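(* Let $G$ be a bounded domain in a real Hilbert space $H$, let $p\in G$, let $\Lambda\subset H$ be a real two-dimensional linear subspace, and write $p=p_\Lambda+p_\perp$ with $p_\Lambda\in\Lambda$, $p_\perp\perp\Lambda$, $a=|p_\Lambda|$, $b=|p_\perp|$. Assume that for some $c>0$ $$G\cap(p+\Lambda)=\{p_\perp+v:v\in\Lambda,\ |v|<c\},$$ and put $s=a/c$, $R=\sqrt{c^2+b^2}$. Suppose that every point $y$ of the boundary circle $\{p_\perp+v:v\in\Lambda,\ |v|=c\}$ satisfies $$\langle X,y\rangle\le R^2\qquad(X\in\overline G).$$ Then $$\sigma_G(p,\Lambda)=(1+s^2)R^2,\qquad M_G(p,\Lambda)=\frac{R^2-|p|^2}{c}.$$ For $y$ on the boundary circle, let $C_y=\{X\in\overline G:\langle X,y\rangle=R^2\}$. A map $F=P[\Phi_F]\in\mathcal F_G^{\mathrm n}(p,\Lambda)$ attains this value (i.e. $\|dF_0\|=M_G(p,\Lambda)$) if and only if $$\Phi_F(\zeta)\in C_{E_s^c(\zeta)}\quad\text{for almost every }\zeta\in\mathbb T.$$ If $C_{E_s^c(\zeta)}=\{E_s^c(\zeta)\}$ for almost every $\zeta\in\mathbb T$, then the only normalized extremal (the only member of $\mathcal F_G^{\mathrm n}(p,\Lambda)$ attaining $M_G(p,\Lambda)$) is $E_s^c$.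
   Context: $\mathbb D$ is the open unit disk in $\mathbb C$, $\mathbb T=\partial\mathbb D$, $m$ is normalized Lebesgue measure on $\mathbb T$. A $C^2$ map $F:\mathbb D\to H$ is harmonic if $\Delta F=0$. For $\Phi\in L^1(\mathbb T,H)$ the (Bochner) Poisson integral is $P[\Phi](re^{i\theta})=\int_{\mathbb T}\frac{1-r^2}{1-2r\cos(\theta-t)+r^2}\Phi(e^{it})\,dm$. Every bounded harmonic $F:\mathbb D\to H$ has a unique (a.e.) boundary function $\Phi_F\in L^\infty(\mathbb T,H)$ with $F=P[\Phi_F]$. $\|dF_0\|$ is the operator norm of the real differential $dF_0:\mathbb R^2\to H$; a nonzero $dF_0$ is conformal if $|dF_0v|=\lambda|v|$ for all $v\in\mathbb R^2$, for some $\lambda>0$. $\mathcal F_G(p,\Lambda)$ is the set of harmonic maps $F:\mathbb D\to G$ with $F(0)=p$, $dF_0\neq0$ conformal, and $dF_0(\mathbb R^2)=\Lambda$; $M_G(p,\Lambda)=\sup\{\|dF_0\|:F\in\mathcal F_G(p,\Lambda)\}$. Choose an orthonormal basis $e_1,e_2$ of $\Lambda$ with $p_\Lambda=ae_1$ ($e_1$ arbitrary if $a=0$). $\mathcal F_G^{\mathrm n}(p,\Lambda)$ is the set of $F\in\mathcal F_G(p,\Lambda)$ with $F_x(0)=\lambda e_1$, $F_y(0)=\lambda e_2$, $\lambda=\|dF_0\|>0$. For $0\le s<1$ let $\mathcal M_s(\zeta)=\frac{s+\zeta}{1+s\zeta}$, $w_s(z)=|1+sz|^2$, $E_s^c(\zeta)=p_\perp+c\operatorname{Re}\mathcal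 M_s(\zeta)e_1+c\operatorname{Im}\mathcal M_s(\zeta)e_2$ for $\zeta\in\overline{\mathbb D}$, and $$I_s^c(\Phi)=\int_{\mathbb T}w_s(z)\langle\Phi(z),E_s^c(z)\rangle\,dm(z).$$ Finally $\sigma_G(p,\Lambda)=\sup\{I_s^c(\Phi_F):F\in\mathcal F_G^{\mathrm n}(p,\Lambda)\}$. *)

(* Defs.v *)
From HB Require Import structures.
From mathcomp Require Import all_boot all_order all_algebra.
From mathcomp Require Import all_classical all_reals all_analysis.
From mathcomp Require Import measurable_realfun complex.

Set Implicit Arguments.
Unset Strict Implicit.
Unset Printing Implicit Defensive.

Import Order.TTheory GRing.Theory Num.Theory.
Import numFieldNormedType.Exports.

Local Open Scope classical_set_scope.
Local Open Scope ring_scope.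

(* The library norm of [R * R] is the max norm; it is used here only for its
   topology. Every metric notion on the plane goes through [enorm]. *)
Definition enorm (R : realType) (v : R * R) : R :=
  Num.sqrt (v.1 ^+ 2 + v.2 ^+ 2).

Definition edot (R : realType) (v w : R * R) : R := v.1 * w.1 + v.2 * w.2.

Definition unit_disk (R : realType) : set (R * R) := [set z | enorm z < 1].
Arguments unit_disk : clear implicits.

Definition e_x (R : realType) : R * R := (1, 0).
Definition e_y (R : realType) : R * R := (0, 1).
Arguments e_x : clear implicits.
Arguments e_y : clear implicits.

(* Normalized Lebesgue measure on the unit circle, as a Borel measure on the
   plane: the image of the uniform distribution on [0, 2 pi] under
   t |-> (cos t, sin t). It is carried by the circle, so "almost every point of
   the circle" is [{ae circle_measure R, forall z, _}], and a function on the
   circle is a function on the plane considered almost everywhere. *)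
Section circle_measure.
Variable R : realType.

Lemma two_pi_gt0 : 0 < pi *+ 2 :> R.
Proof. by rewrite mulr2n addr_gt0// pi_gt0. Qed.

Definition circle_param (t : measurableTypeR R) : R * R := (cos t, sin t).

Lemma measurable_circle_param : measurable_fun [set: measurableTypeR R] circle_param.
Proof.
apply: measurable_fun_pair; apply: continuous_measurable_fun.
  exact: continuous_cos.
exact: continuous_sin.
Qed.

HB.instance Definition _ :=
  isMeasurableFun.Build _ _ _ _ circle_param measurable_circle_param.

Definition circle_measure : probability (R * R)%type R :=
  distribution (uniform_prob two_pi_gt0) circle_param.

End circle_measure.
Arguments circle_measure : clear implicits.

Section bochner.
Context d (T : measurableType d) (R : realType) (H : normedModType R).
Variable mu : probability T R.
Implicit Types (f g : T -> H) (v : H).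

Definition simple_function g :=
  finite_set (range g) /\ forall v, measurable (g @^-1` [set v]).

Definition simple_integral g : H :=
  \sum_(v \in range g) fine (mu (g @^-1` [set v])) *: v.

Definition strongly_measurable f :=
  exists g_ : nat -> T -> H, (forall n, simple_function (g_ n)) /\
    {ae mu, forall x, g_ ^~ x @ \oo --> f x}.

(* f is Bochner integrable with integral v. *)
Definition is_bochner_integral f v :=
  exists g_ : nat -> T -> H,
    [/\ forall n, simple_function (g_ n),
        {ae mu, forall x, g_ ^~ x @ \oo --> f x},
        (fun n => \int[mu]_x (`|f x - g_ n x|)%:E)%E @ \oo --> 0%E &
        (fun n => simple_integral (g_ n)) @ \oo --> v].

Definition Linfty f :=
  strongly_measurable f /\ exists C : R, {ae mu, forall x, `|f x| <= C}.

End bochner.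

Section harmonic.
Context (R : realType) (H : completeNormedModType R).
Implicit Types (F Phi : R * R -> H) (z zeta : R * R).

Definition C1_on_disk F :=
  forall z, unit_disk R z ->
    [/\ derivable F z (e_x R), derivable F z (e_y R),
        {for z, continuous ('D_(e_x R) F)} & {for z, continuous ('D_(e_y R) F)}].

Definition C2_on_disk F :=
  [/\ C1_on_disk F, C1_on_disk ('D_(e_x R) F) & C1_on_disk ('D_(e_y R) F)].

Definition laplacian F z : H :=
  'D_(e_x R) ('D_(e_x R) F) z + 'D_(e_y R) ('D_(e_y R) F) z.

Definition harmonic F :=
  C2_on_disk F /\ forall z, unit_disk R z -> laplacian F z = 0.

(* For z = r e^(i theta) and zeta = e^(i t), [edot z zeta] is
   r cos (theta - t). *)
Definition poisson_kernel z zeta : R :=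
  (1 - enorm z ^+ 2) / (1 - 2 * edot z zeta + enorm z ^+ 2).

(* F = P[Phi] on the disk. *)
Definition is_poisson_integral Phi F :=
  forall z, unit_disk R z ->
    is_bochner_integral (circle_measure R)
      (fun zeta => poisson_kernel z zeta *: Phi zeta) (F z).

(* The boundary function of F, unique up to a null set; the default value is
   used only when there is none, which does not happen for bounded harmonic
   F. *)
Definition boundary_function F : R * R -> H :=
  xget (fun=> 0)
    [set Phi | Linfty (circle_measure R) Phi /\ is_poisson_integral Phi F].

Definition dF0_norm F : R :=
  sup [set `|'d F (0 : R * R) v| | v in [set v : R * R | enorm v <= 1]].

Definition dF0_conformal F :=
  exists2 lambda : R, 0 < lambda &
    forall v : R * R, `|'d F (0 : R * R) v| = lambda * enorm v.

(* Maps of the disk are total functions on the plane of which only the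
   restriction to the disk matters. *)
Definition conformal_maps (G : set H) (p : H) (L : set H) : set (R * R -> H) :=
  [set F | [/\ harmonic F, forall z, unit_disk R z -> G (F z), F 0 = p,
               dF0_conformal F & range ('d F (0 : R * R)) = L]].

(* Suprema are taken in the extended reals, so that an equality with a real
   number also asserts that the set is nonempty and bounded above. *)
Definition M_G (G : set H) (p : H) (L : set H) : \bar R :=
  ereal_sup [set (dF0_norm F)%:E | F in conformal_maps G p L].

Definition normalized_maps (G : set H) (p : H) (L : set H) (e1 e2 : H) :
    set (R * R -> H) :=
  [set F | [/\ conformal_maps G p L F, 0 < dF0_norm F,
               'D_(e_x R) F 0 = dF0_norm F *: e1 &
               'D_(e_y R) F 0 = dF0_norm F *: e2]].

End harmonic.

Section extremal.
Context (R : realType) (H : completeNormedModType R) (ip : {dot H for @idfun R}).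

Definition to_complex (z : R * R) : R[i] := (z.1 +i* z.2)%C.

Definition mobius (s : R) (zeta : R * R) : R[i] :=
  (s%:C%C + to_complex zeta) / (1 + s%:C%C * to_complex zeta).

Definition weight (s : R) (z : R * R) : R :=
  ComplexField.Normc.normc (1 + s%:C%C * to_complex z) ^+ 2.

Definition Emap (pperp e1 e2 : H) (c s : R) (zeta : R * R) : H :=
  pperp + (c * complex.Re (mobius s zeta)) *: e1
        + (c * complex.Im (mobius s zeta)) *: e2.

Definition I_s (pperp e1 e2 : H) (c s : R) (Phi : R * R -> H) : R :=
  \int[circle_measure R]_z (weight s z * ip (Phi z) (Emap pperp e1 e2 c s z)).

Definition sigma_G (G : set H) (p : H) (L : set H) (pperp e1 e2 : H)
    (c s : R) : \bar R :=
  ereal_sup [set (I_s pperp e1 e2 c s (boundary_function F))%:E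
            | F in normalized_maps G p L e1 e2].

Definition contact_set (G : set H) (rho : R) (y : H) : set H :=
  [set X | closure G X /\ ip X y = rho ^+ 2].

Definition domain (G : set H) := [/\ open G, connected G & G !=set0].

Definition span2 (u v : H) : set H :=
  [set w | exists x y : R, w = x *: u + y *: v].

Definition two_dim_subspace (L : set H) :=
  exists u v : H,
    (forall x y : R, x *: u + y *: v = 0 -> x = 0 /\ y = 0) /\ L = span2 u v.

Definition orthonormal_basis2 (e1 e2 : H) (L : set H) :=
  [/\ `|e1| = 1, `|e2| = 1, ip e1 e2 = 0 & L = span2 e1 e2].

End extremal.

(* Main.v *)
(* A bounded harmonic F is the Poisson integral of its boundary function Phi,
   with values in the closure of G almost everywhere (Phi is the limit of
   F (r_n zeta) for radii along which the L2 norms converge fast). Multiplying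
   E_s^c by w_s gives a trigonometric polynomial of degree 1, hence the integral
   of w_s <Phi, E_s^c> depends only on F(0) = p and on dF_0; for a normalized F
   it equals (1 + s^2) R^2 - c (c (1 - s^2) - |dF_0|). Since <Phi, E_s^c> <= R^2
   almost everywhere it is at most (1 + s^2) R^2, so |dF_0| <= c (1 - s^2), with
   equality exactly when <Phi, E_s^c> = R^2 almost everywhere; E_s^c itself is a
   competitor with |dF_0| = c (1 - s^2) = (R^2 - |p|^2) / c. *)
Require Import Defs.
From HB Require Import structures.
From mathcomp Require Import all_boot all_order all_algebra.
From mathcomp Require Import all_classical all_reals all_analysis.
From mathcomp Require Import measurable_realfun complex ring lra.
Import Order.TTheory GRing.Theory Num.Theory.
Import numFieldNormedType.Exports.
Local Open Scope classical_set_scope.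
Local Open Scope ring_scope.
Set Implicit Arguments.
Unset Strict Implicit.
Unset Printing Implicit Defensive.

(** The space H may be nonseparable, and existence, uniqueness and location of the boundary function
    make up the bulk of the work. Most vector statements are tested against a fixed [w] and become
    scalar. Norms are essential in two places: existence, through L2 distances of dilates, and the
    passage from weak to strong equality, where strong measurability supplies countably many test
    vectors. The L2 norms of dilates increase with the radius because the Poisson kernel is
    symmetric on circles, so that a factor of the radius can move from one side of an L2 product to
    the other. The Poisson formula rests on a maximum principle for second differences. The supremum
    [M_G] runs over all conformal maps, not only normalized ones; these are handled by writing the
    weight and E_s^c in the coordinates of an orthonormal frame [u1], [u2] of the source plane. A
    boundary function is known only up to a null set, so it is replaced early by a bounded
    representative that is an everywhere limit of simple functions. *)

Section inner_product.
Context (R : realType) (H : completeNormedModType R) (ip : {dot H for @idfun R}).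
Hypothesis hip : forall x : H, ip x x = `|x| ^+ 2.
Implicit Types x y z : H.

Lemma ipC x y : ip x y = ip y x.
Proof. by have := hermC ip x y; rewrite expr0 mul1r. Qed.

Lemma ipDl x y z : ip (x + y) z = ip x z + ip y z. Proof. exact: linearDl. Qed.
Lemma ipDr x y z : ip x (y + z) = ip x y + ip x z.
Proof. by rewrite ipC ipDl (ipC y) (ipC z). Qed.
Lemma ipZl (k : R) x y : ip (k *: x) y = k * ip x y.
Proof. exact: linearZl_LR. Qed.
Lemma ipZr (k : R) x y : ip x (k *: y) = k * ip x y.
Proof. by rewrite ipC ipZl ipC. Qed.
Lemma ip0l x : ip 0 x = 0. Proof. by rewrite -(scale0r x) ipZl mul0r. Qed.
Lemma ipNl x y : ip (- x) y = - ip x y.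
Proof. by rewrite -scaleN1r ipZl mulN1r. Qed.
Lemma ipNr x y : ip x (- y) = - ip x y. Proof. by rewrite ipC ipNl ipC. Qed.
Lemma ipBl x y z : ip (x - y) z = ip x z - ip y z.
Proof. by rewrite ipDl ipNl. Qed.
Lemma ipBr x y z : ip x (y - z) = ip x y - ip x z.
Proof. by rewrite ipDr ipNr. Qed.

Definition ipE := (ipDl, ipDr, ipNl, ipNr, ipZl, ipZr).

(** Cauchy-Schwarz: the square of [|y|^2 x - <x, y> y] is nonnegative and equals [|y|^2] times the
    difference of the two squared sides. *)
Lemma ip_le_norm x y : `|ip x y| <= `|x| * `|y|.
Proof.
have [->|y0] := eqVneq y 0; first by rewrite ipC ip0l normr0 mulr_ge0.
have ygt0 : 0 < `|y| by rewrite normr_gt0.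
have h : 0 <= ip (`|y| ^+ 2 *: x - ip x y *: y) (`|y| ^+ 2 *: x - ip x y *: y).
  by rewrite hip.
move: h; rewrite !ipE !hip (ipC y x).
rewrite (_ : _ + _ = `|y| ^+ 2 * ((`|x| * `|y|) ^+ 2 - ip x y ^+ 2)); last by ring.
rewrite pmulr_rge0 ?exprn_gt0// subr_ge0 => h.
by rewrite -ler_sqr ?nnegrE ?mulr_ge0// real_normK ?num_real.
Qed.

Lemma ip_eq0 x : (forall y, ip x y = 0) -> x = 0.
Proof.
by move=> /(_ x); rewrite hip => /eqP; rewrite sqrf_eq0 normr_eq0 => /eqP.
Qed.

(** Testing with [y = x] is enough. This is the device that turns scalar estimates, uniform in the
    test vector, into norm estimates. *)
Lemma norm_le_ip x (C : R) : 0 <= C -> (forall y, `|ip x y| <= C * `|y|) -> `|x| <= C.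
Proof.
move=> C0 /(_ x); rewrite hip normrX normr_id expr2.
have [->//|x0] := eqVneq x 0; first by rewrite normr0.
by rewrite ler_pM2r// normr_gt0.
Qed.

Lemma ip_cvg (T : Type) (A : set_system T) {FA : Filter A} (f g : T -> H) x y :
  f @ A --> x -> g @ A --> y -> ip (f t) (g t) @[t --> A] --> ip x y.
Proof.
move=> fx gy.
have E t : ip (f t) (g t) = ip x y + (ip (f t - x) y + ip x (g t - y)
    + ip (f t - x) (g t - y)).
  by rewrite !ipE; ring.
have f0 : `|f t - x| @[t --> A] --> 0.
  by apply/norm_cvg0P; rewrite -(subrr x); apply: cvgB fx (cvg_cst x).
have g0 : `|g t - y| @[t --> A] --> 0.
  by apply/norm_cvg0P; rewrite -(subrr y); apply: cvgB gy (cvg_cst y).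
rewrite (_ : (fun t => ip (f t) (g t)) = fun t => ip x y + (ip (f t - x) y
    + ip x (g t - y) + ip (f t - x) (g t - y))); last exact/funext.
rewrite -[X in _ --> X]addr0; apply: cvgD; first exact: cvg_cst.
apply/norm_cvg0P.
have h : (`|f t - x| * `|y| + `|x| * `|g t - y| + `|f t - x| * `|g t - y|)
    @[t --> A] --> 0.
  rewrite [X in _ --> X](_ : 0 = 0 * `|y| + `|x| * 0 + 0 * 0); last by ring.
  by apply: cvgD; [apply: cvgD|]; apply: cvgM => //; exact: cvg_cst.
apply: (squeeze_cvgr _ (@cvg_cst _ (0 : R) _ A _) h).
apply: nearW => t; rewrite normr_ge0 /=.
apply: le_trans (ler_normD _ _) _; apply: lerD; last exact: ip_le_norm.
by apply: le_trans (ler_normD _ _) _; apply: lerD; exact: ip_le_norm.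
Qed.

Lemma cvg_ipl (T : Type) (A : set_system T) {FA : Filter A} (f : T -> H) x y :
  f @ A --> x -> ip (f t) y @[t --> A] --> ip x y.
Proof. by move=> fx; apply: (ip_cvg fx); exact: cvg_cst. Qed.

End inner_product.

(** * Integration of bounded scalar functions over a probability space *)

Section ae_invariance.
Context d (T : measurableType d) (R : realType).
Variable mu : {measure set T -> \bar R}.
Import HBNNSimple.

(* Measurability is not assumed: a boundary function is only almost everywhere
   equal to a measurable function. *)
Lemma ae_eq_integral_nonmeasurable (f g : T -> \bar R) :
  {ae mu, forall x, f x = g x} ->
  (\int[mu]_x f x = \int[mu]_x g x)%E.
Proof.
move=> [N [mN N0 subN]].
have fg x : ~ N x -> f x = g x by move=> Nx; apply: contrapT => /subN.
rewrite /integral !patch_setT.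
have le_nn (u v : T -> \bar R) : (forall x, 0 <= v x)%E ->
    (forall x, ~ N x -> u x = v x) ->
    (ereal_sup [set sintegral mu h |
      h in [set h : {nnsfun T >-> R} | forall x, (h x)%:E <= u x]] <=
    ereal_sup [set sintegral mu h |
      h in [set h : {nnsfun T >-> R} | forall x, (h x)%:E <= v x]])%E.
  move=> v0 uv; apply/ge_ereal_sup => _ [h hu <-].
  apply: ereal_sup_ubound => /=.
  have mNC : measurable (~` N) by exact: measurableC.
  (* A simple function below [u], set to 0 on the null set [N], lies below [v] everywhere and keeps
     its integral; hence the two suprema that define the integrals agree. *)
  exists (proj_nnsfun h mNC).
    move=> x /=; rewrite mindicE; case: (boolP (x \in ~` N)) => [|_].
      by rewrite inE => Nx; rewrite mulr1 -uv.
    by rewrite mulr0.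
  rewrite -!integralT_nnsfun; apply: ge0_ae_eq_integral => //.
  - exact/measurable_EFinP.
  - exact/measurable_EFinP.
  - by move=> x _; rewrite lee_fin.
  - by move=> x _; rewrite lee_fin.
  exists N; split => // x /= /not_implyP[_].
  rewrite mindicE; apply: contra_notP => Nx.
  by rewrite mem_set// mulr1.
congr (_ - _)%E; apply/eqP; rewrite eq_le; apply/andP; split; apply: le_nn => //;
  move=> x Nx; rewrite ?funeposE ?funenegE fg//.
Qed.

Lemma ae_eq_Rintegral (f g : T -> R) : {ae mu, forall x, f x = g x} ->
  \int[mu]_x f x = \int[mu]_x g x.
Proof.
move=> fg; rewrite /Rintegral; congr fine; apply: ae_eq_integral_nonmeasurable.
by apply: filterS fg => x ->.
Qed.

End ae_invariance.

Section finitely_valued.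
Context d (T : measurableType d).

(** The same condition as [simple_function], but for an arbitrary value type, so that one set of
    closure lemmas serves scalars, vectors and booleans. *)
Definition fin_meas (A : Type) (f : T -> A) :=
  finite_set (range f) /\ forall v, measurable (f @^-1` [set v]).

Lemma fin_meas_cst (A : Type) (a : A) : fin_meas (fun=> a).
Proof.
split; first by apply: (sub_finite_set _ (finite_set1 a)) => _ [_ _ <-].
move=> v; rewrite preimage_cst; case: ifP => _ //.
Qed.

Lemma fin_meas_comp2 (A B C : Type) (f : T -> A) (g : T -> B) (h : A -> B -> C) :
  fin_meas f -> fin_meas g -> fin_meas (fun x => h (f x) (g x)).
Proof.
move=> [ff mf] [fg mg]; split.
  apply: (sub_finite_set _ (finite_image (fun ab => h ab.1 ab.2) (finite_setX ff fg))).
  by move=> _ [x _ <-]; exists (f x, g x) => //; split => /=; exists x.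
move=> v.
rewrite (_ : _ @^-1` _ = \bigcup_(ab in (range f `*` range g) `&` [set ab | h ab.1 ab.2 = v])
    (f @^-1` [set ab.1] `&` g @^-1` [set ab.2])); last first.
  apply/seteqP; split => [x /= hv|x [[a b] [_ /= <-] [/= -> ->]]//].
  by exists (f x, g x) => //=; split => //; split; exists x.
apply: fin_bigcup_measurable.
  by apply: sub_finite_set (finite_setX ff fg) => x [].
by move=> [a b] _; exact: measurableI.
Qed.

Lemma fin_meas_comp (A B : Type) (f : T -> A) (h : A -> B) :
  fin_meas f -> fin_meas (h \o f).
Proof.
by move=> mf; exact: (fin_meas_comp2 (fun a _ => h a) mf (fin_meas_cst tt)).
Qed.

Lemma fin_meas_preimage (A : Type) (f : T -> A) (P : set A) :
  fin_meas f -> measurable (f @^-1` P).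
Proof.
move=> [ff mf]; rewrite (_ : _ @^-1` _ =
    \bigcup_(a in range f `&` P) (f @^-1` [set a])); last first.
  apply/seteqP; split => [x /= Px|x [a [_ Pa] /= ->]//].
  by exists (f x) => //; split => //; exists x.
by apply: fin_bigcup_measurable => //; apply: sub_finite_set ff => x [].
Qed.

Lemma fin_meas_measurable (R : realType) (f : T -> R) :
  fin_meas f -> measurable_fun setT f.
Proof. by move=> mf _ Y _; rewrite setTI; exact: fin_meas_preimage. Qed.

Import HBSimple.
Lemma sfun_fin_meas (R : realType) (f : {sfun T >-> R}) : fin_meas f.
Proof. by split; [exact: fimfunP|move=> v; exact: measurable_sfunP]. Qed.

Lemma fin_meas_patch (A : Type) (a : A) (N : set T) (f : T -> A) :
  measurable N -> fin_meas f -> fin_meas (fun x => if x \in N then f x else a).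
Proof.
move=> mN mf.
apply: (fin_meas_comp2 (fun (b : bool) y => if b then y else a) (f := fun x => x \in N)) => //.
split; first by apply: (sub_finite_set _ (finite_set2 true false)) => -[] _; [left|right].
move=> [].
  rewrite (_ : _ @^-1` _ = N)//; apply/seteqP; split => x /=; first exact: set_mem.
  exact: mem_set.
rewrite (_ : _ @^-1` _ = ~` N); last first.
  apply/seteqP; split => x /=; first by move=> xN Nx; rewrite mem_set in xN.
  exact: memNset.
exact: measurableC.
Qed.

End finitely_valued.

Section bounded_measurable.
Context d (T : measurableType d) (R : realType).
Variable mu : probability T R.
Implicit Types f g : T -> R.

(** The working class of scalar integrands. The bound holds everywhere rather than almost
    everywhere, which makes the class an algebra, and over a probability each member is
    integrable. *)
Definition bmeas f :=
  measurable_fun [set: T] f /\ exists C : R, forall x, `|f x| <= C.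

Lemma bmeas_cst (k : R) : bmeas (fun=> k).
Proof. by split; [exact: measurable_cst|exists `|k|]. Qed.

Lemma bmeasD f g : bmeas f -> bmeas g -> bmeas (fun x => f x + g x).
Proof.
move=> [mf [C fC]] [mg [D gD]]; split; first exact: measurable_funD.
by exists (C + D) => x; apply: le_trans (ler_normD _ _) _; exact: lerD.
Qed.

Lemma bmeasM f g : bmeas f -> bmeas g -> bmeas (fun x => f x * g x).
Proof.
move=> [mf [C fC]] [mg [D gD]]; split; first exact: measurable_funM.
by exists (C * D) => x; rewrite normrM ler_pM.
Qed.

Lemma bmeasZ (k : R) f : bmeas f -> bmeas (fun x => k * f x).
Proof. exact/bmeasM/bmeas_cst. Qed.

Lemma bmeasN f : bmeas f -> bmeas (fun x => - f x).
Proof.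
move=> [mf [C fC]]; split; first exact: measurableT_comp.
by exists C => x; rewrite normrN.
Qed.

Lemma bmeasB f g : bmeas f -> bmeas g -> bmeas (fun x => f x - g x).
Proof. by move=> bf bg; exact/bmeasD/bmeasN. Qed.

Lemma bmeas_norm f : bmeas f -> bmeas (fun x => `|f x|).
Proof.
move=> [mf [C fC]]; split; first exact: measurableT_comp.
by exists C => x; rewrite normr_id.
Qed.

Lemma bmeas_integrable f : bmeas f -> mu.-integrable setT (EFin \o f).
Proof.
move=> [mf [C fC]]; apply: measurable_bounded_integrable => //.
  by apply: le_lt_trans (probability_le1 mu measurableT) _; rewrite ltry.
exists C; split; first by rewrite num_real.
by move=> M CM x _; apply: le_trans (fC x) (ltW CM).
Qed.

Lemma bmeas_fineK f : bmeas f -> (\int[mu]_x f x)%:E = (\int[mu]_x (f x)%:E)%E.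
Proof.
move=> bf; rewrite /Rintegral fineK//.
exact: (integrable_fin_num measurableT (bmeas_integrable bf)).
Qed.

Lemma bintD f g : bmeas f -> bmeas g ->
  \int[mu]_x (f x + g x) = \int[mu]_x f x + \int[mu]_x g x.
Proof. by move=> bf bg; apply: RintegralD => //; exact: bmeas_integrable. Qed.

Lemma bintB f g : bmeas f -> bmeas g ->
  \int[mu]_x (f x - g x) = \int[mu]_x f x - \int[mu]_x g x.
Proof. by move=> bf bg; apply: RintegralB => //; exact: bmeas_integrable. Qed.

Lemma bintZ (k : R) f : bmeas f -> \int[mu]_x (k * f x) = k * \int[mu]_x f x.
Proof. by move=> bf; apply: RintegralZl => //; exact: bmeas_integrable. Qed.

Lemma bint_cst (k : R) : \int[mu]_x k = k.
Proof.
transitivity (\int[mu]_(x in setT) (cst k x)) => //.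
by rewrite Rintegral_cst//= probability_setT /= mulr1.
Qed.

Lemma le_bint f g : bmeas f -> bmeas g -> (forall x, f x <= g x) ->
  \int[mu]_x f x <= \int[mu]_x g x.
Proof. by move=> bf bg fg; apply: le_Rintegral => //; exact: bmeas_integrable. Qed.

Lemma ae_le_bint f g : bmeas f -> bmeas g -> {ae mu, forall x, f x <= g x} ->
  \int[mu]_x f x <= \int[mu]_x g x.
Proof.
move=> bf bg fg.
(* Replacing [g] by the maximum of [f] and [g] changes it only on a null set and makes the
   inequality hold everywhere. *)
rewrite [leRHS](@ae_eq_Rintegral _ _ _ mu _ (fun x => Num.max (f x) (g x))); last first.
  by apply: filterS fg => x; move/max_idPr => ->.
apply: le_bint => //; last by move=> x; rewrite le_max lexx.
case: (bf) (bg) => mf [C fC] [mg [D gD]]; split; first exact: measurable_maxr.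
exists (Num.max C D) => x; rewrite le_max; case: (leP (f x) (g x)) => _.
  by rewrite gD orbT.
by rewrite fC.
Qed.

Lemma le_norm_bint f : bmeas f -> `|\int[mu]_x f x| <= \int[mu]_x `|f x|.
Proof. by move=> bf; apply: le_normr_Rintegral => //; exact: bmeas_integrable. Qed.

Lemma bint_norm_le f (C : R) : bmeas f -> {ae mu, forall x, `|f x| <= C} ->
  `|\int[mu]_x f x| <= C.
Proof.
move=> bf fC; apply: le_trans (le_norm_bint bf) _; rewrite -[leRHS]bint_cst.
by apply: ae_le_bint => //; [exact: bmeas_norm|exact: bmeas_cst].
Qed.

Lemma bint_eq0 f : bmeas f -> (forall x, 0 <= f x) -> \int[mu]_x f x = 0 ->
  {ae mu, forall x, f x = 0}.
Proof.
move=> bf f0 If; have mf : measurable_fun setT (EFin \o f).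
  by apply/measurable_EFinP; case: bf.
have /(ae_eq_integral_abs mu measurableT mf) : (\int[mu]_x `|(EFin \o f) x|)%E = 0%E.
  transitivity (\int[mu]_x f x)%:E; last by rewrite If.
  rewrite bmeas_fineK//; apply: eq_integral => x _ /=.
  by rewrite ger0_norm.
by apply: filterS => x /(_ I) /= [].
Qed.

Lemma bint_cvg (f_ : nat -> T -> R) f (C : R) :
  (forall n, bmeas (f_ n)) -> (forall n x, `|f_ n x| <= C) -> bmeas f ->
  {ae mu, forall x, f_ ^~ x @ \oo --> f x} ->
  \int[mu]_x f_ n x @[n --> \oo] --> \int[mu]_x f x.
Proof.
move=> bf_ f_C bf f_f; apply: fine_cvg; rewrite bmeas_fineK//.
have h1 n : measurable_fun setT (EFin \o f_ n).
  by apply/measurable_EFinP; case: (bf_ n).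
have h2 : measurable_fun setT (EFin \o f) by apply/measurable_EFinP; case: bf.
have h3 : {ae mu, forall x, setT x -> (EFin \o f_ n) x @[n --> \oo] --> (EFin \o f) x}.
  by apply: filterS f_f => x fx _; apply: cvg_EFin => //; exact: nearW.
have h4 : mu.-integrable setT (EFin \o cst C).
  exact: finite_measure_integrable_cst.
have h5 : {ae mu, forall x n, setT x -> (`|(EFin \o f_ n) x| <= (EFin \o cst C) x)%E}.
  by apply: aeW => x n _ /=; rewrite lee_fin.
have [_ _ h] := dominated_convergence measurableT h1 h2 h3 h4 h5.
exact: h.
Qed.

Lemma bint_near_cvg0 (f_ : nat -> T -> R) (C : R) :
  (forall n, bmeas (f_ n)) -> (forall n x, `|f_ n x| <= C) ->
  {ae mu, forall x, f_ ^~ x @ \oo --> 0} ->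
  \int[mu]_x f_ n x @[n --> \oo] --> 0.
Proof.
move=> bf_ f_C f_0; rewrite -(bint_cst 0).
by apply: (bint_cvg bf_ f_C) => //; exact: bmeas_cst.
Qed.

End bounded_measurable.

(** * Pointwise limits of simple functions *)

Section pointwise_limits.
Context d (T : measurableType d).

(** Strong measurability with an empty exceptional set: everywhere convergence is preserved by any
    sequentially continuous operation, in any topological space. *)
Definition sm (V : topologicalType) (f : T -> V) :=
  exists g_ : nat -> T -> V,
    (forall n, fin_meas (g_ n)) /\ forall x, g_ ^~ x @ \oo --> f x.

Definition seq_continuous2 (U V W : topologicalType) (h : U -> V -> W) :=
  forall (u_ : nat -> U) (v_ : nat -> V) u v, u_ @ \oo --> u -> v_ @ \oo --> v ->
    h (u_ n) (v_ n) @[n --> \oo] --> h u v.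

Lemma sm_comp2 (U V W : topologicalType) (h : U -> V -> W) f g :
  seq_continuous2 h -> sm f -> sm g -> sm (fun x => h (f x) (g x)).
Proof.
move=> ch [f_ [mf ff]] [g_ [mg gg]].
exists (fun n x => h (f_ n x) (g_ n x)); split => [n|x]; first exact: fin_meas_comp2.
by apply: ch; [exact: ff|exact: gg].
Qed.

Lemma sm_measurable (R : realType) (f : T -> R) : sm f -> measurable_fun setT f.
Proof.
move=> [g_ [mg gf]]; apply: (measurable_fun_cvg (h := g_)) => // n.
exact: fin_meas_measurable.
Qed.

Import HBSimple.
Lemma measurable_sm (R : realType) (f : T -> R) : measurable_fun setT f -> sm f.
Proof.
move=> /measurable_EFinP mf.
have [g_ g_f] := approximation_sfun measurableT mf.
exists (fun n => g_ n); split => [n|x]; first exact: sfun_fin_meas.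
by have /fine_cvg := g_f x I.
Qed.

End pointwise_limits.

Lemma sm_comp d1 d2 (T1 : measurableType d1) (T2 : measurableType d2)
    (V : topologicalType) (f : T2 -> V) (p : T1 -> T2) :
  measurable_fun setT p -> sm f -> sm (f \o p).
Proof.
move=> mp [g_ [mg gf]]; exists (fun n => g_ n \o p); split => [n|x]; last exact: gf.
have [fg mgn] := mg n; split.
  by apply: sub_finite_set fg => _ [x _ <-]; exists (p x).
move=> v; rewrite comp_preimage.
by have := mp measurableT _ (mgn v); rewrite setTI.
Qed.

(** The coordinates of the plane are approximated by simple functions and [f] is applied afterwards,
    so the approximants take finitely many values whatever the target space; no separability
    enters. *)
Lemma continuous_sm (R : realType) (V : topologicalType) (f : R * R -> V) :
  continuous f -> sm f.
Proof.
move=> cf.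
have [g_ [mg gf]] : sm (@fst R R) by apply: measurable_sm; exact: measurable_fst.
have [h_ [mh hf]] : sm (@snd R R) by apply: measurable_sm; exact: measurable_snd.
exists (fun n x => f (g_ n x, h_ n x)); split => [n|x].
  exact: (fin_meas_comp2 (fun a b => f (a, b))).
apply: continuous_cvg; first exact: cf.
rewrite {3}[x]surjective_pairing.
by apply: (cvg_pair (F := \oo) (G := nbhs x.1) (H := nbhs x.2)); [exact: gf|exact: hf].
Qed.

Lemma continuous_measurable_plane (R : realType) (f : R * R -> R) :
  continuous f -> measurable_fun setT f.
Proof. by move=> /continuous_sm /sm_measurable. Qed.

(** * Bounded strongly measurable maps and the Bochner integral *)

Section hilbert_valued.
Context d (T : measurableType d) (R : realType) (H : completeNormedModType R).
Context (ip : {dot H for @idfun R}).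
Hypothesis hip : forall x : H, ip x x = `|x| ^+ 2.
Variable mu : probability T R.
Implicit Types f g : T -> H.

Lemma sc_ip : seq_continuous2 (fun x y : H => ip x y : R).
Proof. by move=> u_ v_ u v uu vv; exact: (ip_cvg hip). Qed.

Lemma sc_sub_norm : seq_continuous2 (fun x y : H => `|x - y|).
Proof. by move=> u_ v_ u v uu vv; apply: cvg_norm; exact: cvgB. Qed.

Lemma sc_scale : seq_continuous2 (fun (k : R) (y : H) => k *: y).
Proof. by move=> u_ v_ u v uu vv; exact: cvgZ. Qed.

Lemma sc_sub : seq_continuous2 (fun (x y : H) => x - y).
Proof. by move=> u_ v_ u v uu vv; exact: cvgB. Qed.

Lemma sm_cst (v : H) : sm (fun _ : T => v).
Proof. by exists (fun _ _ => v); split => [n|x]; [exact: fin_meas_cst|exact: cvg_cst]. Qed.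

Lemma fin_meas_sm (f : T -> H) : fin_meas f -> sm f.
Proof. by move=> mf; exists (fun=> f); split => // x; exact: cvg_cst. Qed.

(** The vector-valued counterpart of [bmeas]. *)
Definition bsm f := sm f /\ exists C : R, forall x, `|f x| <= C.

Lemma bsm_ip f g : bsm f -> bsm g -> bmeas (fun x => ip (f x) (g x)).
Proof.
move=> [mf [C fC]] [mg [D gD]]; split.
  by apply: sm_measurable; exact: (sm_comp2 sc_ip).
by exists (C * D) => x; apply: le_trans (ip_le_norm hip _ _) _; exact: ler_pM.
Qed.

Lemma bsm_cst (v : H) : bsm (fun _ : T => v).
Proof. by split; [exact: sm_cst|exists `|v|]. Qed.

Lemma bsm_ipl f v : bsm f -> bmeas (fun x => ip (f x) v).
Proof. by move=> bf; apply: bsm_ip => //; exact: bsm_cst. Qed.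

Lemma bsm_sub f g : bsm f -> bsm g -> bsm (fun x => f x - g x).
Proof.
move=> [mf [C fC]] [mg [D gD]]; split; first exact: (sm_comp2 sc_sub).
by exists (C + D) => x; apply: le_trans (ler_normB _ _) _; exact: lerD.
Qed.

Lemma bsm_scale (k : T -> R) f : bmeas k -> bsm f -> bsm (fun x => k x *: f x).
Proof.
move=> [mk [C kC]] [mf [D fD]]; split.
  by apply: (sm_comp2 sc_scale) => //; exact: measurable_sm.
by exists (C * D) => x; rewrite normrZ ler_pM.
Qed.

Lemma bsm_norm f : bsm f -> bmeas (fun x => `|f x|).
Proof.
move=> [mf [C fC]]; split; last by exists C => x; rewrite normr_id.
rewrite (_ : (fun _ => _) = fun x => `|f x - 0|); last by apply/funext => x; rewrite subr0.
by apply: sm_measurable; apply: (sm_comp2 sc_sub_norm) => //; exact: sm_cst.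
Qed.

Lemma fin_meas_bsm f : fin_meas f -> bsm f.
Proof.
move=> mf; split; first exact: fin_meas_sm.
have [[fr _]] := (mf, tt).
have : finite_set [set `|y| | y in range f] by exact: finite_image.
move=> /finite_seqP[s Es].
exists (\sum_(y <- s) `|y|) => x.
have : `|f x| \in s.
  have : [set `|y| | y in range f] `|f x| by exists (f x) => //; exists x.
  by rewrite Es.
move=> xs; rewrite (big_rem _ xs)/= normr_id lerDl.
by apply: sumr_ge0 => i _.
Qed.

Lemma bsm_approx f : bsm f -> exists g_ : nat -> T -> H,
  [/\ forall n, fin_meas (g_ n), forall x, g_ ^~ x @ \oo --> f x &
      exists C : R, forall n x, `|g_ n x| <= C].
Proof.
move=> [[g_ [mg gf]] [C fC]].
(* Values of norm above the threshold are sent to 0. Since [|f x| <= |C|], the margin 1 ensures that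
   at each point the truncation is eventually inactive. *)
pose tr (y : H) : H := if `|y| <= `|C| + 1 then y else 0.
exists (fun n => tr \o g_ n); split => [n|x|]; first exact: fin_meas_comp.
  have near_le : \forall n \near \oo, `|g_ n x| <= `|C| + 1.
    have /cvgrPdist_lt/(_ 1 ltr01) := gf x; apply: filterS => n h.
    rewrite -[g_ n x](subrK (f x)) (le_trans (ler_normD _ _))// addrC.
    by rewrite lerD ?(le_trans (fC x)) ?ler_norm// distrC ltW.
  apply: cvg_trans (gf x); apply: near_eq_cvg.
  by apply: filterS near_le => n; rewrite /= /tr => ->.
exists (`|C| + 1) => n x; rewrite /= /tr; case: ifP => //.
by rewrite normr0 addr_ge0.
Qed.

Lemma ip_simple_integral g w : fin_meas g ->
  ip (simple_integral mu g) w = \int[mu]_x ip (g x) w.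
Proof.
move=> mg; rewrite /simple_integral fsbig_finite; last exact: mg.1.
set s := (X in \sum_(i <- X) _).
have ipS (t : seq H) (F : H -> H) :
    ip (\sum_(v <- t) F v) w = \sum_(v <- t) ip (F v) w.
  by elim: t => [|v t IH]; rewrite ?big_nil ?ip0l// !big_cons ipDl IH.
rewrite ipS.
have bi v : bmeas (\1_(g @^-1` [set v]) : T -> R).
  split; first exact/measurable_indic/mg.2.
  by exists 1 => x; rewrite indicE; case: (_ \in _); rewrite ?normr1 ?normr0.
have bS (t : seq H) : bmeas (fun x => \sum_(v <- t) ip v w * \1_(g @^-1` [set v]) x).
  elim: t => [|v t IH].
    by under eq_fun do rewrite big_nil; exact: bmeas_cst.
  under eq_fun do rewrite big_cons.
  by apply: bmeasD => //; exact: bmeasZ.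
have intS (t : seq H) : \int[mu]_x (\sum_(v <- t) ip v w * \1_(g @^-1` [set v]) x) =
    \sum_(v <- t) ip v w * fine (mu (g @^-1` [set v])).
  elim: t => [|v t IH].
    by under eq_Rintegral do rewrite big_nil; rewrite bint_cst big_nil.
  under eq_Rintegral do rewrite big_cons.
  rewrite bintD//; last exact: bmeasZ.
  rewrite IH big_cons bintZ//; congr (_ * _ + _).
  rewrite /Rintegral integral_indic ?setIT//; exact: mg.2.
transitivity (\sum_(v <- s) ip v w * fine (mu (g @^-1` [set v]))).
  by apply: eq_bigr => v _; rewrite ipZl mulrC.
rewrite -intS; apply: eq_Rintegral => x _.
have gs : g x \in s.
  rewrite in_fset_set; last exact: mg.1.
  by apply/mem_set; exists x.
(* At the point [x] only the term of the value [g x] survives in the sum of indicators. *)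
rewrite (big_rem _ gs)/= indicE mem_set// mulr1 big_seq big1 ?addr0// => v.
rewrite (mem_rem_uniq _ (finmap.fset_uniq _)) => /andP[/= vg _].
rewrite indicE memNset ?mulr0//= => gv; move: vg; rewrite -gv eqxx.
by [].
Qed.

(** Paired with [w], the error of the n-th simple integral is at most [|w|] times the integral of
    [|f - g_n|]; by [norm_le_ip] the simple integrals then converge in norm. Bochner integrals can
    thus be verified through scalar identities. *)
Lemma bochner_of_weak f v : bsm f ->
  (forall w, ip v w = \int[mu]_x ip (f x) w) -> is_bochner_integral mu f v.
Proof.
move=> bf fv; have [g_ [mg gf [C gC]]] := bsm_approx bf.
have bg n : bsm (g_ n) by exact: fin_meas_bsm.
have bfg n : bmeas (fun x => `|f x - g_ n x|) by exact/bsm_norm/bsm_sub.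
have [_ [D fD]] := bf.
have I0 : \int[mu]_x `|f x - g_ n x| @[n --> \oo] --> 0.
  apply: (@bint_near_cvg0 _ _ _ mu _ (D + C)) => //.
    move=> n x; rewrite normr_id (le_trans (ler_normB _ _))// lerD//.
  apply: aeW => x; apply/norm_cvg0P; rewrite -(subrr (f x)).
  by apply: cvgB; [exact: cvg_cst|exact: gf].
exists g_; split => //; first exact: aeW.
  under eq_fun do rewrite -bmeas_fineK//.
  by apply: cvg_EFin => //; exact: nearW.
apply/cvgrPdist_le => e e0; have /cvgr0_norm_le/(_ e e0) := I0.
apply: filterS => n; apply: le_trans.
rewrite ger0_norm; last exact: Rintegral_ge0.
apply: (norm_le_ip hip); first exact: Rintegral_ge0.
move=> w; rewrite ipBl fv ip_simple_integral// -bintB; last 2 first.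
  exact: bsm_ipl.
  exact: bsm_ipl.
apply: le_trans (le_norm_bint _ (bmeasB (bsm_ipl w bf) (bsm_ipl w (bg n)))) _.
rewrite mulrC -bintZ//; apply: le_bint.
- exact/bmeas_norm/bmeasB/bsm_ipl/bg/bsm_ipl.
- exact: bmeasZ.
by move=> x; rewrite -ipBl mulrC ip_le_norm.
Qed.

Lemma is_bochner_ae f f' v : {ae mu, forall x, f x = f' x} ->
  is_bochner_integral mu f v -> is_bochner_integral mu f' v.
Proof.
move=> ff' [g_ [sg gf g0 gv]]; exists g_; split => //.
  by apply: filterS2 gf ff' => x h <-.
rewrite (_ : (fun _ => _) = (fun n => \int[mu]_x (`|f x - g_ n x|)%:E)%E)//.
apply/funext => n; apply: ae_eq_integral_nonmeasurable.
by apply: filterS ff' => x ->.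
Qed.

(** The approximating sequence is the one given by the definition, with no bound uniform in [n]; the
    pairings converge because the L1 error tends to 0. *)
Lemma bochner_weak f v w : bsm f -> is_bochner_integral mu f v ->
  ip v w = \int[mu]_x ip (f x) w.
Proof.
move=> bf [g_ [sg gf g0 gv]].
have bg n : bsm (g_ n) by apply: fin_meas_bsm; exact: sg.
have bfg n : bmeas (fun x => `|f x - g_ n x|) by exact/bsm_norm/bsm_sub.
have I0 : \int[mu]_x `|f x - g_ n x| @[n --> \oo] --> 0.
  apply: fine_cvg; move: g0; under eq_fun do rewrite -bmeas_fineK//.
  by [].
have h1 : ip (simple_integral mu (g_ n)) w @[n --> \oo] --> ip v w.
  exact: cvg_ipl.
apply: (cvg_unique _ h1) => //.
apply/cvgrPdist_le => e e0.
have : `|w| * \int[mu]_x `|f x - g_ n x| @[n --> \oo] --> 0.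
  by rewrite -(mulr0 `|w|); apply: cvgM => //; exact: cvg_cst.
move=> /cvgr0_norm_le/(_ e e0); apply: filterS => n; apply: le_trans.
rewrite (ip_simple_integral _ (sg n)) -bintB; last 2 first.
  exact: bsm_ipl.
  exact: bsm_ipl.
apply: le_trans (le_norm_bint _ (bmeasB (bsm_ipl w bf) (bsm_ipl w (bg n)))) _.
rewrite ger0_norm; last by apply: mulr_ge0 => //; exact: Rintegral_ge0.
rewrite -bintZ//; apply: le_bint.
- exact/bmeas_norm/bmeasB/bsm_ipl/bg/bsm_ipl.
- exact: bmeasZ.
by move=> x; rewrite -ipBl mulrC ip_le_norm.
Qed.

(** The function and its approximants are set to 0 on the union of the two exceptional null sets,
    one for convergence and one for the bound. *)
Lemma Linfty_bsm f : Linfty mu f ->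
  exists2 f', bsm f' & {ae mu, forall x, f x = f' x}.
Proof.
move=> [[g_ [sg [N1 [mN1 N10 sub1]]]] [C [N2 [mN2 N20 sub2]]]].
pose N := N1 `|` N2; have mN : measurable N by exact: measurableU.
have mNC := measurableC mN.
exists (fun x => if x \in ~` N then f x else 0).
  split; last first.
    exists `|C| => x; case: ifP => [|_]; last by rewrite normr0.
    rewrite inE => Nx; apply: le_trans (ler_norm _).
    by apply: contrapT => fC; apply: Nx; right; exact: sub2.
  exists (fun n x => if x \in ~` N then g_ n x else 0); split => [n|x].
    exact: (fin_meas_patch _ mNC (sg n)).
  case: ifP => [|_]; last exact: cvg_cst.
  by rewrite inE => Nx; apply: contrapT => fC; apply: Nx; left; exact: sub1.
exists N; split => //; first by apply: null_set_setU => //.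
move=> x /=; apply: contra_notP => Nx.
by rewrite mem_set.
Qed.

End hilbert_valued.

(** * Euclidean plane, circle averages and the Poisson kernel *)

Section plane.
Context (R : realType).
Implicit Types (z zeta eta v w : R * R).
Local Notation cm := (circle_measure R).

Lemma enorm_ge0 z : 0 <= enorm z. Proof. exact: sqrtr_ge0. Qed.
Hint Resolve enorm_ge0 : core.

Lemma sqr_enorm z : enorm z ^+ 2 = z.1 ^+ 2 + z.2 ^+ 2.
Proof. by rewrite sqr_sqrtr// addr_ge0 ?sqr_ge0. Qed.

Lemma enorm0 : enorm (0 : R * R) = 0.
Proof. by rewrite /enorm /= expr0n/= addr0 sqrtr0. Qed.

Lemma enormZ (k : R) z : enorm (k *: z) = `|k| * enorm z.
Proof.
by rewrite /enorm /= !exprMn -mulrDr sqrtrM ?sqr_ge0// sqrtr_sqr.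
Qed.

Lemma edotC z w : edot z w = edot w z.
Proof. by rewrite /edot mulrC (mulrC z.2). Qed.

Lemma edotZl (k : R) z w : edot (k *: z) w = k * edot z w.
Proof. by rewrite /edot /= mulrDr !mulrA. Qed.

Lemma edot_le z w : `|edot z w| <= enorm z * enorm w.
Proof.
rewrite -ler_sqr ?nnegrE ?mulr_ge0// real_normK ?num_real// exprMn !sqr_enorm /edot.
have := sqr_ge0 (z.1 * w.2 - z.2 * w.1); nra.
Qed.

Lemma enorm_fst z : `|z.1| <= enorm z.
Proof. by rewrite -sqrtr_sqr ler_wsqrtr// lerDl sqr_ge0. Qed.

Lemma enorm_snd z : `|z.2| <= enorm z.
Proof. by rewrite -sqrtr_sqr ler_wsqrtr// lerDr sqr_ge0. Qed.

Lemma enorm_le_sum z : enorm z <= `|z.1| + `|z.2|.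
Proof.
rewrite -ler_sqr ?nnegrE// ?addr_ge0// sqr_enorm sqrrD !real_normK ?num_real//.
by rewrite lerD2r lerDl mulrn_wge0// mulr_ge0.
Qed.

Lemma continuous_fst_plane : continuous (fst : R * R -> R).
Proof. by move=> z; exact: cvg_fst. Qed.

Lemma continuous_snd_plane : continuous (snd : R * R -> R).
Proof. by move=> z; exact: cvg_snd. Qed.

Lemma continuous_enorm : continuous (@enorm R).
Proof.
move=> z; apply: (@continuous_comp _ _ _ (fun z : R * R =>
  z.1 ^+ 2 + z.2 ^+ 2) (@Num.sqrt R)); last exact: sqrt_continuous.
apply: cvgD; rewrite !expr2; apply: cvgM;
  by [exact: continuous_fst_plane|exact: continuous_snd_plane].
Qed.

Lemma continuous_edot w : continuous (edot w).
Proof.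
move=> z; apply: cvgD; apply: cvgM; by [exact: cvg_cst|exact: continuous_fst_plane
  |exact: continuous_snd_plane].
Qed.

Lemma open_unit_disk : open (unit_disk R).
Proof.
rewrite (_ : unit_disk R = @enorm R @^-1` [set x | x < 1])//.
by apply: open_comp; [move=> z _; exact: continuous_enorm|exact: open_lt].
Qed.

Lemma enorm_circle_param (t : R) : enorm (circle_param t) = 1.
Proof. by rewrite /enorm/= cos2Dsin2 sqrtr1. Qed.

Lemma ae_circle : {ae cm, forall eta, enorm eta = 1}.
Proof.
exists (~` [set eta | enorm eta = 1]); split => //.
  apply: measurableC; rewrite (_ : [set _ | _] = @enorm R @^-1` [set 1])//.
  rewrite -[_ @^-1` _]setTI.
  by apply: (continuous_measurable_plane continuous_enorm) => //; exact: measurable_set1.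
transitivity (uniform_prob (@two_pi_gt0 R)
  (@circle_param R @^-1` (~` [set eta | enorm eta = 1]))) => //.
rewrite (_ : _ @^-1` _ = set0) ?measure0//.
by apply/seteqP; split => // t /=; rewrite enorm_circle_param.
Qed.

Lemma circle_integralE (f : R * R -> R) : measurable_fun setT f ->
  bmeas (f \o @circle_param R) ->
  \int[cm]_x f x = \int[uniform_prob (@two_pi_gt0 R)]_t f (circle_param t).
Proof.
move=> mf bf; rewrite /Rintegral /circle_measure; congr fine.
rewrite integral_distribution//; first exact/measurable_EFinP.
exact: bmeas_integrable.
Qed.

Lemma polar_unit z : enorm z = 1 -> exists th : R, z = circle_param th.
Proof.
move=> z1; have z12 : z.1 ^+ 2 + z.2 ^+ 2 = 1 by rewrite -sqr_enorm z1 expr1n.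
have zi : -1 <= z.1 <= 1 by rewrite -ler_norml (le_trans (enorm_fst z))// z1.
have s : sin (acos z.1) = `|z.2|.
  by rewrite sin_acos// (_ : 1 - _ = z.2 ^+ 2) ?sqrtr_sqr// -z12; ring.
have [z2|z2] := leP 0 z.2.
  exists (acos z.1); rewrite /circle_param acosK ?in_itv//= s ger0_norm//.
  by case: (z).
exists (- acos z.1); rewrite /circle_param cosN sinN acosK ?in_itv//= s ltr0_norm//.
by rewrite opprK; case: (z).
Qed.

Lemma polar z : exists th : R, z = enorm z *: circle_param th.
Proof.
have [z0|z0] := eqVneq (enorm z) 0.
  exists 0; rewrite z0 scale0r; move: (enorm_fst z) (enorm_snd z); rewrite z0.
  by rewrite !normr_le0 => /eqP h1 /eqP h2; rewrite (surjective_pairing z) h1 h2.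
have [|th E] := @polar_unit ((enorm z)^-1 *: z).
  by rewrite enormZ ger0_norm ?invr_ge0// mulVf.
by exists th; rewrite -E scalerA divff// scale1r.
Qed.

Lemma continuous_cos_affine (k ph : R) : continuous (fun t => cos (k * t - ph)).
Proof.
move=> t; apply: continuous_comp; last exact: continuous_cos.
by apply: cvgB; [apply: cvgM; [exact: cvg_cst|exact: cvg_id]|exact: cvg_cst].
Qed.

Lemma bmeas_cos_affine (k ph : R) : bmeas (fun t : measurableTypeR R => cos (k * t - ph)).
Proof.
split; last by exists 1 => t; exact: cos_max.
by apply: continuous_measurable_fun; exact: continuous_cos_affine.
Qed.

Lemma uniform_cos (k : nat) (ph : R) :
  \int[uniform_prob (@two_pi_gt0 R)]_t cos (k.+1%:R * t - ph) = 0.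
Proof.
have bc := bmeas_cos_affine k.+1%:R ph.
(* Adding 1 makes the integrand nonnegative, as the formula for integrals against the uniform law
   requires; the constant is removed at the end. *)
pose f t : R := 1 + cos (k.+1%:R * t - ph).
pose F t : R := t + k.+1%:R^-1 * sin (k.+1%:R * t - ph).
have k0 : k.+1%:R != 0 :> R by [].
have dg t : is_derive t (1 : R) (fun t => k.+1%:R * t - ph) k.+1%:R.
  by apply: is_derive_eq; rewrite ?scaler0 ?addr0 ?subr0 ?scale1r /GRing.scale/= ?mulr1 ?oppr0
    ?add0r ?addr0 //.
have dF t : is_derive t (1 : R) F (f t).
  have := is_deriveD (is_derive_id t (1 : R))
    (is_deriveZ k.+1%:R^-1 (is_derive1_comp (is_derive_sin _) (dg t))).
  move=> h; apply: (is_derive_eq h).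
  rewrite /f; congr (_ + _); rewrite /GRing.scale/= mulrCA mulVf ?mulr1//.
have cf : continuous f.
  by move=> t; apply: cvgD; [exact: cvg_cst|exact: continuous_cos_affine].
have cF : continuous F.
  by move=> t; apply: differentiable_continuous; apply/derivable1_diffP/ex_derive.
have I1 : \int[uniform_prob (@two_pi_gt0 R)]_t f t = 1.
  apply: EFin_inj; rewrite bmeas_fineK; last by apply: bmeasD => //; exact: bmeas_cst.
  rewrite integral_uniform; last 2 first.
  - by apply/measurable_EFinP; apply: continuous_measurable_fun.
  - move=> t; rewrite lee_fin /f -(subrr 1) -[X in _ - X]opprK opprK.
    by rewrite lerD2l; have /ler_normlP[] := cos_max (k.+1%:R * t - ph); lra.
  rewrite (@continuous_FTC2 _ f F) ?two_pi_gt0//.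
  - rewrite -EFinB -EFinM subr0; congr EFin; rewrite /F mulr0 !add0r.
    have -> : sin (k.+1%:R * (pi *+ 2) - ph) = sin (- ph).
      have := periodicn (@sinD2pi R) k.+1 (- ph).
      by rewrite addrC mulr_natl.
    by rewrite addrK mulVf// gt_eqF// two_pi_gt0.
  - by move=> t; apply: continuous_subspaceT.
  - split; first by move=> t _; exact: ex_derive.
      by apply: cvg_at_right_filter; exact: cF.
    by apply: cvg_at_left_filter; exact: cF.
  - by move=> t _; rewrite derive1E; exact: derive_val.
move: I1; rewrite bintD//; last exact: bmeas_cst.
by rewrite bint_cst => /eqP; rewrite -subr_eq0 addrAC subrr add0r => /eqP.
Qed.

(** Partial sum of the Fourier series of the Poisson kernel, 1 + 2 (r cos ph + ... + r^n cos (n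
    ph)). *)
Fixpoint poisson_partial (r ph : R) (n : nat) : R :=
  if n is n'.+1 then poisson_partial r ph n' + 2 * r ^+ n * cos (n%:R * ph) else 1.

Lemma cos_recr (n : nat) (ph : R) :
  2 * cos ph * cos (n.+1%:R * ph) = cos (n.+2%:R * ph) + cos (n%:R * ph).
Proof.
rewrite (_ : n.+2%:R * ph = n.+1%:R * ph + ph); last by rewrite -!natr1; ring.
rewrite (_ : n%:R * ph = n.+1%:R * ph - ph); last by rewrite -!natr1; ring.
by rewrite cosD cosB; ring.
Qed.

(** By the three-term recurrence of the cosines, multiplication by the kernel denominator telescopes
    and leaves the numerator 1 - r^2 plus a remainder of order r^(n+1). *)
Lemma poisson_partialE (r ph : R) (n : nat) :
  (1 - 2 * r * cos ph + r ^+ 2) * poisson_partial r ph n =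
  1 - r ^+ 2 - 2 * r ^+ n.+1 * cos (n.+1%:R * ph) + 2 * r ^+ n.+2 * cos (n%:R * ph).
Proof.
elim: n => [|n IH]; first by rewrite /= mul1r mul0r cos0; ring.
rewrite /= mulrDr IH.
have := cos_recr n ph; set c0 := cos (n%:R * ph); set c1 := cos (n.+1%:R * ph).
set c2 := cos (n.+2%:R * ph) => E.
rewrite (_ : _ * (2 * _ * c1) = 2 * (r ^+ n.+1 + r ^+ n.+3) * c1 -
   2 * r ^+ n.+2 * (2 * cos ph * c1)); last by rewrite !exprS; ring.
by rewrite E !exprS; ring.
Qed.

(* The maximum is inactive on the circle ([pkE]); it bounds the kernel on the
   whole plane, where the functions of [circle_measure] live. *)
Definition pkr (r x : R) : R :=
  (1 - r ^+ 2) / Num.max ((1 - r) ^+ 2) (1 - 2 * x + r ^+ 2).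

Definition pk z eta : R := pkr (enorm z) (edot z eta).

Section kernel.
Variable r : R.
Hypothesis r01 : 0 <= r < 1.

Lemma pkr_den_gt0 x : 0 < Num.max ((1 - r) ^+ 2) (1 - 2 * x + r ^+ 2).
Proof. by rewrite lt_max exprn_gt0// subr_gt0; case/andP: r01. Qed.

Lemma pkr_ge0 x : 0 <= pkr r x.
Proof.
apply: divr_ge0; last exact/ltW/pkr_den_gt0.
by rewrite subr_ge0 expr_le1//; case/andP: r01 => // _ /ltW.
Qed.

Lemma pkr_le x : pkr r x <= (1 - r ^+ 2) / (1 - r) ^+ 2.
Proof.
case/andP: r01 => r0 r1.
apply: ler_wpM2l; first by rewrite subr_ge0 expr_le1// ltW.
rewrite lef_pV2 ?posrE ?pkr_den_gt0// ?exprn_gt0 ?subr_gt0//.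
by rewrite le_max lexx.
Qed.

Lemma continuous_pkr : continuous (pkr r).
Proof.
have cd : continuous ((fun=> (1 - r) ^+ 2) \max (fun x : R => 1 - 2 * x + r ^+ 2)).
  apply: max_fun_continuous => x; first exact: cvg_cst.
  apply: cvgD; last exact: cvg_cst; apply: cvgB; first exact: cvg_cst.
  by apply: cvgM; [exact: cvg_cst|exact: cvg_id].
move=> x; apply: cvgM; first exact: cvg_cst.
by apply: cvgV; [rewrite gt_eqF// pkr_den_gt0|exact: cd].
Qed.

End kernel.

Lemma enorm01 z : enorm z < 1 -> 0 <= enorm z < 1.
Proof. by move=> ->; rewrite enorm_ge0. Qed.

Lemma pk_ge0 z eta : enorm z < 1 -> 0 <= pk z eta.
Proof. by move=> z1; apply: pkr_ge0; exact: enorm01. Qed.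

Lemma bmeas_pk z : enorm z < 1 -> bmeas (pk z).
Proof.
move=> z1; split.
  apply: continuous_measurable_plane => eta.
  apply: (@continuous_comp _ _ _ (edot z) (pkr (enorm z))); first exact: continuous_edot.
  exact/continuous_pkr/enorm01.
exists ((1 - enorm z ^+ 2) / (1 - enorm z) ^+ 2) => eta.
by rewrite ger0_norm ?pk_ge0//; apply: pkr_le; exact: enorm01.
Qed.

Lemma poisson_den_ge z eta : enorm eta = 1 ->
  (1 - enorm z) ^+ 2 <= 1 - 2 * edot z eta + enorm z ^+ 2.
Proof. by move=> e1; have := edot_le z eta; rewrite e1 mulr1 ler_norml; lra. Qed.

Lemma pkE z eta : enorm eta = 1 -> pk z eta = poisson_kernel z eta.
Proof. by move=> e1; rewrite /pk /pkr max_r// poisson_den_ge. Qed.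

(** Each Fourier partial sum has mean 1, and the partial sums converge to the kernel uniformly on
    the circle. *)
Lemma int_pk z : enorm z < 1 -> \int[cm]_eta pk z eta = 1.
Proof.
move=> z1; have [th zE] := polar z; set r := enorm z in zE z1 *.
have r01 : 0 <= r < 1 by rewrite enorm_ge0.
have [r0 _] := andP r01.
pose U := uniform_prob (@two_pi_gt0 R).
pose f n t := poisson_partial r (t - th) n.
have bf n : bmeas (f n : measurableTypeR R -> R).
  elim: n => [|n IH]; first exact: bmeas_cst.
  apply: bmeasD => //; apply: bmeasZ.
  by under eq_fun do rewrite mulrBr; exact: bmeas_cos_affine.
have If n : \int[U]_t f n t = 1.
  elim: n => [|n IH]; first exact: bint_cst.
  have bc : bmeas (fun t : measurableTypeR R => cos (n.+1%:R * (t - th))).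
    by under eq_fun do rewrite mulrBr; exact: bmeas_cos_affine.
  rewrite bintD; [|exact: (bf n)|exact: bmeasZ].
  rewrite [X in X + _]IH bintZ// -[RHS]addr0; congr (_ + _).
  under eq_Rintegral do rewrite mulrBr.
  by rewrite uniform_cos mulr0.
have [mp [Cp pC]] := bmeas_pk z1.
have bp : bmeas (pk z \o @circle_param R).
  by split; [exact: measurableT_comp|exists Cp => t; exact: pC].
rewrite circle_integralE//; apply/eqP; rewrite -subr_eq0 -normr_le0.
have D0 : 0 < (1 - r) ^+ 2 by rewrite exprn_gt0// subr_gt0.
(* The remainder is 2 r^(n+1) times a difference of cosines of size at most 2, over a denominator
   that is at least (1 - r)^2; hence the 4. *)
have bnd n : `|\int[U]_t pk z (circle_param t) - 1| <= 4 / (1 - r) ^+ 2 * r ^+ n.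
  rewrite -[X in _ - X](If n) -bintB//; apply: bint_norm_le; first exact: bmeasB.
  apply: aeW => t; rewrite pkE ?enorm_circle_param// /poisson_kernel -/r.
  have -> : edot z (circle_param t) = r * cos (t - th).
    by rewrite zE edotZl /edot /= cosB mulrC -(mulrC (cos t)) -(mulrC (sin t)) mulrC.
  set D := (1 - _ + _).
  have Dge : (1 - r) ^+ 2 <= D.
    by rewrite /D; have := cos_le1 (t - th); have := r0; nra.
  have Dgt : 0 < D by exact: lt_le_trans Dge.
  have -> : (1 - r ^+ 2) / D - f n t =
      (2 * r ^+ n.+1 * (cos (n.+1%:R * (t - th)) - r * cos (n%:R * (t - th)))) / D.
    have := poisson_partialE r (t - th) n.
    rewrite (_ : 1 - 2 * r * _ + _ = D); last by rewrite /D mulrA.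
    move=> E; apply: (mulIf (lt0r_neq0 Dgt)); rewrite mulrBl !divfK ?gt_eqF//.
    by rewrite [f n t * D]mulrC /f E !exprS; ring.
  rewrite normrM normfV (gtr0_norm Dgt) normrM normrM (ger0_norm (exprn_ge0 _ r0)).
  rewrite [leRHS]mulrAC; apply: ler_pM.
  - by rewrite !mulr_ge0// exprn_ge0.
  - by rewrite invr_ge0 ltW.
  - rewrite (ger0_norm (ler0n _ _)).
    have h : `|cos (n.+1%:R * (t - th)) - r * cos (n%:R * (t - th))| <= 2.
      apply: le_trans (ler_normB _ _) _; rewrite normrM ger0_norm//.
      have := cos_max (n.+1%:R * (t - th)); have := cos_max (n%:R * (t - th)).
      by have := normr_ge0 (cos (n%:R * (t - th))); nra.
    have rn : r ^+ n.+1 <= r ^+ n by rewrite exprSr ler_piMr ?exprn_ge0// ltW.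
    have rn0 : 0 <= r ^+ n.+1 by rewrite exprn_ge0.
    apply: (@le_trans _ _ (2 * r ^+ n * 2)); last by lra.
    by apply: ler_pM => //; lra.
  by rewrite lef_pV2 ?posrE.
have : 4 / (1 - r) ^+ 2 * r ^+ n @[n --> \oo] --> 0.
  by apply: cvg_geometric; rewrite ger0_norm.
move=> h; apply: (cvgr_to_ge h); exact: nearW.
Qed.

(** The kernel times its denominator is 1 - |z|^2, and the denominator is affine in [edot z eta].
    Integrated, this gives the first moment |z|^2 of the kernel. *)
Lemma pk_mul_dot z eta : enorm z < 1 -> enorm eta = 1 ->
  pk z eta * edot z eta = 2^-1 * ((1 + enorm z ^+ 2) * pk z eta - (1 - enorm z ^+ 2)).
Proof.
move=> z1 e1; rewrite pkE// /poisson_kernel; have := poisson_den_ge z e1.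
have : 0 < (1 - enorm z) ^+ 2 by rewrite exprn_gt0// subr_gt0.
set D := (1 - _ + _) => h1 h2; have D0 : 0 < D := lt_le_trans h1 h2.
have -> : edot z eta = 2^-1 * (1 + enorm z ^+ 2 - D) by rewrite /D; field.
by field; rewrite gt_eqF.
Qed.

(** By the first moment, 1 - [edot zeta eta] integrates to exactly 1 - t against the kernel at
    [t *: zeta]. A continuity bound of this shape is therefore integrated at once, without splitting
    the circle. *)
Lemma poisson_approx_identity (g : R * R -> R) zeta (t e C : R) :
  bmeas g -> enorm zeta = 1 -> 0 < t < 1 ->
  (forall eta, enorm eta = 1 -> `|g eta - g zeta| <= e + C * (1 - edot zeta eta)) ->
  `|\int[cm]_eta (pk (t *: zeta) eta * g eta) - g zeta| <= e + C * (1 - t).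
Proof.
move=> bg z1 /andP[t0 t1] hg.
have tz : enorm (t *: zeta) = t by rewrite enormZ z1 mulr1 gtr0_norm.
have tz1 : enorm (t *: zeta) < 1 by rewrite tz.
have bp := bmeas_pk tz1.
rewrite -[g zeta in X in `|X|]mul1r -(int_pk tz1).
rewrite -[X in _ - X]mulrC -bintZ// -bintB; last 2 first.
- exact: bmeasM.
- exact: bmeasZ.
(* The majorant e + C (1 - edot) times the kernel, rewritten through [pk_mul_dot] so that only the
   kernel occurs: [edot] is unbounded off the circle. *)
have bq : bmeas (fun eta => (e + C) * pk (t *: zeta) eta - C * t^-1 * (2^-1
  * ((1 + t ^+ 2) * pk (t *: zeta) eta - (1 - t ^+ 2)))).
  apply: bmeasB; first exact: bmeasZ.
  by apply/bmeasZ/bmeasZ/bmeasB; [exact: bmeasZ|exact: bmeas_cst].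
have bd : bmeas (fun eta => pk (t *: zeta) eta * g eta - g zeta * pk (t *: zeta) eta).
  by apply: bmeasB; [exact: bmeasM|exact: bmeasZ].
apply: le_trans (le_norm_bint _ bd) _.
apply: (@le_trans _ _ (\int[cm]_eta ((e + C) * pk (t *: zeta) eta - C * t^-1 * (2^-1
  * ((1 + t ^+ 2) * pk (t *: zeta) eta - (1 - t ^+ 2)))))).
  apply: ae_le_bint => //; first exact: bmeas_norm.
  apply: filterS ae_circle => eta e1.
  have := pk_mul_dot tz1 e1; rewrite tz edotZl => <-.
  rewrite (_ : _ - _ = pk (t *: zeta) eta * (g eta - g zeta)); last by ring.
  rewrite normrM (ger0_norm (pk_ge0 _ tz1)).
  have -> : (e + C) * pk (t *: zeta) eta - C / t * (pk (t *: zeta) eta * (t * edot zeta eta))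
      = pk (t *: zeta) eta * (e + C * (1 - edot zeta eta)) by field; rewrite gt_eqF.
  by apply: ler_wpM2l; [exact: pk_ge0|exact: hg].
rewrite bintB; last 2 first.
- exact: bmeasZ.
- by apply/bmeasZ/bmeasZ/bmeasB; [exact: bmeasZ|exact: bmeas_cst].
have bq1 : bmeas (fun eta => (1 + t ^+ 2) * pk (t *: zeta) eta - (1 - t ^+ 2)).
  by apply: bmeasB; [exact: bmeasZ|exact: bmeas_cst].
rewrite (bintZ _ _ bp) (bintZ _ _ (bmeasZ 2^-1 bq1)) (bintZ _ _ bq1).
rewrite bintB; [|exact: bmeasZ|exact: bmeas_cst].
rewrite (bintZ _ _ bp) int_pk// bint_cst.
by rewrite le_eqVlt; apply/orP; left; apply/eqP; field; rewrite gt_eqF.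
Qed.

Lemma sqr_dist_circle zeta eta : enorm zeta = 1 -> enorm eta = 1 ->
  enorm (zeta - eta) ^+ 2 = 2 * (1 - edot zeta eta).
Proof.
move=> z1 e1; have := sqr_enorm zeta; have := sqr_enorm eta.
by rewrite z1 e1 sqr_enorm expr1n /edot /=; nra.
Qed.

End plane.
#[global] Hint Extern 0 (is_true (0 <= enorm _)) => exact: enorm_ge0 : core.

(** * The discrete Laplacian of the Poisson kernel *)

Section discrete_laplacian.
Context (R : realType).
Implicit Types (z zeta eta v w : R * R) (u : R * R -> R) (h : R).
Local Notation cm := (circle_measure R).
Import ComplexField.Normc.

(* Second-difference form of the Laplacian: it avoids differentiating Poisson
   integrals. *)
Definition dlap u z h : R :=
  u (z + h *: e_x R) + u (z - h *: e_x R)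
  + (u (z + h *: e_y R) + u (z - h *: e_y R)) - 4 * u z.

Lemma normc_to_complex z : normc (to_complex z) = enorm z.
Proof. by []. Qed.

Definition kernel_base z eta : R[i] := 1 - to_complex z * (to_complex eta)^*%C.

(** The kernel is the real part of the holomorphic function 2 / (1 - z conj(eta)) - 1, so its second
    differences reduce to sums of complex reciprocals. *)
Lemma poisson_kernel_complex z eta : enorm z < 1 -> enorm eta = 1 ->
  poisson_kernel z eta = -1 + 2 * complex.Re ((kernel_base z eta)^-1).
Proof.
move=> z1 e1; rewrite /poisson_kernel.
have e2 : eta.1 ^+ 2 + eta.2 ^+ 2 = 1 by rewrite -sqr_enorm e1 expr1n.
have Dgt : 0 < 1 - 2 * edot z eta + enorm z ^+ 2.
  by apply: lt_le_trans (poisson_den_ge z e1); rewrite exprn_gt0// subr_gt0.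
rewrite (_ : complex.Re _ = (1 - edot z eta) / (1 - 2 * edot z eta + enorm z ^+ 2)).
  by move: Dgt; set D := (1 - _ + _) => Dgt; rewrite -[1 - _ ^+ 2](_ : 2 - 2 * edot z eta - D =
    _); [field; rewrite gt_eqF|rewrite /D; ring].
rewrite sqr_enorm /kernel_base /to_complex /edot.
case: z z1 {Dgt} => x y _ /=; case: eta e1 e2 => p q _ /= e2.
rewrite !(mulrN, mulNr, opprK, add0r, sub0r, oppr0).
congr (_ / _).
transitivity (1 - 2 * (x * p + y * q) + (x ^+ 2 + y ^+ 2) * (p ^+ 2 + q ^+ 2)); first by ring.
by rewrite e2 mulr1.
Qed.

(* The four displacements of [dlap] are the fourth roots of unity times [k]. *)
Lemma sum_inv_4th_roots (K : fieldType) (a k j : K) : j ^+ 2 = - k ^+ 2 ->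
  a != 0 -> a - k != 0 -> a + k != 0 -> a - j != 0 -> a + j != 0 ->
  (a - k)^-1 + (a + k)^-1 + ((a - j)^-1 + (a + j)^-1) - 4 * a^-1 =
  4 * k ^+ 4 / (a * (a ^+ 4 - k ^+ 4)).
Proof.
move=> jk a0 h1 h2 h3 h4.
have n1 : a ^+ 2 - k ^+ 2 != 0 by rewrite subr_sqr mulf_neq0.
have n2 : a ^+ 2 - j ^+ 2 != 0 by rewrite subr_sqr mulf_neq0.
have -> : (a - k)^-1 + (a + k)^-1 = 2 * a / (a ^+ 2 - k ^+ 2).
  by rewrite subr_sqr; field; rewrite h1 h2.
have -> : (a - j)^-1 + (a + j)^-1 = 2 * a / (a ^+ 2 - j ^+ 2).
  by rewrite subr_sqr; field; rewrite h3 h4.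
rewrite jk opprK in n2 *.
have -> : a ^+ 4 - k ^+ 4 = (a ^+ 2 - k ^+ 2) * (a ^+ 2 + k ^+ 2) by ring.
by field; rewrite a0 n1 n2.
Qed.

Lemma normc_kernel_base_ge z eta : enorm eta = 1 -> 1 - enorm z <= normc (kernel_base z eta).
Proof.
move=> e1; rewrite lerBlDr -{1}(@normc1 R).
rewrite -[X in normc X <= _](subrK (to_complex z * (to_complex eta)^*%C)).
apply: le_trans (le_normcD _ _) _; rewrite lerD2l normcM normc_to_complex.
rewrite (_ : normc _ = 1) ?mulr1//.
by rewrite -e1; case: (eta) => p q; rewrite /enorm /= sqrrN.
Qed.

Lemma normcX (w : R[i]) n : normc (w ^+ n) = normc w ^+ n.
Proof. by elim: n => [|n IH]; rewrite ?expr0 ?normc1// !exprS normcM IH. Qed.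

Lemma Re_le_normc (w : R[i]) : `|complex.Re w| <= normc w.
Proof. by case: w => x y; exact: (enorm_fst (x, y)). Qed.

Lemma enorm_triangle z v : enorm (z + v) <= enorm z + enorm v.
Proof.
rewrite -ler_sqr ?nnegrE ?addr_ge0// sqrrD !sqr_enorm /=.
by have := edot_le z v; rewrite ler_norml /edot; lra.
Qed.

Lemma kernel_base_shift z v eta :
  kernel_base (z + v) eta = kernel_base z eta - to_complex v * (to_complex eta)^*%C.
Proof.
rewrite /kernel_base (_ : to_complex (z + v) = to_complex z + to_complex v) ?mulrDl ?opprD
  ?addrA//.
Qed.

(** With d = 1 - |z| and 2 h <= d, the displaced points stay in the disk, |a| >= d and |a^4 - k^4|
    >= d^4 - d^4 / 16 >= d^4 / 2. The real part contributes a factor 2, the algebraic identity 4,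
    and the last bound 2, whence 16. *)
Lemma dlap_poisson_kernel z eta h : enorm eta = 1 -> 0 < h -> 2 * h <= 1 - enorm z ->
  `|dlap (fun z => poisson_kernel z eta) z h| <= 16 / (1 - enorm z) ^+ 5 * h ^+ 4.
Proof.
move=> e1 h0 h2; set d := 1 - enorm z.
have d0 : 0 < d by rewrite /d; lra.
have z1 : enorm z < 1 by move: d0; rewrite subr_gt0.
have step v : enorm v = h -> enorm (z + v) < 1.
  by move=> vh; have := enorm_triangle z v; rewrite vh; move: z1 h2; lra.
have ex : enorm (h *: e_x R) = h
  by rewrite enormZ gtr0_norm// /enorm /= expr1n expr0n addr0 sqrtr1 mulr1.
have ey : enorm (h *: e_y R) = h
  by rewrite enormZ gtr0_norm// /enorm /= expr1n expr0n add0r sqrtr1 mulr1.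
have exN : enorm (- (h *: e_x R)) = h by rewrite -scaleN1r enormZ normrN1 mul1r.
have eyN : enorm (- (h *: e_y R)) = h by rewrite -scaleN1r enormZ normrN1 mul1r.
rewrite /dlap !poisson_kernel_complex//; try exact: step.
set a := kernel_base z eta.
(* [k] and [j] are the shifts of the kernel base under the horizontal and the vertical displacement
   by [h]; they differ by the factor i, so that j^2 = - k^2. *)
pose k : R[i] := h%:C%C * (to_complex eta)^*%C.
pose j : R[i] := 'i%C * k.
have tx : to_complex (h *: e_x R) = h%:C%C.
  by rewrite /to_complex /= /GRing.scale /= mulr1 mulr0.
have ty : to_complex (h *: e_y R) = 'i%C * h%:C%C.
  by rewrite /to_complex /= /GRing.scale /= mulr1 mulr0; simpc.
have tN v : to_complex (- v) = - to_complex v by [].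
have -> : kernel_base (z + h *: e_x R) eta = a - k by rewrite kernel_base_shift tx.
have -> : kernel_base (z - h *: e_x R) eta = a + k.
  by rewrite kernel_base_shift tN tx mulNr opprK.
have -> : kernel_base (z + h *: e_y R) eta = a - j.
  by rewrite kernel_base_shift ty -mulrA.
have -> : kernel_base (z - h *: e_y R) eta = a + j.
  by rewrite kernel_base_shift tN ty mulNr opprK -mulrA.
have hd : 2 * h <= d := h2.
have kn : normc k = h.
  rewrite /k normcM (_ : normc (to_complex eta)^*%C = 1).
    by rewrite mulr1 /= expr0n addr0 sqrtr_sqr gtr0_norm.
  by rewrite -e1; case: (eta) => p q; rewrite /enorm /= sqrrN.
have jk : j ^+ 2 = - k ^+ 2 by rewrite /j exprMn sqr_i mulN1r.
have jn : normc j = h by rewrite /j normcM kn /= expr0n add0r expr1n sqrtr1 mul1r.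
have an : d <= normc a by exact: normc_kernel_base_ge.
have neq (w : R[i]) : 0 < normc w -> w != 0.
  by apply: contraTneq => ->; rewrite normc0 ltxx.
have sub_ge (w x : R[i]) : normc w - normc x <= normc (w - x).
  by rewrite lerBlDr -{1}[w](subrK x); exact: le_normcD.
have a0 : a != 0 by apply: neq; lra.
have rs : -1 + 2 * complex.Re (a - k)^-1 + (-1 + 2 * complex.Re (a + k)^-1)
  + (-1 + 2 * complex.Re (a - j)^-1 + (-1 + 2 * complex.Re (a + j)^-1))
  - 4 * (-1 + 2 * complex.Re a^-1) =
  2 * complex.Re ((a - k)^-1 + (a + k)^-1 + ((a - j)^-1 + (a + j)^-1) - 4 * a^-1).
  case: (a - k)^-1 => x1 y1; case: (a + k)^-1 => x2 y2; case: (a - j)^-1 => x3 y3.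
  by case: (a + j)^-1 => x4 y4; case: (a^-1) => x5 y5 /=; ring.
rewrite rs sum_inv_4th_roots//; last 4 first.
- by apply: neq; apply: lt_le_trans (sub_ge a k); rewrite kn; lra.
- rewrite -[k]opprK; apply: neq; apply: lt_le_trans (sub_ge a (- k)).
  by rewrite normcN kn; lra.
- by apply: neq; apply: lt_le_trans (sub_ge a j); rewrite jn; lra.
- rewrite -[j]opprK; apply: neq; apply: lt_le_trans (sub_ge a (- j)).
  by rewrite normcN jn; lra.
rewrite normrM ger0_norm//; apply: le_trans (ler_wpM2l _ (Re_le_normc _)) _ => //.
rewrite (normcM (4 * _)) normcV (normcM 4) (normcM a) normcX kn.
have n4 : normc (4 : R[i]) = 4 by rewrite -[4 : R[i]]/((4%:R)) normcMn normc1.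
rewrite n4.
have d4 : d ^+ 4 / 2 <= normc (a ^+ 4 - k ^+ 4).
  apply: le_trans (sub_ge _ _); rewrite !normcX kn.
  have : d ^+ 4 <= normc a ^+ 4 by apply: lerXn2r; rewrite ?nnegrE; lra.
  have : h ^+ 4 <= (d / 2) ^+ 4 by apply: lerXn2r; rewrite ?nnegrE; lra.
  rewrite exprMn; have := exprn_gt0 4 d0.
  have -> : (2^-1 : R) ^+ 4 = 16^-1 by field.
  by lra.
have -> : 16 / d ^+ 5 * h ^+ 4 = 2 * (4 * h ^+ 4 / (d * (d ^+ 4 / 2))).
  by field; rewrite gt_eqF.
apply: ler_wpM2l => //; apply: ler_wpM2l; first by rewrite mulr_ge0// exprn_ge0// ltW.
have p1 : 0 < d * (d ^+ 4 / 2) by rewrite mulr_gt0// divr_gt0// exprn_gt0.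
have p2 : d * (d ^+ 4 / 2) <= normc a * normc (a ^+ 4 - k ^+ 4).
  by apply: ler_pM => //; [exact: ltW|rewrite divr_ge0// exprn_ge0// ltW].
by rewrite lef_pV2 ?posrE//; exact: lt_le_trans p2.
Qed.

End discrete_laplacian.

(** * Compactness and continuity on closed disks *)

Section closed_disk.
Context (R : realType).
Implicit Types (z zeta eta v w : R * R) (u : R * R -> R) (h r : R).
Local Notation cm := (circle_measure R).

(** Translation between library neighbourhoods, given by the max norm, and Euclidean disks; one
    direction halves the radius because the Euclidean norm is at most the sum of the coordinates. *)
Lemma near_enorm z (P : R * R -> Prop) :
  (\forall x \near z, P x) <-> exists2 e : R, 0 < e & forall x, enorm (x - z) < e -> P x.
Proof.
split=> [/nbhs_ballP[e /= e0 h]|[e e0 h]].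
  exists e => // x xz; apply: h; split => /=.
    by rewrite /ball /= distrC; exact: le_lt_trans (enorm_fst (x - z)) xz.
  by rewrite /ball /= distrC; exact: le_lt_trans (enorm_snd (x - z)) xz.
apply/nbhs_ballP; exists (e / 2) => /=; first by rewrite divr_gt0.
move=> x [/= h1 h2]; apply: h; apply: le_lt_trans (enorm_le_sum _) _.
move: h1 h2; rewrite /ball /= !(distrC z.1) !(distrC z.2) /=.
by rewrite [in X in _ -> _ -> _ < X](splitr e); exact: ltrD.
Qed.

Lemma cvg_enormP (V : normedModType R) (f : R * R -> V) z :
  {for z, continuous f} <-> forall e, 0 < e -> exists2 d : R, 0 < d &
    forall x, enorm (x - z) < d -> `|f z - f x| <= e.
Proof.
split=> [fz e e0|h].
  by apply/near_enorm; move/cvgrPdist_le: fz; exact.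
by apply/cvgrPdist_le => e e0; apply/near_enorm; exact: h.
Qed.

Lemma enormB z w : enorm (z - w) = enorm (w - z).
Proof. by rewrite -opprB -scaleN1r enormZ normrN1 mul1r. Qed.

Definition cdisk r : set (R * R) := [set z | enorm z <= r].

Lemma compact_cdisk r : compact (cdisk r).
Proof.
apply: (@subclosed_compact _ _ (`[- r, r] `*` `[- r, r])).
- rewrite (_ : cdisk r = @enorm R @^-1` [set x | x <= r])//.
  by apply: closed_comp => [z _|]; [exact: continuous_enorm|exact: closed_le].
- by apply: compact_setX; exact: segment_compact.
- move=> z zr; split; rewrite /= in_itv/= -ler_norml; apply: le_trans zr.
    exact: enorm_fst.
  exact: enorm_snd.
Qed.

(** Heine-Cantor, from the covering form of compactness applied to the modulus [d] as a parameter
    tending to 0 from the right. Only [x] is confined to the compact set. *)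
Lemma uniform_continuity (A : set (R * R)) (g : R * R -> R) (e : R) : continuous g ->
  compact A -> 0 < e -> exists2 d : R, 0 < d &
    forall x y, A x -> enorm (x - y) < d -> `|g x - g y| <= e.
Proof.
move=> cg /compact_near_coveringP cA e0.
have := cA R (0^'+)%classic (fun d x => forall y, enorm (x - y) < d -> `|g x - g y| <= e) _.
case.
  move=> x Ax; have [] := (cvg_enormP g x).1 (cg x) (e / 2); first by rewrite divr_gt0.
  move=> d d0 hd.
  exists ([set y | enorm (y - x) < d / 2], [set t : R | t < d / 2]).
    split => /=; first by apply/near_enorm; exists (d / 2) => //; rewrite divr_gt0.
    by apply: nbhs_right_lt; rewrite divr_gt0.
  move=> [y t] /= [yx td] w yw.
  have h1 := hd y (lt_trans yx _); have h2 : enorm (w - x) < d.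
    rewrite (_ : w - x = (w - y) + (y - x)); last by rewrite addrA subrK.
    apply: le_lt_trans (enorm_triangle _ _) _; rewrite [ltRHS](splitr d) enormB.
    by apply: ltrD => //; exact: lt_trans td.
  have := hd w h2; have : `|g x - g y| <= e / 2 by apply: h1; rewrite ltr_pdivrMr//; lra.
  rewrite (_ : g y - g w = (g x - g w) - (g x - g y)); last by ring.
  by move=> h3 h4; apply: le_trans (ler_normB _ _) _; lra.
move=> d /= d0 h.
exists (d / 2); first by rewrite divr_gt0.
move=> x y Ax xy.
apply: (h (d / 2) _ _ x) => //=.
- by rewrite sub0r normrN ger0_norm ?divr_ge0 ?ltW// ltr_pdivrMr//; lra.
- by rewrite divr_gt0.
Qed.

(* Extends functions on the closed disk to the plane. *)
Definition retract eta : R * R := (Num.max 1 (enorm eta))^-1 *: eta.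

Lemma max1_gt0 (x : R) : 0 < Num.max 1 x.
Proof. by rewrite lt_max ltr01. Qed.

Lemma retract_id eta : enorm eta <= 1 -> retract eta = eta.
Proof. by move=> e1; rewrite /retract max_l// invr1 scale1r. Qed.

Lemma enorm_retract eta : enorm (retract eta) <= 1.
Proof.
rewrite enormZ gtr0_norm ?invr_gt0 ?max1_gt0// mulrC ler_pdivrMr ?max1_gt0// mul1r.
by rewrite le_max lexx orbT.
Qed.

Lemma continuous_retract : continuous retract.
Proof.
have cm : continuous ((fun=> 1) \max @enorm R).
  by apply: max_fun_continuous => x; [exact: cvg_cst|exact: continuous_enorm].
move=> z; apply: cvgZ; last exact: cvg_id.
by apply: cvgV; [rewrite gt_eqF// max1_gt0|exact: cm].
Qed.

Lemma enorm_ex : enorm (e_x R) = 1.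
Proof. by rewrite /enorm/= expr1n expr0n addr0 sqrtr1. Qed.

Lemma enorm_ey : enorm (e_y R) = 1.
Proof. by rewrite /enorm/= expr1n expr0n add0r sqrtr1. Qed.

End closed_disk.

(** * Poisson integrals of bounded functions *)

Section poisson_integral.
Context (R : realType).
Implicit Types (z zeta eta v w : R * R) (u : R * R -> R) (h : R).
Local Notation cm := (circle_measure R).

Definition poisson_int (g : R * R -> R) z : R := \int[cm]_eta (pk z eta * g eta).

Variables (g : R * R -> R) (M : R).
Hypothesis mg : measurable_fun setT g.
Hypothesis gM : forall eta, `|g eta| <= M.

Lemma bmeas_bounded : bmeas g. Proof. by split => //; exists M. Qed.
Let bg := bmeas_bounded.

(** Quotient rule for differences: on the disk of radius [q] the numerators differ by at most 2 e,
    the denominators by at most 4 e, the denominators are at most 4 and at least (1 - q)^2. *)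
Lemma poisson_kernel_lip z w eta (q : R) : enorm eta = 1 -> q < 1 ->
  enorm z <= q -> enorm w <= q ->
  `|poisson_kernel z eta - poisson_kernel w eta| <= 24 / (1 - q) ^+ 4 * enorm (z - w).
Proof.
move=> e1 q1 zq wq; rewrite /poisson_kernel.
have dz := poisson_den_ge z e1; have dw := poisson_den_ge w e1.
have q0 : 0 < (1 - q) ^+ 2 by rewrite exprn_gt0// subr_gt0.
have le1 x : enorm x <= q -> (1 - q) ^+ 2 <= (1 - enorm x) ^+ 2.
  by move=> xq; apply: lerXn2r; rewrite ?nnegrE; lra.
have {}dz := le_trans (le1 _ zq) dz; have {}dw := le_trans (le1 _ wq) dw.
set Dz := (1 - _ + _) in dz *; set Dw := (1 - 2 * edot w eta + _) in dw *.
have Dz0 : 0 < Dz by exact: lt_le_trans dz.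
have Dw0 : 0 < Dw by exact: lt_le_trans dw.
set Nz := 1 - enorm z ^+ 2; set Nw := 1 - enorm w ^+ 2.
set e := enorm (z - w).
have e0 : 0 <= e by exact: enorm_ge0.
have zw : `|enorm z - enorm w| <= e.
  have := enorm_triangle (z - w) w; have := enorm_triangle (w - z) z.
  by rewrite !subrK enormB -/e ler_norml; lra.
have hN : `|Nz - Nw| <= 2 * e.
  rewrite (_ : Nz - Nw = - ((enorm z - enorm w) * (enorm z + enorm w))); last
    by rewrite /Nz /Nw; ring.
  rewrite normrN normrM mulrC; apply: ler_pM => //.
  by rewrite ger0_norm ?addr_ge0//; lra.
have hD : `|Dw - Dz| <= 4 * e.
  have -> : Dw - Dz = 2 * edot (z - w) eta + (Nz - Nw).
    by rewrite /Dw /Dz /Nz /Nw /edot /=; ring.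
  apply: le_trans (ler_normD _ _) _.
  have := edot_le (z - w) eta; rewrite e1 mulr1 normrM -/e (ger0_norm (ler0n _ _)).
  lra.
have hDw : `|Dw| <= 4.
  rewrite gtr0_norm// /Dw; have := edot_le w eta; rewrite e1 mulr1 ler_norml.
  have := enorm_ge0 w; nra.
have hNw : `|Nw| <= 1.
  by rewrite /Nw ger0_norm ?lerBlDr ?lerDl ?sqr_ge0// subr_ge0 expr_le1//; lra.
have -> : Nz / Dz - Nw / Dw = ((Nz - Nw) * Dw + Nw * (Dw - Dz)) / (Dz * Dw).
  by field; rewrite !gt_eqF.
rewrite normrM normfV (gtr0_norm (mulr_gt0 Dz0 Dw0)) mulrAC; apply: ler_pM => //.
- by rewrite invr_ge0 ltW// mulr_gt0.
- apply: le_trans (ler_normD _ _) _; rewrite !normrM.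
  have : `|Nz - Nw| * `|Dw| <= 2 * e * 4 by apply: ler_pM.
  have : `|Nw| * `|Dw - Dz| <= 1 * (4 * e) by apply: ler_pM.
  lra.
- rewrite lef_pV2 ?posrE ?mulr_gt0// ?exprn_gt0 ?subr_gt0//.
  rewrite (_ : (1 - q) ^+ 4 = (1 - q) ^+ 2 * (1 - q) ^+ 2); last by ring.
  by apply: ler_pM => //; exact: ltW.
Qed.

Lemma M_ge0 : 0 <= M. Proof. exact: le_trans (gM 0). Qed.

Lemma poisson_int_lip z w (q : R) : q < 1 -> enorm z <= q -> enorm w <= q ->
  `|poisson_int g z - poisson_int g w| <= 24 / (1 - q) ^+ 4 * M * enorm (z - w).
Proof.
move=> q1 zq wq; have z1 := le_lt_trans zq q1; have w1 := le_lt_trans wq q1.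
have bz := bmeas_pk z1; have bw := bmeas_pk w1.
rewrite /poisson_int -bintB; [|exact: bmeasM|exact: bmeasM].
apply: bint_norm_le; first by apply: bmeasB; exact: bmeasM.
apply: filterS (ae_circle R) => eta e1; rewrite -mulrBl normrM mulrAC.
by apply: ler_pM => //; rewrite !pkE//; exact: poisson_kernel_lip.
Qed.

Lemma continuous_poisson_int z : enorm z < 1 -> {for z, continuous (poisson_int g)}.
Proof.
move=> z1; apply/cvg_enormP => e e0; pose q := (1 + enorm z) / 2.
have q1 : q < 1 by rewrite /q ltr_pdivrMr//; lra.
pose K := 24 / (1 - q) ^+ 4 * M + 1.
have K0 : 0 < K.
  by rewrite ltr_wpDl// mulr_ge0 ?M_ge0// divr_ge0// exprn_ge0// subr_ge0 ltW.
exists (Num.min ((1 - enorm z) / 2) (e / K)) => [|x].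
  by rewrite lt_min !divr_gt0// subr_gt0.
rewrite lt_min => /andP[h1 h2].
have zq : enorm z <= q by rewrite /q ler_pdivlMr//; lra.
have xq : enorm x <= q.
  rewrite -[x](subrK z); apply: le_trans (enorm_triangle _ _) _.
  by rewrite /q; move: h1; lra.
apply: le_trans (poisson_int_lip q1 zq xq) _; rewrite enormB.
apply: (@le_trans _ _ (K * enorm (x - z))).
  by apply: ler_wpM2r => //; rewrite /K lerDl.
by rewrite mulrC -ler_pdivlMr// ltW.
Qed.

Lemma dlap_poisson_int z h : 0 < h -> 2 * h <= 1 - enorm z ->
  `|dlap (poisson_int g) z h| <= 16 / (1 - enorm z) ^+ 5 * M * h ^+ 4.
Proof.
move=> h0 h2.
have z1 : enorm z < 1 by lra.
have [ex exN ey eyN] : [/\ enorm (z + h *: e_x R) < 1, enorm (z - h *: e_x R) < 1,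
    enorm (z + h *: e_y R) < 1 & enorm (z - h *: e_y R) < 1].
  have e1 v : enorm v = 1 -> enorm (z + h *: v) < 1 /\ enorm (z - h *: v) < 1.
    move=> v1; have vh : enorm (h *: v) = h by rewrite enormZ v1 mulr1 gtr0_norm.
    split; apply: le_lt_trans (enorm_triangle _ _) _; last first.
      by rewrite -scaleN1r enormZ normrN1 mul1r vh; lra.
    by rewrite vh; lra.
  by have [h3 h4] := e1 _ (enorm_ex R); have [h5 h6] := e1 _ (enorm_ey R); split.
have E : dlap (poisson_int g) z h = \int[cm]_eta (dlap (fun x => pk x eta) z h * g eta).
  rewrite /dlap /poisson_int.
  have bx x : enorm x < 1 -> bmeas (fun eta => pk x eta * g eta).
    by move=> x1; apply: bmeasM => //; exact: bmeas_pk.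
  rewrite -!bintD//; try by [exact: bx|apply: bmeasD; exact: bx].
  rewrite -bintZ; last exact: bx.
  rewrite -bintB; last 2 first.
  - by apply: bmeasD; apply: bmeasD; exact: bx.
  - by apply: bmeasZ; exact: bx.
  by apply: eq_Rintegral => eta _; ring.
rewrite E; apply: bint_norm_le.
  apply: bmeasM => //; apply: bmeasB.
    by apply: bmeasD; apply: bmeasD; exact: bmeas_pk.
  by apply: bmeasZ; exact: bmeas_pk.
apply: filterS (ae_circle R) => eta e1; rewrite normrM mulrAC; apply: ler_pM => //.
by rewrite /dlap !pkE//; exact: dlap_poisson_kernel.
Qed.

(** The rate is uniform along the circle. Points within [d] of zeta are covered by the modulus of
    continuity of [g], the others by the bound [M] and the identity |zeta - eta|^2 = 2 (1 - edot
    zeta eta). *)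
Lemma poisson_int_boundary (e : R) : 0 < e -> continuous g -> exists2 d : R, 0 < d &
  forall zeta t, enorm zeta = 1 -> 0 < t < 1 -> 1 - t < d ->
    `|poisson_int g (t *: zeta) - g zeta| <= e.
Proof.
move=> e0 cg; have e20 : 0 < e / 2 by rewrite divr_gt0.
have [d d0 hd] := uniform_continuity cg (@compact_cdisk R 1) e20.
(* Chosen so that C (1 - edot zeta eta) >= 2 M as soon as |zeta - eta| >= d. *)
pose C := 4 * M / d ^+ 2.
have C0 : 0 <= C.
  by apply: divr_ge0; [apply: mulr_ge0 => //; exact: M_ge0|apply: exprn_ge0; exact: ltW].
exists (e / 2 / (C + 1)); first by rewrite divr_gt0// ltr_wpDl.
move=> zeta t z1 t01 td.
have h eta : enorm eta = 1 -> `|g eta - g zeta| <= e / 2 + C * (1 - edot zeta eta).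
  move=> e1; have sq := sqr_dist_circle z1 e1.
  have ed : 0 <= 1 - edot zeta eta.
    by have := edot_le zeta eta; rewrite z1 e1 mulr1 ler_norml subr_ge0 => /andP[].
  have [zd|zd] := ltP (enorm (zeta - eta)) d.
    rewrite distrC; apply: le_trans (hd zeta eta _ zd) _; first by rewrite /cdisk/= z1.
    by rewrite lerDl mulr_ge0.
  apply: le_trans (ler_normB _ _) _; have := gM eta; have := gM zeta.
  have : d ^+ 2 <= enorm (zeta - eta) ^+ 2 by apply: lerXn2r; rewrite ?nnegrE// ltW.
  rewrite sq => h1 h2 h3.
  have : 2 * M <= C * (1 - edot zeta eta).
    rewrite /C mulrAC ler_pdivlMr ?exprn_gt0//.
    by have := M_ge0; nra.
  by lra.
apply: le_trans (poisson_approx_identity bg z1 t01 h) _.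
rewrite [leRHS](splitr e) lerD2l.
apply: (@le_trans _ _ ((C + 1) * (1 - t))).
  by apply: ler_wpM2r; [case/andP: t01; lra|lra].
by rewrite mulrC -ler_pdivlMr ?ltr_wpDl// ltW.
Qed.

End poisson_integral.

(** * The Poisson formula for harmonic functions *)

Section poisson_formula.
Context (R : realType).
Implicit Types (z zeta eta v w : R * R) (u : R * R -> R) (h r : R).
Local Notation cm := (circle_measure R).

(** Harmonicity as the maximum principle uses it: at each point the discrete Laplacian is o(h^2). *)
Definition dlap_small u := forall z, enorm z < 1 -> forall e : R, 0 < e ->
  exists2 d : R, 0 < d & forall h, 0 < h < d -> `|dlap u z h| <= e * h ^+ 2.

(** Composition with [retract] makes the dilate a bounded continuous function on the whole plane,
    where the integrands of [circle_measure] live; on the closed disk it is the usual dilate. *)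
Definition dilate (V : Type) (u : R * R -> V) (r : R) (eta : R * R) : V :=
  u (r *: retract eta).

Lemma continuous_dilate (V : topologicalType) (u : R * R -> V) r :
  (forall z, enorm z < 1 -> {for z, continuous u}) -> 0 <= r < 1 ->
  continuous (dilate u r).
Proof.
move=> cu /andP[r0 r1] z; apply: (@continuous_comp _ _ _ (fun z => r *: retract z) u).
  by apply: cvgZ; [exact: cvg_cst|exact: continuous_retract].
apply: cu; rewrite enormZ ger0_norm//.
by apply: le_lt_trans r1; rewrite ler_piMr// enorm_retract.
Qed.

Lemma continuous_dilate_bounded (V : normedModType R) (u : R * R -> V) r :
  (forall z, enorm z < 1 -> {for z, continuous u}) -> 0 <= r < 1 ->
  exists M : R, forall eta, `|dilate u r eta| <= M.
Proof.
move=> cu r01; have cg := continuous_dilate cu r01.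
have ne : cdisk (1 : R) !=set0 by exists 0; rewrite /cdisk/= enorm0.
have cw : {within cdisk 1, continuous (fun z => `|dilate u r z|)}.
  by apply: continuous_subspaceT => z; apply: cvg_norm; exact: cg.
have [c _ hc] := compact_EVT_max ne (@compact_cdisk R 1) cw.
exists `|dilate u r c| => eta; have := hc (retract eta).
rewrite /dilate (retract_id (enorm_retract eta)); apply.
by rewrite inE; exact: enorm_retract.
Qed.

Lemma dlap_max_le u z h : (forall x, enorm x < 1 -> u x <= u z) ->
  0 < h -> 2 * h <= 1 - enorm z -> dlap u z h <= 0.
Proof.
move=> um h0 h2.
have e1 v : enorm v = 1 -> u (z + h *: v) <= u z /\ u (z - h *: v) <= u z.
  move=> v1; have vh : enorm (h *: v) = h by rewrite enormZ v1 mulr1 gtr0_norm.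
  split; apply: um; apply: le_lt_trans (enorm_triangle _ _) _; last first.
    by rewrite -scaleN1r enormZ normrN1 mul1r vh; lra.
  by rewrite vh; lra.
have [h3 h4] := e1 _ (enorm_ex R); have [h5 h6] := e1 _ (enorm_ey R).
by rewrite /dlap; lra.
Qed.

(* Maximum principle for the difference of both sides plus a small multiple of
   [enorm z ^+ 2], whose discrete Laplacian is positive. *)
Lemma poisson_formula_le u r : (forall z, enorm z < 1 -> {for z, continuous u}) ->
  dlap_small u -> 0 < r < 1 -> forall z, enorm z < 1 ->
  u (r *: z) <= poisson_int (dilate u r) z.
Proof.
move=> cu lu r01 z1 z1lt; rewrite leNgt; apply/negP => hlt.
have [r0 r1] := andP r01; have r01' : 0 <= r < 1 by rewrite ltW.
have cg := continuous_dilate cu r01'; set g := dilate u r in cg hlt *.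
have mg := continuous_measurable_plane cg.
have [M gM] := continuous_dilate_bounded cu r01'; have M0 := M_ge0 gM.
pose v z := u (r *: z) - poisson_int g z.
pose m := v z1; have m0 : 0 < m by rewrite /m /v subr_gt0.
have m8 : 0 < m / 8 by rewrite divr_gt0.
have [d1 d10 hd1] := poisson_int_boundary mg gM m8 cg.
have [d2 d20 hd2] := uniform_continuity cg (@compact_cdisk R 1) m8.
pose d := Num.min (Num.min d1 d2) (1 / 2).
have d0 : 0 < d by rewrite !lt_min d10 d20/=.
have [dd1 dd2 dd3] : [/\ d <= d1, d <= d2 & d <= 1 / 2].
  by split; rewrite /d !ge_min lexx ?orbT.
(* Near the circle both terms of [v] are close to the boundary value of [g]: one error m / 8 from
   the Poisson integral, one from the continuity of [g]. *)
have ring_bound x : enorm x < 1 -> 1 - d < enorm x -> v x <= m / 4.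
  move=> x1 xd; have x0 : 0 < enorm x by lra.
  pose zeta := (enorm x)^-1 *: x.
  have zeta1 : enorm zeta = 1 by rewrite enormZ ger0_norm ?invr_ge0// mulVf// gt_eqF.
  have xE : x = enorm x *: zeta by rewrite scalerA divff ?scale1r// gt_eqF.
  have := hd1 zeta (enorm x) zeta1; rewrite x0 x1 -xE => /(_ isT).
  have -> : 1 - enorm x < d1 by lra.
  move=> /(_ isT); have := hd2 x zeta.
  have -> : enorm (x - zeta) < d2.
    rewrite {1}xE -{2}[zeta]scale1r -scalerBl enormZ zeta1 mulr1 distrC ger0_norm; lra.
  rewrite /cdisk/= (ltW x1) => /(_ isT isT).
  rewrite {1}/g /dilate (retract_id (ltW x1)) /v !ler_norml -/g; lra.
(* In the outer ring V <= m / 4 + m / 2 < m <= V z1, so a maximum point over the smaller closed disk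
   is a maximum point over the open disk. *)
pose V x := v x + m / 2 * enorm x ^+ 2.
have cV x : enorm x < 1 -> {for x, continuous V}.
  move=> x1; apply: cvgD.
    apply: cvgB; last exact: (continuous_poisson_int mg gM).
    apply: (@continuous_comp _ _ _ (fun z => r *: z) u).
      by apply: cvgZ; [exact: cvg_cst|exact: cvg_id].
    by apply: cu; rewrite enormZ gtr0_norm//; have := enorm_ge0 x; nra.
  apply: cvgM; first exact: cvg_cst.
  by rewrite expr2; apply: cvgM; exact: continuous_enorm.
have z1d : enorm z1 <= 1 - d.
  by rewrite leNgt; apply/negP => h; have := ring_bound _ z1lt h; rewrite -/m; lra.
have ne : cdisk (1 - d) !=set0 by exists z1.
have cw : {within cdisk (1 - d), continuous V}.
  apply: continuous_in_subspaceT => x; rewrite inE /cdisk /= => xd.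
  by apply: cV; lra.
have [z0 z0K hz0] := compact_EVT_max ne (@compact_cdisk R (1 - d)) cw.
move: z0K; rewrite inE /cdisk/= => z0d.
have z0lt : enorm z0 < 1 by lra.
have Vmax x : enorm x < 1 -> V x <= V z0.
  move=> x1; have [xd|xd] := leP (enorm x) (1 - d).
    by apply: hz0; rewrite inE.
  have Vz1 : V z1 <= V z0 by apply: hz0; rewrite inE.
  apply: le_trans Vz1; rewrite /V -/m.
  have := ring_bound x x1 xd; have : enorm x ^+ 2 <= 1 by rewrite expr_le1//; exact: ltW.
  have := sqr_ge0 (enorm z1); nra.
have z0r : enorm (r *: z0) < 1 by rewrite enormZ gtr0_norm//; have := enorm_ge0 z0; nra.
have [d3 d30 hd3] := lu _ z0r m m0.
pose q := 1 - enorm z0; have q0 : 0 < q by rewrite subr_gt0.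
pose K := 16 / q ^+ 5 * M + 1.
have K0 : 0 < K by rewrite ltr_wpDl// mulr_ge0// divr_ge0// exprn_ge0// ltW.
(* The step is small enough for the estimate of [u], for the displaced points to stay inside, and
   for the kernel error to be at most (m / 2) h^2. With the error m h^2 of [u], the term 2 m h^2
   still wins, contradicting the maximum. *)
pose h := Num.min (Num.min (d3 / 2) (q / 2)) (Num.min (1 / 2) (m / (2 * K))).
have h0 : 0 < h by rewrite !lt_min !divr_gt0// mulr_gt0.
have [h3 h4 h5 h6] : [/\ h <= d3 / 2, h <= q / 2, h <= 1 / 2 & h <= m / (2 * K)].
  by split; rewrite /h !ge_min lexx ?orbT.
have h2 : 2 * h <= 1 - enorm z0 by rewrite -/q; lra.
have L0 := dlap_max_le Vmax h0 h2.
have L1 := dlap_poisson_int mg gM h0 h2.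
have L2 : `|dlap u (r *: z0) (r * h)| <= m * (r * h) ^+ 2.
  by apply: hd3; rewrite mulr_gt0//=; nra.
have E : dlap V z0 h = dlap u (r *: z0) (r * h) - dlap (poisson_int g) z0 h + 2 * m * h ^+ 2.
  rewrite /dlap /V /v !sqr_enorm -!scalerA !scalerDr !scalerN /e_x /e_y /=.
  rewrite /GRing.scale /= !mulr0 !mulr1 !(addr0, subr0, oppr0).
  by field.
move: L0; rewrite E.
have Kh : 16 / q ^+ 5 * M * h ^+ 4 <= m / 2 * h ^+ 2.
  have -> : h ^+ 4 = h ^+ 2 * h ^+ 2 by ring.
  rewrite mulrA; apply: ler_wpM2r; first exact: sqr_ge0.
  apply: (@le_trans _ _ (K * h)).
    apply: (@le_trans _ _ (K * h ^+ 2)).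
      by apply: ler_wpM2r; [exact: sqr_ge0|rewrite /K lerDl].
    by rewrite ler_pM2l// expr2 ger_pMr//; lra.
  by move: h6; rewrite ler_pdivlMr ?mulr_gt0//; lra.
have Rh : (r * h) ^+ 2 <= h ^+ 2 by rewrite exprMn ler_piMl ?sqr_ge0// expr_le1 ?ltW.
have hh : 0 < h ^+ 2 by rewrite exprn_gt0.
move: L1 L2; rewrite !ler_norml -/q => /andP[_ L1] /andP[L2 _].
nra.
Qed.

Lemma poisson_formula u r : (forall z, enorm z < 1 -> {for z, continuous u}) ->
  dlap_small u -> 0 < r < 1 -> forall z, enorm z < 1 ->
  u (r *: z) = poisson_int (dilate u r) z.
Proof.
move=> cu lu r01 z z1; apply/eqP; rewrite eq_le poisson_formula_le//=.
have r01' : 0 <= r < 1 by case/andP: r01 => /ltW -> ->.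
have cg := continuous_dilate cu r01'.
have [M gM] := continuous_dilate_bounded cu r01'.
have bg : bmeas (dilate u r) by apply: bmeas_bounded gM; exact: continuous_measurable_plane.
(* The reverse inequality is the same one for [- u]. *)
have := @poisson_formula_le (fun x => - u x) r _ _ r01 z z1.
rewrite lerNl; have -> : poisson_int (dilate (fun x => - u x) r) z = - poisson_int (dilate u r) z.
  rewrite /poisson_int -mulN1r -bintZ; last by apply: bmeasM => //; exact: bmeas_pk.
  by apply: eq_Rintegral => eta _; rewrite /dilate mulN1r mulrN.
rewrite opprK; apply.
- by move=> x x1; apply: cvgN; exact: cu.
- move=> x x1 e e0; have [d d0 hd] := lu x x1 e e0; exists d => // h h0.
  apply: le_trans (hd h h0); rewrite -normrN le_eqVlt; apply/orP; left; apply/eqP.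
  by congr `|_|; rewrite /dlap; ring.
Qed.

End poisson_formula.

(** * Differential calculus of maps into the Hilbert space *)

Section lin2.
Context (R : realType) (H : normedModType R) (A B : H).

Definition lin2 (v : R * R) : H := v.1 *: A + v.2 *: B.

Lemma lin2_linear : linear lin2.
Proof.
move=> k u v; rewrite /lin2 /= !scalerDl scalerDr !scalerA /GRing.scale/=.
by rewrite addrACA.
Qed.

HB.instance Definition _ := GRing.isLinear.Build R (R * R)%type H *:%R lin2 lin2_linear.

Lemma continuous_lin2 : continuous lin2.
Proof.
move=> v; apply: cvgD; apply: cvgZ; try exact: cvg_cst.
  exact: continuous_fst_plane.
exact: continuous_snd_plane.
Qed.

End lin2.

Lemma scale_ex (R : realType) (t : R) : t *: e_x R = (t, 0).
Proof. by apply: injective_projections; [exact: mulr1|exact: mulr0]. Qed.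

Lemma scale_ey (R : realType) (t : R) : t *: e_y R = (0, t).
Proof. by apply: injective_projections; [exact: mulr0|exact: mulr1]. Qed.

Lemma scale_exy (R : realType) (x y : R) : x *: e_x R + y *: e_y R = (x, y).
Proof. by rewrite scale_ex scale_ey; apply: injective_projections;
  [exact: addr0|exact: add0r]. Qed.

Section line_derivative.
Context (R : realType).
Implicit Types (f df : R -> R) (t k : R).

Lemma is_derive_line (V W : normedModType R) (f : V -> W) (z v : V) (t : R) :
  derivable f (z + t *: v) v ->
  is_derive t (1 : R) (fun s : R => f (z + s *: v)) ('D_v f (z + t *: v)).
Proof.
have E : (fun h : R => h^-1 *: (((fun s : R => f (z + s *: v)) \o shift t) (h *: (1 : R))
  - f (z + t *: v)))
  = (fun h : R => h^-1 *: ((f \o shift (z + t *: v)) (h *: v) - f (z + t *: v))).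
  apply/funext => h /=; congr (_ *: (f _ - _)).
  by rewrite [h *: _]mulr1 scalerDl addrCA addrA.
by move=> df; split; rewrite /derivable /derive E.
Qed.

Lemma is_derive_continuous f df t : is_derive t (1 : R) f (df t) -> {for t, continuous f}.
Proof. by move=> h; apply: differentiable_continuous; apply/derivable1_diffP/ex_derive. Qed.

(** Mean value theorem for an increment of either sign. *)
Lemma MVT_sym f df k : (forall t, `|t| <= `|k| -> is_derive t (1 : R) f (df t)) ->
  exists2 t, `|t| <= `|k| & f k - f 0 = df t * k.
Proof.
move=> hd; have [k0|k0] := leP 0 k.
  have hdk t : t \in `[0, k] -> is_derive t (1 : R) f (df t).
    by rewrite in_itv/= => /andP[t0 tk]; apply: hd; rewrite !ger0_norm.
  have cw : {within `[0, k], continuous f}.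
    apply: continuous_in_subspaceT => t /set_mem /= tk.
    exact: (is_derive_continuous (hdk t tk)).
  have hdo t : t \in `]0, k[ -> is_derive t (1 : R) f (df t).
    by move=> tk; apply: hdk; move: tk; rewrite !in_itv/= => /andP[/ltW -> /ltW ->].
  have [t tk ->] := MVT_segment k0 hdo cw.
  exists t; last by rewrite subr0.
  by move: tk; rewrite in_itv/= => /andP[t0 tk]; rewrite !ger0_norm.
have k0' := ltW k0.
have hdk t : t \in `[k, 0] -> is_derive t (1 : R) f (df t).
  by rewrite in_itv/= => /andP[t0 tk]; apply: hd; rewrite !ler0_norm// lerN2.
have cw : {within `[k, 0], continuous f}.
  apply: continuous_in_subspaceT => t /set_mem /= tk.
  exact: (is_derive_continuous (hdk t tk)).
have hdo t : t \in `]k, 0[ -> is_derive t (1 : R) f (df t).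
  by move=> tk; apply: hdk; move: tk; rewrite !in_itv/= => /andP[/ltW -> /ltW ->].
have [t tk E] := MVT_segment k0' hdo cw.
exists t.
  by move: tk; rewrite in_itv/= => /andP[t0 t1]; rewrite !ler0_norm// lerN2.
by rewrite -opprB E sub0r mulrN opprK.
Qed.

End line_derivative.

Section hilbert_derivative.
Context (R : realType) (H : completeNormedModType R) (ip : {dot H for @idfun R}).
Hypothesis hip : forall x : H, ip x x = `|x| ^+ 2.
Implicit Types (F : R * R -> H) (z v w : R * R).

Lemma derivable_ip (V : normedModType R) (F : V -> H) (z v : V) (w : H) : derivable F z v ->
  derivable (fun x => ip (F x) w : R) z v /\
  'D_v (fun x => ip (F x) w : R) z = ip ('D_v F z) w.
Proof.
move=> dF.
have E : (fun h : R => h^-1 *: (((fun x => ip (F x) w) \o shift z) (h *: v) - ip (F z) w))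
  = (fun h : R => ip (h^-1 *: ((F \o shift z) (h *: v) - F z)) w).
  by apply/funext => h /=; rewrite ipZl ipBl.
have h : (fun h : R => h^-1 *: (((fun x => ip (F x) w) \o shift z) (h *: v) - ip (F z) w)) @ 0^'
    --> ip ('D_v F z) w.
  by rewrite E; exact: (cvg_ipl hip).
by split; [apply/cvg_ex; exists (ip ('D_v F z) w)|exact: cvg_lim].
Qed.

(** Vector mean value inequality: the scalar theorem is applied to the pairing with each [w], at a
    point that may depend on [w], and [norm_le_ip] recovers the norm. *)
Lemma line_increment F z v (k e : R) (D : H) :
  (forall t : R, `|t| <= `|k| -> derivable F (z + t *: v) v /\
     `|'D_v F (z + t *: v) - D| <= e) ->
  `|F (z + k *: v) - F z - k *: D| <= e * `|k|.
Proof.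
move=> hF; have e0 : 0 <= e.
  have k0 : `|0 : R| <= `|k| by rewrite normr0.
  by have [_] := hF 0 k0; exact: le_trans.
apply: (norm_le_ip hip); first by rewrite mulr_ge0.
move=> w.
have [t tk E] : exists2 t : R, `|t| <= `|k| &
    ip (F (z + k *: v)) w - ip (F (z + 0 *: v)) w = ip ('D_v F (z + t *: v)) w * k.
  apply: (@MVT_sym _ (fun t => ip (F (z + t *: v)) w) (fun t => ip ('D_v F (z + t *: v)) w)).
  move=> t tk; have [dF _] := hF t tk.
  have [d1 d2] := derivable_ip w dF.
  by rewrite -d2; exact: is_derive_line.
rewrite scale0r addr0 in E.
rewrite !ipBl E ipZl [k * _]mulrC -mulrBl -ipBl normrM mulrAC.
apply: ler_wpM2r => //; apply: le_trans (ip_le_norm hip _ _) _.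
by apply: ler_wpM2r => //; have [_] := hF t tk.
Qed.

(** The increment is split along a horizontal and then a vertical segment, each controlled by the
    continuity of one partial derivative at [z]. *)
Lemma C1_lin2_approx F z : C1_on_disk F -> unit_disk R z -> forall e : R, 0 < e ->
  exists2 d : R, 0 < d & forall k, enorm k < d ->
    `|F (k + z) - F z - lin2 ('D_(e_x R) F z) ('D_(e_y R) F z) k| <= e * (`|k.1| + `|k.2|).
Proof.
move=> C1 zd e e0; have [_ _ cx cy] := C1 z zd.
have [d1 d10 h1] := (cvg_enormP _ z).1 cx e e0.
have [d2 d20 h2] := (cvg_enormP _ z).1 cy e e0.
have z1 : enorm z < 1 by [].
exists (Num.min (Num.min d1 d2) (1 - enorm z)).
  by rewrite !lt_min d10 d20 subr_gt0.
move=> k; rewrite !lt_min => /andP[/andP[k1 k2] k3].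
have small (x : R * R) : enorm x <= enorm k -> [/\ unit_disk R (z + x),
    enorm (z + x - z) < d1 & enorm (z + x - z) < d2].
  move=> xk; rewrite addrAC subrr add0r; split; try exact: le_lt_trans xk _.
  by rewrite /unit_disk/=; apply: le_lt_trans (enorm_triangle _ _) _; lra.
have le_k (x y : R) : `|x| <= `|k.1| -> `|y| <= `|k.2| -> enorm (x, y) <= enorm k.
  move=> xk yk; rewrite -ler_sqr ?nnegrE// !sqr_enorm /=.
  rewrite -(real_normK (num_real x)) -(real_normK (num_real y)).
  rewrite -(real_normK (num_real k.1)) -(real_normK (num_real k.2)).
  by apply: lerD; apply: lerXn2r; rewrite ?nnegrE.
have L1 := @line_increment F z (e_x R) k.1 e ('D_(e_x R) F z).
have L2 := @line_increment F (z + k.1 *: e_x R) (e_y R) k.2 e ('D_(e_y R) F z).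
have {}L1 : `|F (z + k.1 *: e_x R) - F z - k.1 *: 'D_(e_x R) F z| <= e * `|k.1|.
  apply: L1 => t tk.
  have [|zt zt1 zt2] := small (t *: e_x R).
    by rewrite scale_ex; apply: le_k => //; rewrite normr0.
  by have [dx _ _ _] := C1 _ zt; split => //; rewrite distrC; exact: h1.
have {}L2 : `|F (z + k.1 *: e_x R + k.2 *: e_y R) - F (z + k.1 *: e_x R)
  - k.2 *: 'D_(e_y R) F z| <= e * `|k.2|.
  apply: L2 => t tk.
  have [|zt zt1 zt2] := small (k.1 *: e_x R + t *: e_y R).
    by rewrite scale_exy; exact: le_k.
  by rewrite addrA in zt zt2; have [_ dy _ _] := C1 _ zt; split => //; rewrite distrC; exact: h2.
have -> : k + z = z + k.1 *: e_x R + k.2 *: e_y R.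
  by rewrite addrC -addrA scale_exy -surjective_pairing.
set a := F (z + _ + _) in L2 *; set b := F (z + _) in L1 L2.
rewrite (_ : a - _ - _ = (b - F z - k.1 *: 'D_(e_x R) F z) + (a - b - k.2 *: 'D_(e_y R) F z)).
  by rewrite mulrDr; apply: le_trans (ler_normD _ _) _; exact: lerD.
have E : b - F z + (a - b) = a - F z by rewrite addrC addrA subrK.
by rewrite [RHS]addrACA E -opprD.
Qed.

Lemma C1_diff F z : C1_on_disk F -> unit_disk R z ->
  differentiable F z /\ 'd F z = lin2 ('D_(e_x R) F z) ('D_(e_y R) F z) :> (R * R -> H).
Proof.
move=> C1 zd.
have E : F \o shift z = cst (F z) + lin2 ('D_(e_x R) F z) ('D_(e_y R) F z) +o_ (0 : R * R) id.
  (* Halving e compensates that the sum of the two coordinates is at most twice the max norm. *)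
  apply/eqaddoP => e e0; have e20 : 0 < e / 2 by rewrite divr_gt0.
  have [d d0 hd] := C1_lin2_approx C1 zd e20.
  apply/near_enorm; exists d => // k; rewrite subr0 => kd.
  rewrite (_ : (_ - _) k = F (k + z) - F z - lin2 ('D_(e_x R) F z) ('D_(e_y R) F z) k);
    last first.
    by rewrite -addrA -opprD.
  apply: le_trans (hd k kd) _.
  rewrite -mulrA; apply: ler_wpM2l; first exact: ltW.
  rewrite mulrC ler_pdivrMr// mulr_natr mulr2n.
  by apply: lerD; rewrite prod_normE le_max lexx ?orbT.
have dE := diff_unique (@continuous_lin2 R H ('D_(e_x R) F z) ('D_(e_y R) F z)) E.
split => //; apply/diff_locallyP; rewrite dE; split => //; exact: continuous_lin2.
Qed.

Lemma C1_continuous F z : C1_on_disk F -> unit_disk R z -> {for z, continuous F}.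
Proof. by move=> C1 zd; have [dF _] := C1_diff C1 zd; exact: differentiable_continuous. Qed.

(** Mean value theorem for f t + f (- t) - t^2 k: its derivative is the difference of two
    first-order Taylor errors of [f'] at 0. *)
Lemma second_difference (f f' : R -> R) (k e h : R) : 0 <= e -> 0 < h ->
  (forall t, `|t| <= h -> is_derive t (1 : R) f (f' t)) ->
  (forall t, `|t| <= h -> `|f' t - f' 0 - t * k| <= e * `|t|) ->
  `|f h + f (- h) - 2 * f 0 - h ^+ 2 * k| <= 2 * e * h ^+ 2.
Proof.
move=> e0 h0 hd he.
pose g t := f t + f (- t) - t ^+ 2 * k.
pose g' t := f' t - f' (- t) - 2 * t * k.
have dg t : `|t| <= `|h| -> is_derive t (1 : R) g (g' t).
  rewrite (gtr0_norm h0) => th.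
  have h1 := hd t th; have h2 : is_derive (- t) (1 : R) f (f' (- t)) by apply: hd; rewrite normrN.
  have h3 : is_derive t (1 : R) (fun t => f (- t)) (f' (- t) * -1).
    exact: (is_derive1_comp h2 (is_deriveN (is_derive_id t (1 : R)))).
  have h4 : is_derive t (1 : R) (fun t => t ^+ 2 * k) (2 * t * k).
    apply: is_derive_eq; rewrite /GRing.scale/=; ring.
  have h5 : is_derive t (1 : R) (fun x => f x + f (- x) - x ^+ 2 * k) (f' t + f' (- t) * -1
    - 2 * t * k).
    exact: is_deriveB (is_deriveD h1 h3) h4.
  by apply: is_derive_eq h5 _; rewrite /g'; ring.
have [t th E] := MVT_sym dg; rewrite (gtr0_norm h0) in th.
rewrite (_ : f h + _ - _ - _ = g h - g 0); last by rewrite /g oppr0; ring.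
rewrite E normrM (gtr0_norm h0) expr2 mulrA; apply: ler_wpM2r; first exact: ltW.
rewrite (_ : g' t = (f' t - f' 0 - t * k) - (f' (- t) - f' 0 - - t * k)); last
  by rewrite /g'; ring.
have := he t th; have := he (- t); rewrite normrN => /(_ th).
move=> h1 h2; apply: le_trans (ler_normB _ _) _.
by have : e * `|t| <= e * h by [apply: ler_wpM2l]; lra.
Qed.

Lemma dlap_algebra (A1 A2 A3 A4 X Y C q e : R) : X + Y = 0 ->
  `|A1 + A2 - 2 * C - X| <= 2 * (e / 4) * q ->
  `|A3 + A4 - 2 * C - Y| <= 2 * (e / 4) * q ->
  `|A1 + A2 + (A3 + A4) - 4 * C| <= e * q.
Proof.
move=> XY hX hY.
rewrite (_ : _ - _ = (A1 + A2 - 2 * C - X) + (A3 + A4 - 2 * C - Y) + (X + Y)); last by ring.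
rewrite XY addr0; apply: le_trans (ler_normD _ _) _; apply: le_trans (lerD hX hY) _.
by rewrite le_eqVlt; apply/orP; left; apply/eqP; field.
Qed.

(** On each axis the second difference equals h^2 times the second derivative up to 2 (e / 4) h^2;
    the two main terms cancel by the Laplace equation. *)
Lemma harmonic_dlap_small F (w : H) : Defs.harmonic F -> dlap_small (fun x => ip (F x) w).
Proof.
move=> [[C1 C1x C1y] lap] z z1 e e0.
have zd : unit_disk R z by [].
pose e' := e / 4; have e'0 : 0 < e' by rewrite divr_gt0.
have key v (D : R * R -> H) (D2 : H) : enorm v = 1 -> D = 'D_v F -> D2 = 'D_v D z ->
    (forall x, unit_disk R x -> derivable F x v) -> differentiable D z ->
    exists2 d : R, 0 < d & forall h : R, 0 < h < d ->
    `|ip (F (z + h *: v)) w + ip (F (z - h *: v)) w - 2 * ip (F z) w - h ^+ 2 * ip D2 w|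
      <= 2 * e' * h ^+ 2.
  move=> v1 DE D2E dF dD.
  have du : derivable D z v by exact: diff_derivable.
  have [du1 du2] := derivable_ip w du.
  have : (fun t : R => t^-1 *: (ip (D (t *: v + z)) w - ip (D z) w)) @ 0^' --> ip D2 w.
    by rewrite D2E -du2; exact: du1.
  move=> /cvgrPdist_le/(_ e' e'0)/nbhs_ballP[d /= d0 hd].
  exists (Num.min d (1 - enorm z)); first by rewrite lt_min d0 subr_gt0.
  move=> h /andP[h0]; rewrite lt_min => /andP[hd1 hd2].
  have inD (t : R) : `|t| <= h -> unit_disk R (z + t *: v).
    move=> th; rewrite /unit_disk/=; apply: le_lt_trans (enorm_triangle _ _) _.
    by rewrite enormZ v1 mulr1; lra.
  have := @second_difference (fun t => ip (F (z + t *: v)) w)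
     (fun t => ip (D (z + t *: v)) w) (ip D2 w) e' h (ltW e'0) h0.
  rewrite !scaleNr scale0r addr0; apply.
    move=> t th; have [d1 d2] := derivable_ip w (dF _ (inD t th)).
    by rewrite DE -d2; exact: is_derive_line.
  move=> t th; have [->|t0] := eqVneq t 0.
    by rewrite scale0r addr0 subrr mul0r subrr normr0 mulr0.
  have := hd t; rewrite /ball /= sub0r normrN => /(_ (le_lt_trans th hd1) t0).
  rewrite -(ler_pM2r (x := `|t|)) ?normr_gt0// -normrM distrC => h3; apply: le_trans h3.
  rewrite le_eqVlt; apply/orP; left; apply/eqP; congr `|_|.
  by rewrite /GRing.scale/= [z + _]addrC; field.
have [dxF _] := C1_diff C1x zd; have [dyF _] := C1_diff C1y zd.
have [d1 d10 h1] := key _ _ _ (enorm_ex R) erefl erefl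
  (fun x xd => let: And4 a _ _ _ := C1 x xd in a) dxF.
have [d2 d20 h2] := key _ _ _ (enorm_ey R) erefl erefl
  (fun x xd => let: And4 _ a _ _ := C1 x xd in a) dyF.
exists (Num.min d1 d2); first by rewrite lt_min d10.
move=> h /andP[h0]; rewrite lt_min => /andP[hd1 hd2].
have {}h1 : `|ip (F (z + h *: e_x R)) w + ip (F (z - h *: e_x R)) w - 2 * ip (F z) w
    - h ^+ 2 * ip ('D_(e_x R) ('D_(e_x R) F) z) w| <= 2 * e' * h ^+ 2.
  by apply: h1; rewrite h0.
have {}h2 : `|ip (F (z + h *: e_y R)) w + ip (F (z - h *: e_y R)) w - 2 * ip (F z) w
    - h ^+ 2 * ip ('D_(e_y R) ('D_(e_y R) F) z) w| <= 2 * e' * h ^+ 2.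
  by apply: h2; rewrite h0.
have h3 : h ^+ 2 * ip ('D_(e_x R) ('D_(e_x R) F) z) w + h ^+ 2 * ip ('D_(e_y R)
  ('D_(e_y R) F) z) w = 0.
  by rewrite -mulrDr -ipDl -/(laplacian F z) lap// ip0l mulr0.
exact: dlap_algebra h3 h1 h2.
Qed.

End hilbert_derivative.

(** * Fubini for bounded functions and for the Poisson kernel *)

Section fubini_bounded.
Context d1 d2 (T1 : measurableType d1) (T2 : measurableType d2) (R : realType).
Variables (m1 : probability T1 R) (m2 : probability T2 R).

Lemma bmeas_pair1 (k : T1 * T2 -> R) y : bmeas k -> bmeas (fun x => k (x, y)).
Proof.
move=> [mk [C kC]]; split; last by exists C => x; exact: kC.
exact: measurable_fun_pair1.
Qed.

Lemma bmeas_pair2 (k : T1 * T2 -> R) x : bmeas k -> bmeas (fun y => k (x, y)).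
Proof.
move=> [mk [C kC]]; split; last by exists C => y; exact: kC.
exact: measurable_fun_pair2.
Qed.

Lemma bmeas_prod_integrable (k : T1 * T2 -> R) : bmeas k ->
  (m1 \x m2)%E.-integrable setT (EFin \o k).
Proof.
move=> [mk [C kC]]; apply: measurable_bounded_integrable => //.
  rewrite -[ltLHS]/((m1 \x m2)%E [set: T1 * T2]) -setXTT product_measure1E//.
  have -> : (m1 [set: T1] * m2 [set: T2] = 1 * 1)%E.
    by congr (_ * _)%E; exact: probability_setT.
  by rewrite mule1 ltry.
exists C; split; first by rewrite num_real.
by move=> M CM x _; apply: le_trans (kC x) (ltW CM).
Qed.

Lemma bmeas_bint (k : T1 * T2 -> R) : bmeas k -> bmeas (fun x => \int[m2]_y k (x, y)).
Proof.
move=> bk; have [mk [C kC]] := bk; split; last first.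
  exists C => x; apply: bint_norm_le; first exact: bmeas_pair2.
  by apply: aeW => y; exact: kC.
have := measurable_fubini_F (bmeas_prod_integrable bk).
by apply: measurableT_comp.
Qed.

Lemma bint_fubini (k : T1 * T2 -> R) : bmeas k ->
  \int[m1]_x \int[m2]_y k (x, y) = \int[m2]_y \int[m1]_x k (x, y).
Proof.
move=> bk; have := Fubini (bmeas_prod_integrable bk) => /= E.
rewrite /Rintegral; congr fine.
under eq_integral => x _ do rewrite -/(Rintegral _ _ _) (bmeas_fineK m2 (bmeas_pair2 x bk)).
rewrite E; apply: eq_integral => y _.
by rewrite -(bmeas_fineK m1 (bmeas_pair1 y bk)).
Qed.

End fubini_bounded.

Section poisson_fubini.
Context (R : realType).
Local Notation cm := (circle_measure R).

Lemma measurable_edot :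
  measurable_fun setT (fun p : (R * R) * (R * R) => edot p.1 p.2).
Proof.
have m1 : measurable_fun setT (fun p : (R * R) * (R * R) => p.1.1).
  by apply: (measurableT_comp measurable_fst); exact: measurable_fst.
have m2 : measurable_fun setT (fun p : (R * R) * (R * R) => p.1.2).
  by apply: (measurableT_comp measurable_snd); exact: measurable_fst.
have m3 : measurable_fun setT (fun p : (R * R) * (R * R) => p.2.1).
  by apply: (measurableT_comp measurable_fst); exact: measurable_snd.
have m4 : measurable_fun setT (fun p : (R * R) * (R * R) => p.2.2).
  by apply: (measurableT_comp measurable_snd); exact: measurable_snd.
by apply: measurable_funD; apply: measurable_funM.
Qed.

Lemma bmeas_pkr (t : R) : 0 <= t < 1 ->
  bmeas (fun p : (R * R) * (R * R) => pkr t (t * edot p.1 p.2)).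
Proof.
move=> t01; split.
  apply: (@measurableT_comp _ _ _ _ _ _ (pkr t)).
    by apply: continuous_measurable_fun; exact: continuous_pkr.
  by apply: measurable_funM; [exact: measurable_cst|exact: measurable_edot].
exists ((1 - t ^+ 2) / (1 - t) ^+ 2) => x.
by rewrite ger0_norm ?pkr_ge0//; exact: pkr_le.
Qed.

Lemma pk_circle (t : R) (zeta eta : R * R) : 0 <= t -> enorm zeta = 1 ->
  pk (t *: zeta) eta = pkr t (t * edot zeta eta).
Proof. by move=> t0 z1; rewrite /pk enormZ z1 mulr1 ger0_norm// edotZl. Qed.

(** On the circle the kernel at [t *: zeta] evaluated at [eta] depends only on [edot zeta eta],
    hence is symmetric. The form [pkr] is jointly measurable on the plane and agrees with it almost
    everywhere. *)
Lemma poisson_fubini (k : (R * R) * (R * R) -> R) (t : R) : 0 <= t < 1 -> bmeas k ->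
  \int[cm]_zeta \int[cm]_eta (pk (t *: zeta) eta * k (zeta, eta)) =
  \int[cm]_eta \int[cm]_zeta (pk (t *: eta) zeta * k (zeta, eta)).
Proof.
move=> t01 bk; have [t0 t1] := andP t01.
rewrite (@ae_eq_Rintegral _ _ _ cm _ (fun zeta =>
  \int[cm]_eta (pkr t (t * edot zeta eta) * k (zeta, eta)))); last first.
  by apply: filterS (ae_circle R) => zeta z1; apply: eq_Rintegral => eta _; rewrite pk_circle.
rewrite (bint_fubini cm cm (bmeasM (bmeas_pkr t01) bk)) /=.
apply: ae_eq_Rintegral; apply: filterS (ae_circle R) => eta e1.
by apply: eq_Rintegral => zeta _; rewrite pk_circle// edotC.
Qed.

End poisson_fubini.

(** * Almost everywhere convergence from summable L1 distances *)

Section L1_convergence.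
Context d (T : measurableType d) (R : realType).
Variable mu : probability T R.

(** Beppo Levi: the integrals are dominated by a geometric series, so the sum of the series is
    integrable and thus finite almost everywhere. *)
Lemma ae_cvg_series (h : nat -> T -> R) (c : R) :
  (forall n, bmeas (h n)) -> (forall n x, 0 <= h n x) ->
  (forall n, \int[mu]_x h n x <= c * 2^-1 ^+ n) ->
  {ae mu, forall x, cvgn (series (h ^~ x))}.
Proof.
move=> bh h0 hc.
pose f x := (\sum_(0 <= n <oo) (h n x)%:E)%E.
have mh n : measurable_fun setT (EFin \o h n) by apply/measurable_EFinP; case: (bh n).
have If : (\int[mu]_x f x < +oo)%E.
  rewrite integral_nneseries//; last by move=> n x _; rewrite lee_fin.
  apply: (@le_lt_trans _ _ (\sum_(0 <= n <oo) (c * 2^-1 ^+ n)%:E)%E).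
    apply: lee_nneseries => [n _ _|n _].
      by apply: integral_ge0 => x _; rewrite lee_fin.
    by rewrite -bmeas_fineK// lee_fin.
  have c0 : 0 <= c.
    by have := hc 0%N; rewrite expr0 mulr1; apply: le_trans; exact: Rintegral_ge0.
  have : (fun n => \sum_(0 <= k < n) (c * 2^-1 ^+ k)%:E)%E @ \oo --> (c * 2)%:E.
    under eq_fun do rewrite sumEFin.
    apply: cvg_EFin; first exact: nearW.
    have := @cvg_geometric_series R c 2^-1.
    rewrite ger0_norm// => /(_ _); rewrite (_ : c / (1 - 2^-1) = c * 2).
      by apply; rewrite invf_lt1// ltr1n.
    by field.
  by move=> /cvg_lim ->//; rewrite ltry.
have mf : measurable_fun setT f.
  apply: (@ge0_emeasurable_sum _ _ R setT (fun n x => (h n x)%:E) xpredT) => [n x _ _|n _].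
    by rewrite lee_fin.
  exact: mh.
have f0 x : (0 <= f x)%E by apply: nneseries_ge0 => n _ _; rewrite lee_fin.
have /integrable_ae : mu.-integrable setT f.
  apply/integrableP; split => //.
  by rewrite (eq_integral f) => [|x _]//; rewrite gee0_abs.
move=> /(_ measurableT); apply: filterS => x /(_ I) fx.
apply: nondecreasing_is_cvgn.
  apply/nondecreasing_seqP => n; rewrite seriesSr lerDl; exact: h0.
exists (fine (f x)) => _ [n _ <-].
rewrite -lee_fin fineK// /series/= -sumEFin.
by apply: nneseries_lim_ge => k _ _; rewrite lee_fin.
Qed.

End L1_convergence.

Section L1_convergence_hilbert.
Context d (T : measurableType d) (R : realType) (H : completeNormedModType R).
Variable mu : probability T R.

(** The telescoping series of increments converges absolutely almost everywhere, and H is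
    complete. *)
Lemma ae_cvg_of_L1 (g_ : nat -> T -> H) (c : R) : (forall n, bsm (g_ n)) ->
  (forall n, \int[mu]_x `|g_ n.+1 x - g_ n x| <= c * 2^-1 ^+ n) ->
  {ae mu, forall x, cvgn (g_ ^~ x)}.
Proof.
move=> bg hg.
have bh n : bmeas (fun x => `|g_ n.+1 x - g_ n x|) by apply: bsm_norm; exact: bsm_sub.
have := ae_cvg_series bh (fun n x => normr_ge0 _) hg.
apply: filterS => x hx.
have : cvgn (series (telescope (g_ ^~ x))) by apply: normed_cvg; exact: hx.
rewrite telescopeK => /cvg_ex[l hl]; apply/cvg_ex; exists (l + g_ 0%N x).
rewrite (_ : g_ ^~ x = (fun n => (g_ n x - g_ 0%N x) + g_ 0%N x)).
  by apply: cvgD; [exact: hl|exact: cvg_cst].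
by apply/funext => n; rewrite subrK.
Qed.

Lemma ae_cvg0_of_L1 (h : nat -> T -> R) (c : R) :
  (forall n, bmeas (h n)) -> (forall n x, 0 <= h n x) ->
  (forall n, \int[mu]_x h n x <= c * 2^-1 ^+ n) ->
  {ae mu, forall x, h ^~ x @ \oo --> 0}.
Proof.
by move=> bh h0 hc; apply: filterS (ae_cvg_series bh h0 hc) => x; exact: cvg_series_cvg_0.
Qed.

Lemma bsm_simple_approx (f : T -> H) (e : R) : bsm f -> 0 < e ->
  exists2 g : T -> H, fin_meas g & \int[mu]_x `|f x - g x| <= e.
Proof.
move=> bf e0; have [g_ [mg gf [C gC]]] := bsm_approx bf.
have bg n : bsm (g_ n) by exact: fin_meas_bsm.
have bfg n : bmeas (fun x => `|f x - g_ n x|) by apply: bsm_norm; exact: bsm_sub.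
have [_ [D fD]] := bf.
have : \int[mu]_x `|f x - g_ n x| @[n --> \oo] --> 0.
  apply: (@bint_near_cvg0 _ _ _ mu _ (D + C)) => //.
    by move=> n x; rewrite normr_id (le_trans (ler_normB _ _))// lerD.
  apply: aeW => x; apply/norm_cvg0P; rewrite -(subrr (f x)).
  by apply: cvgB; [exact: cvg_cst|exact: gf].
move=> /cvgr0_norm_le/(_ e e0)[n _ hn]; exists (g_ n) => //.
by apply: le_trans (ler_norm _) (hn n (leqnn n)).
Qed.

(** Integrates the pointwise inequality 2 c |f| <= c^2 + |f|^2. *)
Lemma L1_le_L2 (f : T -> H) (c : R) : bsm f -> 0 < c ->
  \int[mu]_x (`|f x| ^+ 2) <= c ^+ 2 -> \int[mu]_x `|f x| <= c.
Proof.
move=> bf c0 hc; have bn := bsm_norm bf.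
have b2 : bmeas (fun x => `|f x| ^+ 2) by exact: bmeasM.
apply: (@le_trans _ _ (\int[mu]_x (2^-1 * (c + c^-1 * `|f x| ^+ 2)))).
  apply: le_bint => //.
    by apply: bmeasZ; apply: bmeasD; [exact: bmeas_cst|exact: bmeasZ].
  move=> x; rewrite -subr_ge0.
  rewrite (_ : _ - _ = (c - `|f x|) ^+ 2 / (2 * c)); last by field; rewrite gt_eqF.
  by rewrite divr_ge0 ?sqr_ge0// mulr_ge0// ltW.
rewrite bintZ; last by apply: bmeasD; [exact: bmeas_cst|exact: bmeasZ].
rewrite bintD; [|exact: bmeas_cst|exact: bmeasZ].
rewrite bint_cst bintZ//.
have : c^-1 * (\int[mu]_x (`|f x| ^+ 2)) <= c.
  by rewrite ler_pdivrMl// -expr2.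
lra.
Qed.

End L1_convergence_hilbert.

(** A positive first increment would persist by convexity and force linear growth past the bound
    [M]. *)
Lemma convex_bounded_le (R : realType) (M : R) (a : nat -> R) :
  (forall n, 0 <= a n <= M) -> (forall n, 2 * a n.+1 <= a n + a n.+2) ->
  a 1%N <= a 0%N.
Proof.
move=> aM conv; rewrite leNgt; apply/negP => h.
pose dlt := a 1%N - a 0%N; have dlt0 : 0 < dlt by rewrite subr_gt0.
have step n : dlt <= a n.+1 - a n.
  by elim: n => [|n IH]; [rewrite /dlt|have := conv n; lra].
have lin n : a 0%N + n%:R * dlt <= a n.
  elim: n => [|n IH]; first by rewrite mul0r addr0.
  by have := step n; rewrite -natr1 mulrDl mul1r; lra.
have M0 : 0 <= M by have /andP[] := aM 0%N; exact: le_trans.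
have : M / dlt < (Num.bound (M / dlt))%:R by rewrite archi_boundP// divr_ge0// ltW.
rewrite ltr_pdivrMr//; have := lin (Num.bound (M / dlt)).
have /andP[a0 _] := aM 0%N; have /andP[_ am] := aM (Num.bound (M / dlt)); lra.
Qed.

(** * Growth of the L2 norms on circles *)

Section boundary_values.
Context (R : realType) (H : completeNormedModType R) (ip : {dot H for @idfun R}).
Hypothesis hip : forall x : H, ip x x = `|x| ^+ 2.
Local Notation cm := (circle_measure R).
Variables (F : R * R -> H) (C : R).
Hypothesis hF : Defs.harmonic F.
Hypothesis FC : forall z, unit_disk R z -> `|F z| <= C.
Implicit Types (r q t : R) (z zeta eta : R * R).

Let C1F : C1_on_disk F. Proof. by case: hF => -[]. Qed.

Lemma harmonic_continuous z : enorm z < 1 -> {for z, continuous F}.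
Proof. by move=> z1; exact: (C1_continuous hip C1F). Qed.

Lemma dilate_le r eta : 0 <= r < 1 -> `|dilate F r eta| <= C.
Proof.
move=> /andP[r0 r1]; apply: FC; rewrite /unit_disk/= enormZ ger0_norm//.
by apply: le_lt_trans r1; rewrite ler_piMr// enorm_retract.
Qed.

Lemma bsm_dilate r : 0 <= r < 1 -> bsm (dilate F r).
Proof.
move=> r01; split; last by exists C => eta; exact: dilate_le.
by apply: continuous_sm; apply: continuous_dilate => //; exact: harmonic_continuous.
Qed.

Lemma harmonic_poisson r z (w : H) : 0 < r < 1 -> enorm z < 1 ->
  ip (F (r *: z)) w = \int[cm]_eta (pk z eta * ip (dilate F r eta) w).
Proof.
move=> r01 z1.
apply: (@poisson_formula _ (fun x => ip (F x) w) r _ _ r01 z z1).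
  by move=> x x1; apply: (cvg_ipl hip); exact: harmonic_continuous.
exact: harmonic_dlap_small.
Qed.

Definition corr r q : R := \int[cm]_zeta ip (dilate F r zeta) (dilate F q zeta).

Lemma corrC r q : corr r q = corr q r.
Proof. by apply: eq_Rintegral => zeta _; rewrite ipC. Qed.

Lemma dilate_mul r t zeta : 0 <= t < 1 -> enorm zeta = 1 ->
  dilate F (r * t) zeta = F (r *: (t *: zeta)).
Proof.
by move=> t01 z1; rewrite /dilate retract_id ?z1// scalerA.
Qed.

(* [F (r * t) .] is the Poisson integral of [F r .] and the kernel is symmetric. *)
Lemma corr_shift r q t : 0 < r < 1 -> 0 < q < 1 -> 0 < t < 1 ->
  corr (r * t) q = corr r (q * t).
Proof.
move=> r01 q01 t01; have [t0 t1] := andP t01.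
have t01' : 0 <= t < 1 by rewrite ltW.
have r01' : 0 <= r < 1 by case/andP: r01 => /ltW ->.
have q01' : 0 <= q < 1 by case/andP: q01 => /ltW ->.
have tz1 zeta : enorm zeta = 1 -> enorm (t *: zeta) < 1.
  by move=> z1; rewrite enormZ z1 mulr1 gtr0_norm.
have bk : bmeas (fun p : (R * R) * (R * R) => ip (dilate F r p.2) (dilate F q p.1)).
  apply: (bsm_ip hip).
    split; last by exists C => p; exact: dilate_le.
    by have [sf _] := bsm_dilate r01'; exact: (sm_comp measurable_snd sf).
  split; last by exists C => p; exact: dilate_le.
  by have [sf _] := bsm_dilate q01'; exact: (sm_comp measurable_fst sf).
have := poisson_fubini t01' bk => /= E.
rewrite [RHS]corrC.
transitivity (\int[cm]_zeta \int[cm]_eta (pk (t *: zeta) eta * ip (dilate F r eta)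
  (dilate F q zeta))).
  apply: ae_eq_Rintegral; apply: filterS (ae_circle R) => zeta z1.
  by rewrite (dilate_mul r t01' z1) (harmonic_poisson _ r01 (tz1 _ z1)).
rewrite E; apply: ae_eq_Rintegral; apply: filterS (ae_circle R) => eta e1.
rewrite (dilate_mul q t01' e1) (harmonic_poisson _ q01 (tz1 _ e1)).
by apply: eq_Rintegral => zeta _; rewrite ipC.
Qed.

Definition energy r : R := corr r r.

Lemma bmeas_corr r q : 0 < r < 1 -> 0 < q < 1 ->
  bmeas (fun zeta => ip (dilate F r zeta) (dilate F q zeta)).
Proof.
by move=> /andP[/ltW r0 r1] /andP[/ltW q0 q1]; apply: (bsm_ip hip); apply: bsm_dilate; apply/andP.
Qed.

Lemma energy_ge0 r : 0 <= energy r.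
Proof. by apply: Rintegral_ge0 => x _; rewrite hip sqr_ge0. Qed.

Lemma energy_le r : 0 < r < 1 -> energy r <= C ^+ 2.
Proof.
move=> r01; rewrite -[leRHS](bint_cst cm); apply: le_bint.
- exact: bmeas_corr.
- exact: bmeas_cst.
move=> x; rewrite hip; apply: lerXn2r; rewrite ?nnegrE//.
  by apply: le_trans (FC (z := 0) _) => //; rewrite /unit_disk/= enorm0.
by apply: dilate_le; case/andP: r01 => /ltW ->.
Qed.

Lemma L2_dist r q : 0 < r < 1 -> 0 < q < 1 ->
  \int[cm]_zeta (`|dilate F q zeta - dilate F r zeta| ^+ 2) = energy q + energy r - 2 * corr r q.
Proof.
move=> r01 q01; rewrite /energy /corr.
rewrite -bintD; try exact: bmeas_corr.
rewrite -bintZ; last exact: bmeas_corr.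
rewrite -bintB.
- by apply: eq_Rintegral => zeta _;
    rewrite -hip !ipE (ipC _ (dilate F q zeta) (dilate F r zeta)); ring.
- by apply: bmeasD; exact: bmeas_corr.
- by apply: bmeasZ; exact: bmeas_corr.
Qed.

Lemma corr_le r q : 0 < r < 1 -> 0 < q < 1 -> 2 * corr r q <= energy r + energy q.
Proof.
move=> r01 q01; have := L2_dist r01 q01.
have : 0 <= \int[cm]_zeta (`|dilate F q zeta - dilate F r zeta| ^+ 2).
  by apply: Rintegral_ge0 => x _; exact: sqr_ge0.
lra.
Qed.

(* [energy (q * t ^+ n)] is a bounded sequence, convex in [n] by [corr_shift]. *)
Lemma le_energy r q : 0 < r -> r <= q -> q < 1 -> energy r <= energy q.
Proof.
move=> r0; rewrite le_eqVlt => /predU1P[->//|rq q1].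
have q0 := lt_trans r0 rq.
pose t := r / q; have t0 : 0 < t by rewrite divr_gt0.
have t1 : t < 1 by rewrite ltr_pdivrMr// mul1r.
pose a n := energy (q * t ^+ n).
have qt n : 0 < q * t ^+ n < 1.
  rewrite mulr_gt0 ?exprn_gt0//=; apply: le_lt_trans q1.
  by rewrite ler_piMr ?(ltW q0)// exprn_ile1// ltW.
have conv n : 2 * a n.+1 <= a n + a n.+2.
  have -> : a n.+1 = corr (q * t ^+ n) (q * t ^+ n.+2).
    have t01 : 0 < t < 1 by rewrite t0.
    rewrite -[t ^+ n.+2]/(t ^+ n.+1.+1) [t ^+ n.+2]exprSr mulrA -(corr_shift (qt n) (qt n.+1)
      t01).
    by rewrite -mulrA -exprSr.
  exact: corr_le.
have -> : energy r = a 1%N by congr energy; rewrite expr1 /t mulrC divfK// gt_eqF.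
have -> : energy q = a 0%N by rewrite /a expr0 mulr1.
apply: (@convex_bounded_le _ (C ^+ 2)) => // n.
by rewrite energy_ge0 energy_le.
Qed.

(** With t^2 = r / q, [corr_shift] gives corr r q = energy (q t), which is at least energy r by
    monotonicity; this bounds the cross term of the squared distance. *)
Lemma L2_dist_le r q : 0 < r -> r <= q -> q < 1 ->
  \int[cm]_zeta (`|dilate F q zeta - dilate F r zeta| ^+ 2) <= energy q - energy r.
Proof.
move=> r0 rq q1; have q0 := lt_le_trans r0 rq.
have r01 : 0 < r < 1 by rewrite r0 (le_lt_trans rq).
have q01 : 0 < q < 1 by rewrite q0.
rewrite L2_dist//.
suff : energy r <= corr r q by lra.
move: rq; rewrite le_eqVlt => /predU1P[->//|rq].
pose t := Num.sqrt (r / q).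
have rq0 : 0 < r / q by rewrite divr_gt0.
have t0 : 0 < t by rewrite sqrtr_gt0.
have t1 : t < 1 by rewrite -sqrtr1 ltr_sqrt// ltr_pdivrMr// mul1r.
have tt : r = q * t * t.
  by rewrite -mulrA -expr2 sqr_sqrtr ?(ltW rq0)// mulrC divfK// gt_eqF.
have qt0 : 0 < q * t by rewrite mulr_gt0.
have qt1 : q * t < 1 by apply: lt_trans q1; rewrite gtr_pMr.
rewrite [corr r q](_ : _ = energy (q * t)).
  by apply: le_energy => //; rewrite tt ger_pMr// ltW.
by rewrite {1}tt corr_shift ?qt0 ?qt1 ?t0.
Qed.

End boundary_values.

(** * Existence of the boundary function *)

Section boundary_existence.
Context (R : realType) (H : completeNormedModType R) (ip : {dot H for @idfun R}).
Hypothesis hip : forall x : H, ip x x = `|x| ^+ 2.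
Local Notation cm := (circle_measure R).
Variables (F : R * R -> H) (C : R).
Hypothesis hF : Defs.harmonic F.
Hypothesis FC : forall z, unit_disk R z -> `|F z| <= C.
Implicit Types (r q t : R) (z zeta eta : R * R).

(** The energies are bounded by C^2, and radii are chosen whose energy is within 4^-n of their
    supremum. The rate is the square of 2^-n, so that the L1 distances of consecutive dilates become
    summable. *)
Lemma radii_exist : exists rn : nat -> R, [/\ forall n, 0 < rn n < 1,
  rn @ \oo --> (1 : R) & forall n, `|energy ip F (rn n.+1) - energy ip F (rn n)| <= 4^-1 ^+ n].
Proof.
pose S := [set energy ip F r | r in [set r | 0 < r < 1]].
have Sub : ubound S (C ^+ 2) by move=> _ [r r01 <-]; exact: energy_le.
have h2 : 0 < (2^-1 : R) < 1 by rewrite invr_gt0 ltr0n invf_lt1 ?ltr1n.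
have hS : has_sup S.
  by split; [exists (energy ip F 2^-1), 2^-1|exists (C ^+ 2)].
have ex n : exists r, 0 < r < 1 /\ sup S - 4^-1 ^+ n < energy ip F r.
  have p4 : 0 < (4^-1 : R) ^+ n by rewrite exprn_gt0.
  by have [_ [r r01 <-] hr] := sup_adherent p4 hS; exists r.
have [ro hro] := choice ex.
pose sn n : R := 1 - n.+2%:R^-1.
have sn01 n : 0 < sn n < 1.
  rewrite /sn subr_gt0 invf_lt1// ltr1n/= ltrBlDr ltrDl invr_gt0//.
(* Taking the maximum with 1 - 1 / (n + 2) forces the radii to 1 and, by monotonicity of the energy,
   keeps it close to the supremum. *)
pose rn n := Num.max (ro n) (sn n).
have rn01 n : 0 < rn n < 1.
  have [/andP[r0 r1] _] := hro n; have /andP[s0 s1] := sn01 n.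
  by rewrite lt_max r0/= gt_max r1.
have en n : sup S - 4^-1 ^+ n < energy ip F (rn n) <= sup S.
  have [/andP[r0 r1] hr] := hro n; apply/andP; split.
    apply: lt_le_trans hr _; apply: (le_energy hip hF FC) => //.
      by rewrite /rn le_max lexx.
    by case/andP: (rn01 n).
  by apply: ub_le_sup; [exists (C ^+ 2)|exists (rn n); [exact: rn01|]].
exists rn; split => //.
  have sn1 : sn n @[n --> \oo] --> (1 : R).
    rewrite -[X in _ --> X]subr0; apply: cvgB; first exact: cvg_cst.
    by rewrite (cvg_shiftS (@harmonic R) (nbhs (0 : R))); exact: cvg_harmonic.
  apply: (squeeze_cvgr _ sn1 (cvg_cst (1 : R))); apply: nearW => n.
  by rewrite le_max lexx orbT/= ltW//; case/andP: (rn01 n).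
move=> n; have /andP[h3 h4] := en n; have /andP[h5 h6] := en n.+1.
have : (4^-1 : R) ^+ n.+1 <= 4^-1 ^+ n.
  by rewrite exprS ler_piMl ?exprn_ge0// invf_le1// ler1n.
rewrite ler_norml; move: h3 h4 h5 h6; set x := energy _ _ _; set y := energy _ _ _.
by set p := _ ^+ n.+1; set p' := _ ^+ n; lra.
Qed.

Lemma dist_radii r q (c : R) : 0 < r < 1 -> 0 < q < 1 -> 0 < c ->
  `|energy ip F q - energy ip F r| <= c ^+ 2 ->
  \int[cm]_zeta `|dilate F q zeta - dilate F r zeta| <= c.
Proof.
move=> r01 q01 c0 hc; have [r0 r1] := andP r01; have [q0 q1] := andP q01.
have br : bsm (dilate F r) by apply: (bsm_dilate hip hF FC); rewrite ltW.
have bq : bsm (dilate F q) by apply: (bsm_dilate hip hF FC); rewrite ltW.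
apply: L1_le_L2 => //; first exact: bsm_sub.
apply: le_trans hc; have [rq|qr] := leP r q.
  apply: le_trans (L2_dist_le hip hF FC r0 rq q1) _; exact: ler_norm.
under eq_Rintegral do rewrite distrC.
by apply: le_trans (L2_dist_le hip hF FC q0 (ltW qr) r1) _; rewrite distrC ler_norm.
Qed.

Lemma boundary_limit_exists : exists (Phi : R * R -> H) (rn : nat -> R),
  [/\ Linfty cm Phi, forall n, 0 < rn n < 1, rn @ \oo --> (1 : R) &
      {ae cm, forall zeta, dilate F (rn n) zeta @[n --> \oo] --> Phi zeta}].
Proof.
have [rn [rn01 rn1 hE]] := radii_exist.
have p2 n : 0 < (2^-1 : R) ^+ n by rewrite exprn_gt0.
have bF n : bsm (dilate F (rn n)).
  by apply: (bsm_dilate hip hF FC); case/andP: (rn01 n) => /ltW ->.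
(* [Linfty] asks for an almost everywhere limit of simple functions, so each dilate is accompanied
   by a simple [g n] at L1 distance at most 2^-n. *)
have [g hg] := choice (fun n => let: ex_intro2 g mg hg := bsm_simple_approx cm (bF n) (p2 n) in
  ex_intro (fun g => fin_meas g /\ \int[cm]_x `|dilate F (rn n) x
    - g x| <= 2^-1 ^+ n) g (conj mg hg)).
have bg n : bsm (g n) by apply: fin_meas_bsm; case: (hg n).
have bFF n m : bmeas (fun x => `|dilate F (rn n) x - dilate F (rn m) x|)
  by apply: bsm_norm; exact: bsm_sub.
have bFg n : bmeas (fun x => `|dilate F (rn n) x - g n x|) by apply: bsm_norm; exact: bsm_sub.
have dF n : \int[cm]_x `|dilate F (rn n.+1) x - dilate F (rn n) x| <= 2^-1 ^+ n.
  apply: dist_radii => //; apply: le_trans (hE n) _.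
  rewrite -exprM mulnC exprM (_ : (2^-1 : R) ^+ 2 = 4^-1)//.
  by field.
have g_cvg : {ae cm, forall x, cvgn (g ^~ x)}.
  (* The 3 counts the terms of the triangle inequality, each at most 2^-n: two simple approximations
     and one change of radius. *)
  apply: (@ae_cvg_of_L1 _ _ _ _ cm g 3) => // n.
  have bs : bmeas (fun x => `|dilate F (rn n.+1) x - g n.+1 x| + (`|dilate F (rn n.+1) x
    - dilate F (rn n) x| + `|dilate F (rn n) x - g n x|)).
    by apply: bmeasD => //; exact: bmeasD.
  apply: (@le_trans _ _ (\int[cm]_x (`|dilate F (rn n.+1) x - g n.+1 x|
    + (`|dilate F (rn n.+1) x - dilate F (rn n) x| + `|dilate F (rn n) x - g n x|)))).
    apply: le_bint => //; first by apply: bsm_norm; exact: bsm_sub.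
    move=> x; rewrite (_ : g n.+1 x - g n x = - (dilate F (rn n.+1) x - g n.+1 x)
      + ((dilate F (rn n.+1) x - dilate F (rn n) x) + (dilate F (rn n) x - g n x))).
      apply: le_trans (ler_normD _ _) _; rewrite normrN lerD2l; exact: ler_normD.
    by rewrite subrKA opprB subrKA.
  rewrite bintD//; last exact: bmeasD.
  rewrite bintD//.
  have := (hg n).2; have := (hg n.+1).2; have := dF n.
  have : (2^-1 : R) ^+ n.+1 <= 2^-1 ^+ n by rewrite exprS ler_piMl ?exprn_ge0// invf_le1// ler1n.
  move: (\int[cm]_x _) (\int[cm]_x _) (\int[cm]_x _) (2^-1 ^+ n.+1) (2^-1 ^+ n) => *; lra.
have Fg0 : {ae cm, forall x, `|dilate F (rn n) x - g n x| @[n --> \oo] --> 0}.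
  apply: (@ae_cvg0_of_L1 _ _ _ cm _ 1) => // n.
  by rewrite mul1r; exact: (hg n).2.
pose Phi x : H := lim (g ^~ x @ \oo).
have gPhi : {ae cm, forall x, g ^~ x @ \oo --> Phi x} by [].
have FPhi : {ae cm, forall x, dilate F (rn n) x @[n --> \oo] --> Phi x}.
  apply: filterS2 gPhi Fg0 => x gx /norm_cvg0P Fgx.
  rewrite (_ : (fun n => _) = fun n => (dilate F (rn n) x - g n x) + g n x).
    by rewrite -[X in _ --> X]add0r; exact: cvgD.
  by apply/funext => n; rewrite subrK.
exists Phi, rn; split => //.
split; first by exists g; split => // n; case: (hg n).
exists C; apply: filterS FPhi => x hx.
have hn : `|dilate F (rn n) x| @[n --> \oo] --> `|Phi x| by exact: cvg_norm.
rewrite -(cvg_lim _ hn)//; apply: limr_le; first by apply/cvg_ex; exists `|Phi x|.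
by apply: nearW => n; apply: (dilate_le FC); case/andP: (rn01 n) => /ltW ->.
Qed.

(** Dominated convergence in the Poisson formula for F (r_n z), paired with each [w]; the pairing is
    then removed by [bochner_of_weak]. *)
Lemma boundary_limit_poisson (Phi : R * R -> H) (rn : nat -> R) :
  Linfty cm Phi -> (forall n, 0 < rn n < 1) -> rn @ \oo --> (1 : R) ->
  {ae cm, forall zeta, dilate F (rn n) zeta @[n --> \oo] --> Phi zeta} ->
  is_poisson_integral Phi F.
Proof.
move=> LPhi rn01 rn1 FPhi z z1.
have [Phi' bPhi' PhiE] := Linfty_bsm LPhi.
have bp := bmeas_pk z1.
have bf : bsm (fun eta => pk z eta *: Phi' eta) by exact: bsm_scale.
have aeE : {ae cm, forall eta, pk z eta *: Phi' eta = poisson_kernel z eta *: Phi eta}.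
  by apply: filterS2 PhiE (ae_circle R) => eta -> e1; rewrite pkE.
apply: (is_bochner_ae aeE); apply: (bochner_of_weak hip) => // w.
have bF n : bsm (dilate F (rn n)).
  by apply: (bsm_dilate hip hF FC); case/andP: (rn01 n) => /ltW ->.
have L1 : ip (F (rn n *: z)) w @[n --> \oo] --> ip (F z) w.
  have hz : rn n *: z @[n --> \oo] --> z.
    by rewrite -[X in _ --> X]scale1r; apply: cvgZ => //; exact: cvg_cst.
  apply: (cvg_ipl hip); apply: (@cvg_comp _ _ _ (fun n => rn n *: z) F _ (nbhs z)) => //.
  exact: (harmonic_continuous hip hF).
apply: (cvg_unique _ L1) => //.
rewrite /= (_ : (fun n => _) = fun n =>
  \int[cm]_eta (pk z eta * ip (dilate F (rn n) eta) w)); last first.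
  by apply/funext => n; exact: (harmonic_poisson hip hF _ (rn01 n) z1).
have [_ [Cp pC]] := bp.
apply: (@bint_cvg _ _ _ cm _ _ (Cp * (C * `|w|))).
- by move=> n; apply: bmeasM => //; exact: (bsm_ipl hip).
- move=> n x; rewrite normrM; apply: ler_pM => //.
  apply: le_trans (ip_le_norm hip _ _) _; apply: ler_wpM2r => //.
  by apply: (dilate_le FC); case/andP: (rn01 n) => /ltW ->.
- by under eq_fun do rewrite ipZl; apply: bmeasM => //; exact: (bsm_ipl hip).
apply: filterS2 FPhi PhiE => x hx xE; rewrite ipZl.
apply: cvgM; first exact: cvg_cst.
by apply: (cvg_ipl hip); rewrite -xE.
Qed.

End boundary_existence.

(** * Uniqueness of the boundary function *)

Section weighted_dynkin.
Context d d' (T : measurableType d) (X : measurableType d') (R : realType).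
Variables (mu : probability T R) (phi : T -> R) (p : T -> X).
Hypotheses (bphi : bmeas phi) (mp : measurable_fun setT p).

Lemma bmeas_indic (A : set X) : measurable A -> bmeas (fun x => \1_A (p x) : R).
Proof.
move=> mA; split.
  by apply: (measurableT_comp (f := \1_A : X -> R)) => //; exact: measurable_indic.
by exists 1 => x; rewrite indicE; case: (_ \in _); rewrite ?normr1 ?normr0.
Qed.

(** The sets over which the bounded signed density [phi] has zero integral form a Dynkin system;
    countable disjoint unions are reached from finite ones by dominated convergence. *)
Lemma weighted_dynkin (G : set (set X)) : @measurable _ X = <<s G >> -> setI_closed G ->
  \int[mu]_x phi x = 0 ->
  (forall A, G A -> \int[mu]_x (phi x * \1_A (p x)) = 0) ->
  forall A, measurable A -> \int[mu]_x (phi x * \1_A (p x)) = 0.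
Proof.
move=> GE GI phi0 GP A; rewrite GE; move: A.
apply: (@dynkin_induction _ X G (fun A => \int[mu]_x (phi x * \1_A (p x)) = 0)) => //.
- by rewrite -[RHS]phi0; apply: eq_Rintegral => x _; rewrite indicT mulr1.
- move=> S mS S0; have bS : bmeas (fun x => phi x * \1_S (p x)).
    by apply: bmeasM => //; exact: bmeas_indic.
  rewrite -(subrr 0) -[X in X - _]phi0 -[X in _ - X]S0 -bintB//.
  apply: eq_Rintegral => x _; rewrite !indicE in_setC.
  by case: (_ \in _) => /=; rewrite ?mulr1 ?mulr0 ?subrr ?subr0.
- move=> F mF tF F0.
  have mU n : measurable (\bigcup_(k in `I_n) F k) by exact: bigcup_measurable.
  have bU n : bmeas (fun x => phi x * \1_(\bigcup_(k in `I_n) F k) (p x)).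
    by apply: bmeasM => //; exact: bmeas_indic.
  have IU n : \int[mu]_x (phi x * \1_(\bigcup_(k in `I_n) F k) (p x)) = 0.
    elim: n => [|n IH].
      by under eq_Rintegral do rewrite II0 bigcup_set0 indic0 mulr0; rewrite bint_cst.
    rewrite -(addr0 0) -[X in X + _]IH -[X in _ + X](F0 n) -bintD//; last first.
      by apply: bmeasM => //; exact: bmeas_indic.
    apply: eq_Rintegral => x _; rewrite -mulrDr; congr (_ * _).
    rewrite !indicE IIS bigcup_setU bigcup_set1 in_setU.
    have [xn|xn] := boolP (p x \in F n); last by rewrite orbF addr0.
    rewrite orbT memNset ?add0r//= => -[k kn Fk].
    move/trivIsetP : tF => /(_ k n I I) tF.
    have : (F k `&` F n) (p x) by split=> //; rewrite inE in xn.
    by rewrite tF// ltn_eqF.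
  have [_ [C phiC]] := bphi.
  have mB : measurable (\bigcup_k F k) by exact: bigcup_measurable.
  have cv : \int[mu]_x (phi x * \1_(\bigcup_(k in `I_n) F k) (p x)) @[n --> \oo] -->
      \int[mu]_x (phi x * \1_(\bigcup_k F k) (p x)).
    apply: (@bint_cvg _ _ _ mu _ _ C) => //.
    + move=> n x; rewrite normrM; apply: le_trans (phiC x); rewrite ler_piMr//.
      by rewrite indicE; case: (_ \in _); rewrite ?normr1 ?normr0.
    + by apply: bmeasM => //; exact: bmeas_indic.
    apply: aeW => x; apply: cvgM; first exact: cvg_cst.
    rewrite indicE; have [/set_mem[k _ Fk]|xF] := boolP (p x \in \bigcup_k F k).
      apply: cvg_near_cst; exists k.+1 => // n /= kn.
      by rewrite indicE mem_set//; exists k.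
    apply: cvg_near_cst; apply: nearW => n; rewrite indicE memNset//.
    by move=> [k _ Fk]; move: xF; rewrite notin_setE; apply; exists k.
  have /cvg_unique : (fun n => \int[mu]_x (phi x * \1_(\bigcup_(k in `I_n) F k) (p x))) @ \oo
    --> (0 : R).
    by under eq_fun do rewrite IU; exact: cvg_cst.
  by move=> /(_ _ _ cv) <-.
Qed.

End weighted_dynkin.

Section poisson_uniqueness.
Context (R : realType).
Local Notation cm := (circle_measure R).
Variable psi : R * R -> R.
Hypothesis bpsi : bmeas psi.
Hypothesis psi0 : forall z, enorm z < 1 -> \int[cm]_eta (pk z eta * psi eta) = 0.

(** [g] is uniformly close on the circle to its own Poisson integral at radius [t]; by the symmetry
    of the kernel that integral can be moved onto [psi], where it vanishes. *)
Lemma int_continuous_eq0 (g : R * R -> R) (M : R) : continuous g ->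
  (forall x, `|g x| <= M) -> \int[cm]_x (psi x * g x) = 0.
Proof.
move=> cg gM; have mg := continuous_measurable_plane cg.
have bg := bmeas_bounded mg gM; have [mpsi [C psiC]] := bpsi.
have C0 : 0 <= C by exact: le_trans (psiC 0).
apply/eqP; rewrite -normr_le0; apply/ler_addgt0Pr => e e0; rewrite add0r.
have e'0 : 0 < e / (C + 1) by rewrite divr_gt0// ltr_wpDl.
have [d d0 hd] := poisson_int_boundary mg gM e'0 cg.
pose t : R := 1 - Num.min (d / 2) (1 / 2).
have [t0 t1 td] : [/\ 0 < t, t < 1 & 1 - t < d].
  have m0 : 0 < Num.min (d / 2) (1 / 2) by rewrite lt_min !divr_gt0.
  have m1 : Num.min (d / 2) (1 / 2) <= d / 2 by rewrite ge_min lexx.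
  have m2 : Num.min (d / 2) (1 / 2) <= 1 / 2 by rewrite ge_min lexx orbT.
  by rewrite /t; move: m0 m1 m2; set m := Num.min _ _ => *; split; lra.
have t01 : 0 <= t < 1 by rewrite ltW.
have bk : bmeas (fun q : (R * R) * (R * R) => psi q.1 * g q.2).
  apply: bmeasM; split.
  - by apply: (measurableT_comp mpsi); exact: measurable_fst.
  - by exists C => q; exact: psiC.
  - by apply: (measurableT_comp mg); exact: measurable_snd.
  - by exists M => q; exact: gM.
have E := poisson_fubini t01 bk; rewrite /= in E.
pose tg zeta : R := \int[cm]_eta (pkr t (t * edot zeta eta) * g eta).
have bK : bmeas (fun q : (R * R) * (R * R) => pkr t (t * edot q.1 q.2) * g q.2).
  apply: bmeasM; first exact: bmeas_pkr.
  split; first by apply: (measurableT_comp mg); exact: measurable_snd.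
  by exists M => q; exact: gM.
have btg : bmeas tg by exact: (bmeas_bint cm cm bK).
have I0 : \int[cm]_x (psi x * tg x) = 0.
  transitivity (\int[cm]_zeta \int[cm]_eta (pk (t *: zeta) eta * (psi zeta * g eta))).
    apply: ae_eq_Rintegral; apply: filterS (ae_circle R) => zeta z1.
    rewrite /tg -bintZ; last exact: (bmeas_pair2 zeta bK).
    by apply: eq_Rintegral => eta _; rewrite (pk_circle eta (ltW t0) z1) mulrCA.
  rewrite E -[RHS](bint_cst cm); apply: ae_eq_Rintegral.
  apply: filterS (ae_circle R) => eta e1.
  have te : enorm (t *: eta) < 1 by rewrite enormZ e1 mulr1 gtr0_norm.
  transitivity (\int[cm]_zeta (g eta * (pk (t *: eta) zeta * psi zeta))).
    by apply: eq_Rintegral => zeta _; ring.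
  have bpe : bmeas (fun zeta => pk (t *: eta) zeta * psi zeta).
    exact: (bmeasM (bmeas_pk te) bpsi).
  by rewrite (bintZ _ _ bpe) (psi0 te) mulr0.
have bpg := bmeasM bpsi bg; have bpt := bmeasM bpsi btg.
rewrite -[X in `|X|]subr0 -I0 -(bintB _ bpg bpt).
apply: (bint_norm_le (bmeasB bpg bpt)).
apply: filterS (ae_circle R) => zeta z1.
rewrite -mulrBr normrM; apply: (@le_trans _ _ (C * (e / (C + 1)))).
  apply: ler_pM => //; rewrite distrC.
  have -> : tg zeta = poisson_int g (t *: zeta).
    by apply: eq_Rintegral => eta _; rewrite (pk_circle eta (ltW t0) z1).
  by apply: hd => //; rewrite t0.
rewrite mulrCA ler_piMr ?(ltW e0)// ler_pdivrMr ?ltr_wpDl// mul1r lerDl//.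
Qed.

(** Continuous functions with values in [0, 1], equal to 1 on the closed ray from [a], whose limit
    is the indicator of that ray; such rays generate the Borel sets. *)
Definition ramp (n : nat) (a x : R) : R := Num.max 0 (Num.min 1 (1 + n%:R * (x - a))).

Lemma continuous_ramp n a : continuous (ramp n a).
Proof.
rewrite (_ : ramp n a = (fun=> 0) \max ((fun=> 1) \min (fun x : R => 1 + n%:R * (x - a))))//.
apply: max_fun_continuous; first by move=> x; exact: cvg_cst.
apply: min_fun_continuous => x; first exact: cvg_cst.
apply: cvgD; first exact: cvg_cst.
apply: cvgM; first exact: cvg_cst.
by apply: cvgB; [exact: cvg_id|exact: cvg_cst].
Qed.

Lemma ramp_le1 n a x : `|ramp n a x| <= 1.
Proof.
by rewrite ger0_norm ?le_max ?lexx// /ramp ge_max ler01 ge_min lexx.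
Qed.

Lemma cvg_ramp a x : ramp n a x @[n --> \oo] --> (\1_`[a, +oo[%classic x : R).
Proof.
apply: cvg_near_cst; rewrite indicE; have [ax|xa] := leP a x.
  apply: nearW => n; rewrite mem_set /= ?in_itv/= ?ax//.
  rewrite /ramp min_l; first by rewrite max_r.
  by rewrite lerDl mulr_ge0// subr_ge0.
exists (Num.bound ((a - x)^-1)) => // n /= hn.
rewrite memNset /=; last by rewrite in_itv/= andbT leNgt xa.
have ax0 : 0 < a - x by rewrite subr_gt0.
have h : (a - x)^-1 < n%:R.
  apply: (@lt_le_trans _ _ (Num.bound (a - x)^-1)%:R); last by rewrite ler_nat.
  by apply: archi_boundP; rewrite invr_ge0 ltW.
rewrite -[_^-1]mul1r ltr_pdivrMr// in h.
by rewrite /ramp max_l// ge_min; apply/orP; right; lra.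
Qed.

Lemma int_quadrant_eq0 (u v : R * R -> R) (U V : nat -> R * R -> R) :
  (forall n, continuous (U n)) -> (forall n, continuous (V n)) ->
  (forall n x, `|U n x| <= 1) -> (forall n x, `|V n x| <= 1) ->
  bmeas u -> bmeas v ->
  (forall x, U n x @[n --> \oo] --> u x) -> (forall x, V n x @[n --> \oo] --> v x) ->
  \int[cm]_x (psi x * u x * v x) = 0.
Proof.
move=> cU cV U1 V1 bu bv Uu Vv; have [mpsi [C psiC]] := bpsi.
have cUV n : continuous (fun x => U n x * V n x).
  by move=> x; apply: cvgM; [exact: cU|exact: cV].
have UV1 n x : `|U n x * V n x| <= 1.
  by rewrite normrM -[leRHS]mulr1; exact: ler_pM.
have bUV n : bmeas (fun x => U n x * V n x).
  by apply: (bmeas_bounded (M := 1)) => //; exact: continuous_measurable_plane.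
have cv : \int[cm]_x (psi x * (U n x * V n x)) @[n --> \oo] --> \int[cm]_x (psi x * u x * v x).
  apply: (@bint_cvg _ _ _ cm _ _ C).
  - by move=> n; exact: bmeasM.
  - by move=> n x; rewrite normrM; apply: le_trans (psiC x); rewrite ler_piMr.
  - by apply: bmeasM => //; exact: bmeasM.
  apply: aeW => x; rewrite -mulrA; apply: cvgM; first exact: cvg_cst.
  by apply: cvgM; [exact: Uu|exact: Vv].
have c0 : \int[cm]_x (psi x * (U n x * V n x)) @[n --> \oo] --> (0 : R).
  rewrite (_ : (fun n => _) = fun=> 0); first exact: cvg_cst.
  by apply/funext => n; exact: (int_continuous_eq0 (cUV n) (UV1 n)).
exact: (cvg_unique _ cv c0).
Qed.

Let ray (a : R) : set R := `[a, +oo[%classic.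

Lemma measurable_fst_plane : measurable_fun setT (fst : R * R -> R).
Proof. exact: measurable_fst. Qed.

Lemma measurable_snd_plane : measurable_fun setT (snd : R * R -> R).
Proof. exact: measurable_snd. Qed.

Lemma ray_setI_closed : setI_closed (@RGenCInfty.G R).
Proof.
move=> _ _ [a ->] [b ->]; exists (Num.max a b); apply/seteqP; split => x /=;
  rewrite !in_itv/= !andbT ge_max; first by move=> [-> ->].
by move=> /andP.
Qed.

Lemma measurable_rayE : @measurable _ (Real_sort__canonical__measurable_structure_Measurable R)
  = <<s @RGenCInfty.G R >>.
Proof. exact: RGenCInfty.measurableE. Qed.

Lemma bmeas_ramp_fst_indic a : bmeas (fun x : R * R => \1_(ray a) x.1 : R).
Proof. exact: (@bmeas_indic _ _ _ _ R fst measurable_fst_plane (ray a) (measurable_itv _)). Qed.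

Lemma bmeas_ramp_snd_indic a : bmeas (fun x : R * R => \1_(ray a) x.2 : R).
Proof. exact: (@bmeas_indic _ _ _ _ R snd measurable_snd_plane (ray a) (measurable_itv _)). Qed.

(** Products of two rays come from ramps. The Dynkin argument is then run one coordinate at a time,
    with the indicator in the other coordinate absorbed into the density; the cases with one or no
    ray provide the vanishing total mass that it requires. *)
Lemma int_rectangle_eq0 (A B : set R) : measurable A -> measurable B ->
  \int[cm]_x (psi x * \1_A x.1 * \1_B x.2) = 0.
Proof.
move=> mA mB.
have cfst n a : continuous (fun x : R * R => ramp n a x.1).
  move=> x; apply: (@continuous_comp _ _ _ fst (ramp n a)); first exact: continuous_fst_plane.
  exact: continuous_ramp.
have csnd n a : continuous (fun x : R * R => ramp n a x.2).
  move=> x; apply: (@continuous_comp _ _ _ snd (ramp n a)); first exact: continuous_snd_plane.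
  exact: continuous_ramp.
have c1 : forall n : nat, continuous (fun _ : R * R => 1 : R) by move=> n x; exact: cvg_cst.
have l1 : forall (n : nat) (x : R * R), `|1 : R| <= 1 by move=> n x; rewrite normr1.
have cv1 : forall (x : R * R), (fun _ : nat => 1 : R) @ \oo --> (1 : R)
  by move=> x; exact: cvg_cst.
have Iab a b : \int[cm]_x (psi x * \1_(ray a) x.1 * \1_(ray b) x.2) = 0.
  apply: (@int_quadrant_eq0 _ _ (fun n x => ramp n a x.1) (fun n x => ramp n b x.2)) => //.
  - by move=> n x; exact: ramp_le1.
  - by move=> n x; exact: ramp_le1.
  - exact: bmeas_ramp_fst_indic.
  - exact: bmeas_ramp_snd_indic.
  - by move=> x; exact: cvg_ramp.
  - by move=> x; exact: cvg_ramp.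
have Ib b : \int[cm]_x (psi x * \1_(ray b) x.2) = 0.
  under eq_Rintegral do rewrite -(mulr1 (psi _)).
  apply: (@int_quadrant_eq0 (fun=> 1) _ (fun n x => 1) (fun n x => ramp n b x.2)) => //.
  - by move=> n x; exact: ramp_le1.
  - exact: bmeas_cst.
  - exact: bmeas_ramp_snd_indic.
  - by move=> x; exact: cvg_ramp.
have Ia a : \int[cm]_x (psi x * \1_(ray a) x.1) = 0.
  under eq_Rintegral do rewrite -(mulr1 (_ * _)).
  apply: (@int_quadrant_eq0 _ (fun=> 1) (fun n x => ramp n a x.1) (fun n x => 1)) => //.
  - by move=> n x; exact: ramp_le1.
  - exact: bmeas_ramp_fst_indic.
  - exact: bmeas_cst.
  - by move=> x; exact: cvg_ramp.
have I0 : \int[cm]_x psi x = 0.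
  under eq_Rintegral do rewrite -(mulr1 (psi _)).
  exact: (int_continuous_eq0 (c1 0%N) (l1 0%N)).
have IA : \int[cm]_x (psi x * \1_A x.1) = 0.
  apply: (weighted_dynkin bpsi measurable_fst_plane measurable_rayE ray_setI_closed) => //.
  by move=> _ [a ->]; exact: Ia.
have bA : bmeas (fun x : R * R => psi x * \1_A x.1).
  by apply: bmeasM => //; exact: (@bmeas_indic _ _ _ _ R fst measurable_fst_plane A mA).
apply: (weighted_dynkin bA measurable_snd_plane measurable_rayE ray_setI_closed) => //.
move=> _ [b ->].
have bb : bmeas (fun x : R * R => psi x * \1_(ray b) x.2).
  by apply: bmeasM => //; exact: bmeas_ramp_snd_indic.
under eq_Rintegral do rewrite mulrAC.
apply: (weighted_dynkin bb measurable_fst_plane measurable_rayE ray_setI_closed) => //.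
move=> _ [a ->]; rewrite -[RHS](Iab a b); apply: eq_Rintegral => x _.
by rewrite mulrAC.
Qed.

Lemma poisson_eq0_ae : {ae cm, forall x, psi x = 0}.
Proof.
have Iall (A : set (R * R)) : measurable A -> \int[cm]_x (psi x * \1_A x) = 0.
  apply: (weighted_dynkin bpsi (p := id)
    (@measurable_id _ _ _) (measurable_prod_measurableType _ _)).
  - move=> _ _ [A1 mA1 [A2 mA2 <-]] [B1 mB1 [B2 mB2 <-]].
    exists (A1 `&` B1); first exact: measurableI.
    by exists (A2 `&` B2); [exact: measurableI|rewrite setXI].
  - have := int_rectangle_eq0 measurableT measurableT.
    by under eq_Rintegral do rewrite !indicT !mulr1.
  - move=> _ [A1 mA1 [A2 mA2 <-]]; rewrite -[RHS](int_rectangle_eq0 mA1 mA2).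
    apply: eq_Rintegral => x _; rewrite -mulrA; congr (_ * _).
    by rewrite !indicE in_setX; case: (_ \in _); case: (_ \in _); rewrite /= ?mulr0 ?mulr1.
have ipsi := bmeas_integrable cm bpsi.
have := @integral_ae_eq _ _ _ cm setT measurableT (cst 0%E) _ ipsi (@measurable_cst _ _ _ _ _ _).
have h : forall E, E `<=` setT -> measurable E ->
    (\int[cm]_(x in E) (EFin \o psi) x = \int[cm]_(x in E) cst 0%E x)%E.
  move=> E _ mE; rewrite integral0 integral_mkcond.
  have bE : bmeas (fun x => psi x * \1_E x).
    by apply: bmeasM => //; exact: (@bmeas_indic _ _ _ _ R id (@measurable_id _ _ _) E mE).
  rewrite -[RHS]/(0%:E) -(Iall E mE) (bmeas_fineK cm bE); apply: eq_integral => x _.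
  by rewrite patchE /= indicE; case: (_ \in _); rewrite ?mulr1 ?mulr0.
by move=> /(_ h); apply: filterS => x /(_ I) /= [].
Qed.

End poisson_uniqueness.

Section boundary_unique.
Context (R : realType) (H : completeNormedModType R) (ip : {dot H for @idfun R}).
Hypothesis hip : forall x : H, ip x x = `|x| ^+ 2.
Local Notation cm := (circle_measure R).

Lemma poisson_integral_weak (F Phi Phi' : R * R -> H) (z : R * R) (w : H) :
  is_poisson_integral Phi F -> bsm Phi' -> {ae cm, forall x, Phi x = Phi' x} ->
  enorm z < 1 -> ip (F z) w = \int[cm]_eta (pk z eta * ip (Phi' eta) w).
Proof.
move=> PF bPhi' PhiE z1; have bp := bmeas_pk z1.
have bf : bsm (fun eta => pk z eta *: Phi' eta) by exact: bsm_scale.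
have aeE : {ae cm, forall eta, poisson_kernel z eta *: Phi eta = pk z eta *: Phi' eta}.
  by apply: filterS2 PhiE (ae_circle R) => eta -> e1; rewrite pkE.
rewrite (bochner_weak hip w bf (is_bochner_ae aeE (PF z z1))).
by apply: eq_Rintegral => eta _; rewrite ipZl.
Qed.

(** The null set of the hypothesis depends on [w]. The values of the simple functions approximating
    [D] form a countable set of test vectors, and along them <D, g_n> = 0 tends to |D|^2. *)
Lemma weak_eq0_ae (D : R * R -> H) : bsm D ->
  (forall w, {ae cm, forall x, ip (D x) w = 0}) -> {ae cm, forall x, D x = 0}.
Proof.
move=> [[g_ [mg gD]] _] D0.
have Dn n : {ae cm, forall x, ip (D x) (g_ n x) = 0}.
  have /finite_seqP[s sE] := (mg n).1.
  have : {ae cm, forall x, forall v, v \in s -> ip (D x) v = 0}.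
    elim: s {sE} => [|v s IH]; first exact: aeW.
    apply: filterS2 (D0 v) IH => x h1 h2 v'.
    by rewrite in_cons => /predU1P[->//|/h2].
  apply: filterS => x; apply.
  have : range (g_ n) (g_ n x) by exists x.
  by rewrite sE.
have /ae_foralln := Dn; apply: filterS => x hx.
have c0 : ip (D x) (g_ n x) @[n --> \oo] --> (0 : R).
  by under eq_fun do rewrite hx; exact: cvg_cst.
have c1 : ip (D x) (g_ n x) @[n --> \oo] --> ip (D x) (D x).
  by apply: (ip_cvg hip); [exact: cvg_cst|exact: gD].
have E : 0 = ip (D x) (D x) := cvg_unique _ c0 c1.
by apply/eqP; rewrite -normr_eq0 -sqrf_eq0 -hip -E.
Qed.

Lemma poisson_boundary_unique (F Phi1 Phi2 : R * R -> H) :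
  Linfty cm Phi1 -> Linfty cm Phi2 ->
  is_poisson_integral Phi1 F -> is_poisson_integral Phi2 F ->
  {ae cm, forall x, Phi1 x = Phi2 x}.
Proof.
move=> L1 L2 P1 P2.
have [Psi1 b1 E1] := Linfty_bsm L1; have [Psi2 b2 E2] := Linfty_bsm L2.
have bD : bsm (fun x => Psi1 x - Psi2 x) by exact: bsm_sub.
have D0 : {ae cm, forall x, Psi1 x - Psi2 x = 0}.
  apply: weak_eq0_ae => // w; apply: poisson_eq0_ae.
    exact: (bsm_ipl hip w bD).
  move=> z z1; have bp := bmeas_pk z1.
  have i1 := bmeasM bp (bsm_ipl hip w b1); have i2 := bmeasM bp (bsm_ipl hip w b2).
  rewrite -(subrr (ip (F z) w)) {1}(poisson_integral_weak w P1 b1 E1 z1).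
  rewrite (poisson_integral_weak w P2 b2 E2 z1) -(bintB _ i1 i2).
  by apply: eq_Rintegral => eta _; rewrite ipBl mulrBr.
apply: filterS3 E1 E2 D0 => x -> -> /eqP.
by rewrite subr_eq0 => /eqP.
Qed.

End boundary_unique.

(** * The extremal map: derivatives and harmonicity *)

Section harmonic_criterion.
Context (R : realType) (H : completeNormedModType R).
Implicit Types (F G : R * R -> H) (z v : R * R).

Lemma near_unit_disk z : unit_disk R z -> \forall x \near z, unit_disk R x.
Proof. by move=> zd; exact: (open_unit_disk (R := R)). Qed.

Definition is_derive_on_disk F G v := forall z, unit_disk R z -> is_derive z v F (G z).

Definition continuous_on_disk F := forall z, unit_disk R z -> {for z, continuous F}.

Lemma is_derive_on_disk_eq F F' G v : (forall z, unit_disk R z -> F z = F' z) ->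
  is_derive_on_disk F' G v -> is_derive_on_disk F G v.
Proof.
move=> FF' dF z zd; apply: (@near_eq_is_derive _ _ _ F'); last exact: dF.
by apply: filterS (near_unit_disk zd) => x xd; rewrite FF'.
Qed.

Lemma continuous_on_disk_eq F F' : (forall z, unit_disk R z -> F z = F' z) ->
  continuous_on_disk F' -> continuous_on_disk F.
Proof.
move=> FF' cF z zd; have h : F' x @[x --> z] --> F' z := cF z zd.
rewrite -(FF' z zd) in h.
apply: cvg_trans h; apply: near_eq_cvg.
by apply: filterS (near_unit_disk zd) => x xd; rewrite FF'.
Qed.

Lemma C1_on_disk_of F Fx Fy : is_derive_on_disk F Fx (e_x R) ->
  is_derive_on_disk F Fy (e_y R) -> continuous_on_disk Fx -> continuous_on_disk Fy ->
  [/\ C1_on_disk F, forall z, unit_disk R z -> 'D_(e_x R) F z = Fx z &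
      forall z, unit_disk R z -> 'D_(e_y R) F z = Fy z].
Proof.
move=> dx dy cx cy.
have Ex z : unit_disk R z -> 'D_(e_x R) F z = Fx z by move=> zd; have := dx z zd; case.
have Ey z : unit_disk R z -> 'D_(e_y R) F z = Fy z by move=> zd; have := dy z zd; case.
split => // z zd; split.
- by have := dx z zd; case.
- by have := dy z zd; case.
- exact: (continuous_on_disk_eq Ex cx).
- exact: (continuous_on_disk_eq Ey cy).
Qed.

(** Formulas valid on the open disk alone suffice, because derivatives and continuity at a point of
    the disk depend only on nearby values. *)
Lemma harmonic_of F Fx Fy Fxx Fxy Fyx Fyy :
  is_derive_on_disk F Fx (e_x R) -> is_derive_on_disk F Fy (e_y R) ->
  is_derive_on_disk Fx Fxx (e_x R) -> is_derive_on_disk Fx Fxy (e_y R) ->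
  is_derive_on_disk Fy Fyx (e_x R) -> is_derive_on_disk Fy Fyy (e_y R) ->
  continuous_on_disk Fx -> continuous_on_disk Fy ->
  continuous_on_disk Fxx -> continuous_on_disk Fxy ->
  continuous_on_disk Fyx -> continuous_on_disk Fyy ->
  (forall z, unit_disk R z -> Fxx z + Fyy z = 0) ->
  Defs.harmonic F.
Proof.
move=> dx dy dxx dxy dyx dyy cx cy cxx cxy cyx cyy lap.
have [C1 Ex Ey] := C1_on_disk_of dx dy cx cy.
have dxx' := is_derive_on_disk_eq Ex dxx; have dxy' := is_derive_on_disk_eq Ex dxy.
have dyx' := is_derive_on_disk_eq Ey dyx; have dyy' := is_derive_on_disk_eq Ey dyy.
have [C1x Exx _] := C1_on_disk_of dxx' dxy' cxx cxy.
have [C1y _ Eyy] := C1_on_disk_of dyx' dyy' cyx cyy.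
split; first by split.
by move=> z zd; rewrite /laplacian Exx// Eyy// lap.
Qed.

End harmonic_criterion.

Section plane_derivatives.
Context (R : realType) (H : completeNormedModType R).
Implicit Types (z v : R * R) (f g : R * R -> R).

Lemma is_derive_fst z v : is_derive z v (fst : R * R -> R) v.1.
Proof.
have E : (fun h : R => h^-1 *: (((fst : R * R -> R) \o shift z) (h *: v) - z.1)) @ 0^' --> v.1.
  apply: cvg_near_cst; near=> h => /=.
  by rewrite addrK scalerA mulVf ?scale1r//; near: h; exact: nbhs_dnbhs_neq.
by split; [apply/cvg_ex; exists v.1|exact: cvg_lim].
Unshelve. all: by end_near. Qed.

Lemma is_derive_snd z v : is_derive z v (snd : R * R -> R) v.2.
Proof.
have E : (fun h : R => h^-1 *: (((snd : R * R -> R) \o shift z) (h *: v) - z.2)) @ 0^' --> v.2.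
  apply: cvg_near_cst; near=> h => /=.
  by rewrite addrK scalerA mulVf ?scale1r//; near: h; exact: nbhs_dnbhs_neq.
by split; [apply/cvg_ex; exists v.2|exact: cvg_lim].
Unshelve. all: by end_near. Qed.

Lemma is_derive_scalev f z v (df : R) (e : H) : is_derive z v f df ->
  is_derive z v (fun x => f x *: e) (df *: e).
Proof.
move=> [df1 df2].
have E : (fun h : R => h^-1 *: (((fun x => f x *: e) \o shift z) (h *: v)
  - f z *: e)) @ 0^' --> df *: e.
  rewrite (_ : (fun h => _) = (fun h : R => (h^-1 *: ((f \o shift z) (h *: v)
    - f z)) *: e)); last first.
    by apply/funext => h /=; rewrite -scalerBl scalerA.
  by apply: cvgZ; [rewrite -df2; exact: df1|exact: cvg_cst].
by split; [apply/cvg_ex; exists (df *: e)|exact: cvg_lim].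
Qed.

Lemma is_derive_quot f g z v (df dg : R) : g z != 0 -> is_derive z v f df ->
  is_derive z v g dg ->
  is_derive z v (fun x => f x / g x) ((df * g z - f z * dg) / g z ^+ 2).
Proof.
move=> g0 hf hg.
have [g1 g2] := hg.
have h : is_derive z v (fun y => (g y)^-1) (- (g z) ^- 2 *: dg).
  by split; [exact: derivableV|rewrite deriveV// g2].
apply: is_derive_eq (is_deriveM hf h) _.
by rewrite /GRing.scale/=; field.
Qed.

End plane_derivatives.

Section extremal_map.
Context (R : realType).
Implicit Types (z v : R * R).
Variable s : R.
Hypothesis s01 : 0 <= s < 1.

Definition emap_den z : R := (1 + s * z.1) ^+ 2 + (s * z.2) ^+ 2.
(* (1 + s z)^-1 = reW z + i imW z *)
Definition reW z : R := (1 + s * z.1) / emap_den z.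
Definition imW z : R := - (s * z.2) / emap_den z.
(** Real and imaginary parts of the powers of W = 1 / (1 + s z): the first two derivatives of the
    Moebius map are (1 - s^2) W^2 and -2 s (1 - s^2) W^3. *)
Definition reW2 z : R := reW z ^+ 2 - imW z ^+ 2.
Definition imW2 z : R := 2 * (reW z * imW z).
Definition reW3 z : R := reW2 z * reW z - imW2 z * imW z.
Definition imW3 z : R := reW2 z * imW z + imW2 z * reW z.
(** The Moebius map in the form s + (1 - s^2) z W, with no quotient other than W to
    differentiate. *)
Definition reM z : R := s + (1 - s ^+ 2) * (z.1 * reW z - z.2 * imW z).
Definition imM z : R := (1 - s ^+ 2) * (z.1 * imW z + z.2 * reW z).

Lemma affine_disk_gt0 z : enorm z <= 1 -> 0 < 1 + s * z.1.
Proof.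
case/andP: s01 => s0 s1 z1; have := enorm_fst z; rewrite ler_norml => /andP[h _].
by nra.
Qed.

Lemma emap_den_gt0 z : enorm z <= 1 -> 0 < emap_den z.
Proof.
move=> z1; rewrite /emap_den ltr_wpDr ?sqr_ge0// exprn_gt0//.
exact: affine_disk_gt0.
Qed.

Lemma is_derive_affine z v : is_derive z v (fun x : R * R => 1 + s * x.1) (s * v.1).
Proof.
have h := is_deriveD (is_derive_cst (1 : R) z v) (is_deriveZ s (is_derive_fst z v)).
by apply: is_derive_eq h _; rewrite add0r.
Qed.

Lemma is_derive_linear2 z v : is_derive z v (fun x : R * R => s * x.2) (s * v.2).
Proof. exact: (is_deriveZ s (is_derive_snd z v)). Qed.

Lemma is_derive_sqr (f : R * R -> R) z v df : is_derive z v f df ->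
  is_derive z v (fun x => f x ^+ 2) (2 * f z * df).
Proof.
move=> hf; apply: is_derive_eq (is_deriveX 2 hf) _.
by rewrite /GRing.scale/= expr1.
Qed.

Lemma is_derive_emap_den z v :
  is_derive z v emap_den (2 * (1 + s * z.1) * (s * v.1) + 2 * (s * z.2) * (s * v.2)).
Proof.
exact: (is_deriveD (is_derive_sqr (is_derive_affine z v))
    (is_derive_sqr (is_derive_linear2 z v))).
Qed.

(** Real part of the complex derivative W' = - s W^2 applied to the direction [v]; the derivative
    lemmas below follow the same pattern. *)
Lemma is_derive_reW z v : unit_disk R z ->
  is_derive z v reW (- s * (v.1 * reW2 z - v.2 * imW2 z)).
Proof.
move=> zd; have D0 : emap_den z != 0 by rewrite gt_eqF// emap_den_gt0// ltW.
apply: is_derive_eq (is_derive_quot D0 (is_derive_affine z v) (is_derive_emap_den z v)) _.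
by rewrite /reW2 /imW2 /reW /imW; move: D0; rewrite /emap_den => D0; field.
Qed.

Lemma is_derive_imW z v : unit_disk R z ->
  is_derive z v imW (- s * (v.1 * imW2 z + v.2 * reW2 z)).
Proof.
move=> zd; have D0 : emap_den z != 0 by rewrite gt_eqF// emap_den_gt0// ltW.
have hn : is_derive z v (fun x : R * R => - (s * x.2)) (- (s * v.2)).
  exact: (is_deriveN (is_derive_linear2 z v)).
apply: is_derive_eq (is_derive_quot D0 hn (is_derive_emap_den z v)) _.
by rewrite /reW2 /imW2 /reW /imW; move: D0; rewrite /emap_den => D0; field.
Qed.

Lemma is_derive_mul (f g : R * R -> R) z v (df dg : R) : is_derive z v f df ->
  is_derive z v g dg -> is_derive z v (fun x => f x * g x) (df * g z + f z * dg).
Proof.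
move=> hf hg; apply: is_derive_eq (is_deriveM hf hg) _.
by rewrite /GRing.scale/=; ring.
Qed.

Lemma is_derive_reW2 z v : unit_disk R z ->
  is_derive z v reW2 (-2 * s * (v.1 * reW3 z - v.2 * imW3 z)).
Proof.
move=> zd; have ha := is_derive_reW v zd; have hb := is_derive_imW v zd.
apply: is_derive_eq (is_deriveB (is_derive_sqr ha) (is_derive_sqr hb)) _.
by rewrite /reW3 /imW3 /imW2; ring.
Qed.

Lemma is_derive_imW2 z v : unit_disk R z ->
  is_derive z v imW2 (-2 * s * (v.1 * imW3 z + v.2 * reW3 z)).
Proof.
move=> zd; have ha := is_derive_reW v zd; have hb := is_derive_imW v zd.
apply: is_derive_eq (is_deriveZ 2 (is_derive_mul ha hb)) _.
by rewrite /GRing.scale/= /reW3 /imW3 /imW2; ring.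
Qed.

Lemma is_derive_reM z v : unit_disk R z ->
  is_derive z v reM ((1 - s ^+ 2) * (v.1 * reW2 z - v.2 * imW2 z)).
Proof.
move=> zd; have ha := is_derive_reW v zd; have hb := is_derive_imW v zd.
have D0 : emap_den z != 0 by rewrite gt_eqF// emap_den_gt0// ltW.
have h := is_deriveD (is_derive_cst s z v) (is_deriveZ (1 - s ^+ 2)
  (is_deriveB (is_derive_mul (is_derive_fst z v) ha) (is_derive_mul (is_derive_snd z v) hb))).
apply: is_derive_eq h _; rewrite /GRing.scale/= /reW2 /imW2 /reW /imW.
by move: D0; rewrite /emap_den => D0; field.
Qed.

Lemma is_derive_imM z v : unit_disk R z ->
  is_derive z v imM ((1 - s ^+ 2) * (v.1 * imW2 z + v.2 * reW2 z)).
Proof.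
move=> zd; have ha := is_derive_reW v zd; have hb := is_derive_imW v zd.
have D0 : emap_den z != 0 by rewrite gt_eqF// emap_den_gt0// ltW.
have h := is_deriveZ (1 - s ^+ 2)
  (is_deriveD (is_derive_mul (is_derive_fst z v) hb) (is_derive_mul (is_derive_snd z v) ha)).
apply: is_derive_eq h _; rewrite /GRing.scale/= /reW2 /imW2 /reW /imW.
by move: D0; rewrite /emap_den => D0; field.
Qed.

Lemma continuous_reW z : unit_disk R z -> {for z, continuous reW}.
Proof.
move=> zd; have D0 : emap_den z != 0 by rewrite gt_eqF// emap_den_gt0// ltW.
have c1 : {for z, continuous (fun x : R * R => 1 + s * x.1)}.
  by apply: cvgD; [exact: cvg_cst|apply: cvgM; [exact: cvg_cst|exact: continuous_fst_plane]].
have c2 : {for z, continuous (fun x : R * R => s * x.2)}.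
  by apply: cvgM; [exact: cvg_cst|exact: continuous_snd_plane].
apply: cvgM; first exact: c1.
by apply: cvgV => //; apply: cvgD; rewrite expr2; apply: cvgM; by [exact: c1|exact: c2].
Qed.

Lemma continuous_imW z : unit_disk R z -> {for z, continuous imW}.
Proof.
move=> zd; have D0 : emap_den z != 0 by rewrite gt_eqF// emap_den_gt0// ltW.
have c1 : {for z, continuous (fun x : R * R => 1 + s * x.1)}.
  by apply: cvgD; [exact: cvg_cst|apply: cvgM; [exact: cvg_cst|exact: continuous_fst_plane]].
have c2 : {for z, continuous (fun x : R * R => s * x.2)}.
  by apply: cvgM; [exact: cvg_cst|exact: continuous_snd_plane].
apply: cvgM; first by apply: cvgN; exact: c2.
by apply: cvgV => //; apply: cvgD; rewrite expr2; apply: cvgM; by [exact: c1|exact: c2].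
Qed.

Lemma continuous_reW2 z : unit_disk R z -> {for z, continuous reW2}.
Proof.
move=> zd; apply: cvgB; rewrite expr2; apply: cvgM;
  by [exact: continuous_reW|exact: continuous_imW].
Qed.

Lemma continuous_imW2 z : unit_disk R z -> {for z, continuous imW2}.
Proof.
move=> zd; apply: cvgM; first exact: cvg_cst.
by apply: cvgM; [exact: continuous_reW|exact: continuous_imW].
Qed.

Lemma continuous_reW3 z : unit_disk R z -> {for z, continuous reW3}.
Proof.
move=> zd; apply: cvgB; apply: cvgM; by [exact: continuous_reW|exact: continuous_imW
  |exact: continuous_reW2|exact: continuous_imW2].
Qed.

Lemma continuous_imW3 z : unit_disk R z -> {for z, continuous imW3}.
Proof.
move=> zd; apply: cvgD; apply: cvgM; by [exact: continuous_reW|exact: continuous_imW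
  |exact: continuous_reW2|exact: continuous_imW2].
Qed.

Lemma mobiusE z : enorm z <= 1 ->
  complex.Re (mobius s z) = reM z /\ complex.Im (mobius s z) = imM z.
Proof.
move=> z1; have D0 : emap_den z != 0 by rewrite gt_eqF// emap_den_gt0.
rewrite /mobius /to_complex /reM /imM /reW /imW.
move: D0; rewrite /emap_den; case: z {z1} => x y /=.
rewrite !(mul0r, subr0, add0r, addr0) => D0.
by split; field.
Qed.

Lemma weightE z : weight s z = emap_den z.
Proof.
rewrite /weight /to_complex /emap_den; case: z => x y /=.
by rewrite !(mul0r, subr0, add0r, addr0) sqr_sqrtr// addr_ge0 ?sqr_ge0.
Qed.

(** The identity behind the invariance of the disk: it shows that the Moebius map sends the open
    disk into itself and the circle into the circle. *)
Lemma modulus_reM_imM z : enorm z <= 1 ->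
  1 - (reM z ^+ 2 + imM z ^+ 2) = (1 - s ^+ 2) * (1 - enorm z ^+ 2) / emap_den z.
Proof.
move=> z1; have D0 : emap_den z != 0 by rewrite gt_eqF// emap_den_gt0.
by rewrite sqr_enorm /reM /imM /reW /imW; move: D0; rewrite /emap_den => D0; field.
Qed.

(** On the circle the weight cancels the denominator: |1 + s z|^2 times the Moebius map is (s + z)(1
    + s conj(z)) = 2 s + z + s^2 conj(z), whose real part this is. *)
Lemma weight_reM z : enorm z = 1 -> emap_den z * reM z = 2 * s + (1 + s ^+ 2) * z.1.
Proof.
move=> z1; have D0 : emap_den z != 0 by rewrite gt_eqF// emap_den_gt0// z1.
have E : z.1 ^+ 2 + z.2 ^+ 2 = 1 by rewrite -sqr_enorm z1 expr1n.
have -> : emap_den z * reM z = (1 + s ^+ 2) * z.1 + s * (1 + (z.1 ^+ 2 + z.2 ^+ 2)).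
  by rewrite /reM /reW /imW; move: D0; rewrite /emap_den => D0; field.
by rewrite E; ring.
Qed.

Lemma weight_imM z : enorm z = 1 -> emap_den z * imM z = (1 - s ^+ 2) * z.2.
Proof.
move=> z1; have D0 : emap_den z != 0 by rewrite gt_eqF// emap_den_gt0// z1.
by rewrite /imM /reW /imW; move: D0; rewrite /emap_den => D0; field.
Qed.

Lemma weight_circle z : enorm z = 1 -> emap_den z = 1 + s ^+ 2 + 2 * s * z.1.
Proof.
move=> z1; have E : z.1 ^+ 2 + z.2 ^+ 2 = 1 by rewrite -sqr_enorm z1 expr1n.
rewrite (_ : emap_den z = 1 + 2 * s * z.1 + s ^+ 2 * (z.1 ^+ 2 + z.2 ^+ 2)).
  by rewrite E; ring.
by rewrite /emap_den; ring.
Qed.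

Section hilbert.
Context (H : completeNormedModType R) (pperp e1 e2 : H) (c : R).

Definition vec (p q : R * R -> R) z : H := p z *: e1 + q z *: e2.

Lemma is_derive_vec p q z v (dp dq : R) : is_derive z v p dp -> is_derive z v q dq ->
  is_derive z v (vec p q) (dp *: e1 + dq *: e2).
Proof.
by move=> hp hq; exact: (is_deriveD (is_derive_scalev e1 hp) (is_derive_scalev e2 hq)).
Qed.

Lemma continuous_vec p q z : {for z, continuous p} -> {for z, continuous q} ->
  {for z, continuous (vec p q)}.
Proof.
by move=> cp cq; apply: cvgD; apply: cvgZ; by [exact: cp|exact: cq|exact: cvg_cst].
Qed.

Lemma EmapE z : enorm z <= 1 ->
  Emap pperp e1 e2 c s z = pperp + vec (fun x => c * reM x) (fun x => c * imM x) z.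
Proof. by move=> z1; have [h1 h2] := mobiusE z1; rewrite /Emap h1 h2 /vec addrA. Qed.

Let k := c * (1 - s ^+ 2).
Let k2 := k * (-2 * s).

Lemma is_derive_Emap z v : unit_disk R z -> is_derive z v (Emap pperp e1 e2 c s)
  (vec (fun z => k * (v.1 * reW2 z - v.2 * imW2 z)) (fun z => k
    * (v.1 * imW2 z + v.2 * reW2 z)) z).
Proof.
move=> zd; apply: (@near_eq_is_derive _ _ _
    (fun z => pperp + vec (fun x => c * reM x) (fun x => c * imM x) z)).
  by apply: filterS (near_unit_disk zd) => x xd; rewrite EmapE// ltW.
have h := is_deriveD (is_derive_cst pperp z v)
  (is_derive_vec (is_deriveZ c (is_derive_reM v zd)) (is_deriveZ c (is_derive_imM v zd))).
apply: is_derive_eq h _; rewrite add0r /vec /k /GRing.scale/=.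
by rewrite !mulrA.
Qed.

(** Under the identification of the span of [e1], [e2] with the complex numbers the map is
    holomorphic up to a constant, so each y-derivative is i times the x-derivative; the pure second
    derivatives are [k2] W^3 and its opposite. *)
Lemma harmonic_Emap : Defs.harmonic (Emap pperp e1 e2 c s).
Proof.
have dP (a : R) z v : unit_disk R z -> is_derive z v (fun z => a * reW2 z)
    (a * (-2 * s * (v.1 * reW3 z - v.2 * imW3 z))).
  by move=> zd; exact: (is_deriveZ a (is_derive_reW2 v zd)).
have dQ (a : R) z v : unit_disk R z -> is_derive z v (fun z => a * imW2 z)
    (a * (-2 * s * (v.1 * imW3 z + v.2 * reW3 z))).
  by move=> zd; exact: (is_deriveZ a (is_derive_imW2 v zd)).
have cM (a : R) (f : R * R -> R) z : {for z, continuous f} ->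
  {for z, continuous (fun x => a * f x)}.
  by move=> cf; apply: cvgM; [exact: cvg_cst|exact: cf].
apply: (@harmonic_of _ _ _
  (vec (fun z => k * reW2 z) (fun z => k * imW2 z))
  (vec (fun z => - k * imW2 z) (fun z => k * reW2 z))
  (vec (fun z => k2 * reW3 z) (fun z => k2 * imW3 z))
  (vec (fun z => - k2 * imW3 z) (fun z => k2 * reW3 z))
  (vec (fun z => - k2 * imW3 z) (fun z => k2 * reW3 z))
  (vec (fun z => - k2 * reW3 z) (fun z => - k2 * imW3 z))).
- move=> z zd; apply: is_derive_eq (is_derive_Emap (e_x R) zd) _.
  by rewrite /vec /=; congr (_ *: _ + _ *: _); ring.
- move=> z zd; apply: is_derive_eq (is_derive_Emap (e_y R) zd) _.
  by rewrite /vec /=; congr (_ *: _ + _ *: _); ring.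
- move=> z zd; apply: is_derive_eq (is_derive_vec (dP k z _ zd) (dQ k z _ zd)) _.
  by rewrite /vec /k2 /=; congr (_ *: _ + _ *: _); ring.
- move=> z zd; apply: is_derive_eq (is_derive_vec (dP k z _ zd) (dQ k z _ zd)) _.
  by rewrite /vec /k2 /=; congr (_ *: _ + _ *: _); ring.
- move=> z zd; apply: is_derive_eq (is_derive_vec (dQ (- k) z _ zd) (dP k z _ zd)) _.
  by rewrite /vec /k2 /=; congr (_ *: _ + _ *: _); ring.
- move=> z zd; apply: is_derive_eq (is_derive_vec (dQ (- k) z _ zd) (dP k z _ zd)) _.
  by rewrite /vec /k2 /=; congr (_ *: _ + _ *: _); ring.
- by move=> z zd; apply: continuous_vec; apply: cM;
    by [exact: continuous_reW2|exact: continuous_imW2].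
- by move=> z zd; apply: continuous_vec; apply: cM;
    by [exact: continuous_reW2|exact: continuous_imW2].
- by move=> z zd; apply: continuous_vec; apply: cM;
    by [exact: continuous_reW3|exact: continuous_imW3].
- by move=> z zd; apply: continuous_vec; apply: cM;
    by [exact: continuous_reW3|exact: continuous_imW3].
- by move=> z zd; apply: continuous_vec; apply: cM;
    by [exact: continuous_reW3|exact: continuous_imW3].
- by move=> z zd; apply: continuous_vec; apply: cM;
    by [exact: continuous_reW3|exact: continuous_imW3].
- move=> z zd; rewrite /vec addrACA -!scalerDl.
  by rewrite subrr !scale0r addr0.
Qed.

Lemma unit_disk0 : unit_disk R 0.
Proof. by rewrite /unit_disk/= enorm0. Qed.

Lemma Emap_derive0 v : 'D_v (Emap pperp e1 e2 c s) 0 = (k * v.1) *: e1 + (k * v.2) *: e2.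
Proof.
have [_ ->] := is_derive_Emap v unit_disk0.
rewrite /vec /reW2 /imW2 /reW /imW /emap_den /=.
by congr (_ *: _ + _ *: _); field.
Qed.

Lemma Emap0 : Emap pperp e1 e2 c s 0 = pperp + (c * s) *: e1.
Proof.
rewrite EmapE ?enorm0// /vec /reM /imM /=.
by rewrite !mul0r subrr addr0 !mulr0 addr0 scale0r addr0.
Qed.

End hilbert.

End extremal_map.

(** * Moments of the boundary function *)

Section boundary_moments.
Context (R : realType) (H : completeNormedModType R) (ip : {dot H for @idfun R}).
Hypothesis hip : forall x : H, ip x x = `|x| ^+ 2.
Local Notation cm := (circle_measure R).
Implicit Types (F Phi : R * R -> H) (z u : R * R) (w : H).

(** By uniqueness the function selected by [xget] agrees almost everywhere with the limit of
    dilates, which lies in the closure of [G]. *)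
Lemma boundary_functionP F (C : R) (G : set H) : Defs.harmonic F ->
  (forall z, unit_disk R z -> `|F z| <= C) -> (forall z, unit_disk R z -> G (F z)) ->
  [/\ Linfty cm (boundary_function F), is_poisson_integral (boundary_function F) F &
      {ae cm, forall zeta, closure G (boundary_function F zeta)}].
Proof.
move=> hF FC FG.
have [Phi [rn [LPhi rn01 rn1 dPhi]]] := boundary_limit_exists hip hF FC.
have PPhi := boundary_limit_poisson hip hF FC LPhi rn01 rn1 dPhi.
have : [set Phi | Linfty cm Phi /\ is_poisson_integral Phi F] (boundary_function F).
  by apply: (xgetPex (fun=> 0)); exists Phi; split.
move=> [LB PB]; split => //.
have E := poisson_boundary_unique hip LPhi LB PPhi PB.
apply: filterS2 dPhi E => zeta dz <-.
apply: (closed_cvg (closure G) _ _ _ dz); first exact: closed_closure.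
apply: nearW => n; apply: subset_closure; apply: FG.
have /andP[r0 r1] := rn01 n.
rewrite /unit_disk/= enormZ gtr0_norm//.
apply: le_lt_trans r1; rewrite ler_piMr ?(ltW r0)//; exact: enorm_retract.
Qed.

(** Poisson representation by a bounded everywhere-defined representative, tested against vectors:
    the form in which boundary data are used from here on. *)
Definition weak_poisson F Phi := bsm Phi /\
  forall z w, enorm z < 1 -> ip (F z) w = \int[cm]_eta (pk z eta * ip (Phi eta) w).

Lemma weak_poisson_mean F Phi w : weak_poisson F Phi ->
  ip (F 0) w = \int[cm]_eta ip (Phi eta) w.
Proof.
move=> [_ ->]; last by rewrite enorm0.
apply: eq_Rintegral => eta _.
by rewrite /pk /pkr /edot enorm0 /= !mul0r addr0 mulr0 !subr0 expr1n expr0n addr0 maxxx subr0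
  divr1 mul1r.
Qed.

(** The radial derivative of the kernel at the origin is 2 x. After simplification the error is h
    times a fraction whose numerator is at most 8 in size and whose denominator is at least (1 -
    |h|)^2 >= 1/4. *)
Lemma poisson_difference_quotient (x h : R) : `|x| <= 1 -> h != 0 -> `|h| <= 2^-1 ->
  `|h^-1 * ((1 - h ^+ 2) / (1 - 2 * (h * x) + h ^+ 2) - 1) - 2 * x| <= 32 * `|h|.
Proof.
move=> x1 h0 h2.
have hx : `|h * x| <= `|h| by rewrite normrM ler_piMr.
have D0 : 4^-1 <= 1 - 2 * (h * x) + h ^+ 2.
  have : h * x <= `|h| by rewrite (le_trans _ hx)// ler_norm.
  have := real_normK (num_real h).
  have : 0 <= `|h| by [].
  nra.
rewrite (_ : _ - _ = h * ((-2 + 4 * x ^+ 2 - 2 * (h * x)) / (1 - 2 * (h * x) + h ^+ 2)));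
  last first.
  by field; rewrite h0 andbT gt_eqF//; lra.
rewrite normrM mulrC ler_wpM2r// normrM normfV (@gtr0_norm _ (1 - _ + _)); last by lra.
rewrite ler_pdivrMr; last by lra.
apply: (@le_trans _ _ 8); last by lra.
have : x ^+ 2 <= 1 by rewrite -real_normK ?num_real// exprn_ile1.
have := sqr_ge0 x.
have := le_trans hx h2; rewrite ler_norml => /andP[hx1 hx2] xx0 xx1.
by rewrite ler_norml; apply/andP; split; lra.
Qed.

(** [retract] bounds this coordinate on the plane without changing it on the circle. *)
Lemma bmeas_edot_retract u : enorm u = 1 -> bmeas (fun eta => edot u (retract eta)).
Proof.
move=> u1; split.
  apply: continuous_measurable_plane => z.
  by apply: continuous_comp; [exact: continuous_retract|exact: continuous_edot].
exists 1 => eta; rewrite (le_trans (edot_le _ _))// u1 mul1r; exact: enorm_retract.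
Qed.

(** The derivative exists by hypothesis and is identified as a limit of difference quotients; these
    converge under the integral because the kernel estimate is uniform in [eta]. *)
Lemma weak_poisson_derivative F Phi u w : differentiable F 0 -> weak_poisson F Phi ->
  enorm u = 1 ->
  ip ('D_u F 0) w = 2 * \int[cm]_eta (edot u (retract eta) * ip (Phi eta) w).
Proof.
move=> dF [bP hP] u1.
have bg : bmeas (fun eta => ip (Phi eta) w) := bsm_ipl hip w bP.
have [M0 gM0] := bg.2.
have [M M1 gM] : exists2 M : R, 0 < M & forall eta, `|ip (Phi eta) w| <= M.
  exists (Num.max 1 M0); first by rewrite lt_max ltr01.
  by move=> eta; rewrite le_max gM0 orbT.
have ed1 eta : `|edot u (retract eta)| <= 1.
  by rewrite (le_trans (edot_le _ _))// u1 mul1r enorm_retract.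
have bx := bmeas_edot_retract u1.
have du : derivable F 0 u by exact: diff_derivable.
have [dip Dip] := derivable_ip hip w du.
rewrite -Dip.
suff lim_quot : (h^-1 * (ip (F (h *: u + 0)) w - ip (F 0) w) : R) @[h --> (0 : R)^'] -->
    (2 * \int[cm]_eta (edot u (retract eta) * ip (Phi eta) w)).
  exact: (cvg_unique (@norm_hausdorff _ R^o) dip lim_quot).
apply/cvgrPdist_le => e e0.
near=> h.
have h0 : h != 0 by near: h; exact: nbhs_dnbhs_neq.
have h2 : `|h| <= 2^-1.
  near: h; apply: dnbhs0_le; by rewrite invr_gt0.
have hu : enorm (h *: u) < 1 by rewrite enormZ u1 mulr1; apply: le_lt_trans h2 _; lra.
rewrite /= addr0 (hP _ _ hu) (hP 0)//; last by rewrite enorm0.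
have b1 := bmeasM (bmeas_pk hu) bg.
have u0 : enorm (0 : R * R) < 1 by rewrite enorm0.
have b2 := bmeasM (bmeas_pk u0) bg.
have b3 := bmeasM bx bg.
rewrite -(bintB _ b1 b2) /GRing.scale/= -(bintZ _ _ (bmeasB b1 b2)) -(bintZ _ _ b3).
rewrite -(bintB _ (bmeasZ _ b3) (bmeasZ _ (bmeasB b1 b2))).
apply: (@le_trans _ _ (32 * `|h| * M)); last first.
  rewrite mulrAC -ler_pdivlMl ?mulr_gt0//.
  near: h; apply: dnbhs0_le; by rewrite mulr_gt0// invr_gt0 mulr_gt0.
apply: bint_norm_le; first exact: bmeasB (bmeasZ _ b3) (bmeasZ _ (bmeasB b1 b2)).
apply: filterS (ae_circle R) => eta eta1.
rewrite retract_id ?eta1//.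
rewrite (pkE _ eta1) (pkE _ eta1) /poisson_kernel enorm0 enormZ u1 mulr1 edotZl.
rewrite real_normK ?num_real//.
rewrite (_ : edot 0 eta = 0); last by rewrite /edot /= !mul0r addr0.
rewrite expr0n /= !mulr0 !subr0 addr0 divr1 mul1r.
rewrite (_ : _ - _ = - ((h^-1 * ((1 - h ^+ 2) / (1 - 2 * (h * edot u eta) + h ^+ 2) - 1)
   - 2 * edot u eta) * ip (Phi eta) w)); last by ring.
rewrite normrN normrM ler_pM// poisson_difference_quotient//.
by have := ed1 eta; rewrite retract_id ?eta1.
Unshelve. all: by end_near. Qed.

End boundary_moments.

(** * Orthonormal bases of the target plane and frames of the source plane *)

Section orthonormal_bases.
Context (R : realType) (H : completeNormedModType R) (ip : {dot H for @idfun R}).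
Hypothesis hip : forall x : H, ip x x = `|x| ^+ 2.
Implicit Types (e f u v w : H) (L : set H).

Lemma span2_subset u v u' v' : span2 u v u' -> span2 u v v' ->
  span2 u' v' `<=` span2 u v.
Proof.
move=> [x [y ->]] [z [t ->]] w [k [l ->]]; exists (k * x + l * z), (k * y + l * t).
by rewrite !scalerDr !scalerA !scalerDl addrACA.
Qed.

Lemma sqr_norm_combination e1 e2 (x y : R) : `|e1| = 1 -> `|e2| = 1 -> ip e1 e2 = 0 ->
  `|x *: e1 + y *: e2| ^+ 2 = x ^+ 2 + y ^+ 2.
Proof.
move=> n1 n2 e12; rewrite -hip !ipE (ipC _ e2 e1) e12 !hip n1 n2; ring.
Qed.

(** Gram-Schmidt applied to [f] and [v]; since [x != 0], these two vectors still span the plane. *)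
Lemma orthonormal_completion u v (x y : R) :
  (forall x y : R, x *: u + y *: v = 0 -> x = 0 /\ y = 0) ->
  x != 0 -> `|x *: u + y *: v| = 1 ->
  exists e2, orthonormal_basis2 ip (x *: u + y *: v) e2 (span2 u v).
Proof.
move=> uv x0; set f := x *: u + y *: v => f1.
pose w := v - ip v f *: f.
have w0 : w != 0.
  apply/eqP => w0.
  have : (- (ip v f * x)) *: u + (1 - ip v f * y) *: v = 0.
    rewrite -[RHS]w0 /w [in RHS]/f scalerDr !scalerA scalerBl scale1r scaleNr opprD.
    by rewrite addrCA.
  move=> /uv[/eqP]; rewrite oppr_eq0 mulf_eq0 (negbTE x0) orbF => /eqP ->.
  by rewrite mul0r subr0 => /eqP; rewrite oner_eq0.
have nw0 : `|w| != 0 by rewrite normr_eq0.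
exists (`|w|^-1 *: w); split => //.
- by rewrite normrZ normfV normr_id mulVf.
- by rewrite ipZr /w ipBr ipZr hip f1 expr1n mulr1 (ipC _ f v) subrr mulr0.
have Lu : span2 u v u by exists 1, 0; rewrite scale1r scale0r addr0.
have Lv : span2 u v v by exists 0, 1; rewrite scale1r scale0r add0r.
have Lf : span2 u v f by exists x, y.
have vE : v = ip v f *: f + `|w| *: (`|w|^-1 *: w).
  by rewrite scalerA mulfV// scale1r /w addrC subrK.
have fv : span2 f (`|w|^-1 *: w) v by exists (ip v f), `|w|.
have ff : span2 f (`|w|^-1 *: w) f by exists 1, 0; rewrite scale1r scale0r addr0.
apply/seteqP; split; apply: span2_subset => //.
  have uE : u = x^-1 *: f + (- (x^-1 * y)) *: v.
    by rewrite /f scalerDr !scalerA mulVf// scale1r scaleNr addrK.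
  rewrite [X in span2 _ _ X]uE; apply: (span2_subset ff fv).
  by exists x^-1, (- (x^-1 * y)).
have wE : `|w|^-1 *: w = (- (`|w|^-1 * ip v f)) *: f + `|w|^-1 *: v.
  by rewrite {2}/w scalerBr scalerA scaleNr addrC.
rewrite wE; apply: (span2_subset Lf Lv).
by exists (- (`|w|^-1 * ip v f)), `|w|^-1.
Qed.

(** The first vector is [f] normalized, or [u] normalized when [f = 0]. If the coefficient on [u]
    vanishes, the roles of [u] and [v] are exchanged. *)
Lemma adapted_orthonormal_basis L f : two_dim_subspace L -> L f ->
  exists e1 e2, orthonormal_basis2 ip e1 e2 L /\ f = `|f| *: e1.
Proof.
move=> [u [v [uv ->]]].
have swap (x y : H) : span2 x y = span2 y x.
  by apply/seteqP; split => w [k [l ->]]; exists l, k; rewrite addrC.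
have unit_case g : `|g| = 1 -> span2 u v g -> exists e2, orthonormal_basis2 ip g e2 (span2 u v).
  move=> g1 [x [y gE]]; rewrite gE in g1 *.
  have [x0|x0] := eqVneq x 0; last exact: orthonormal_completion.
  have y0 : y != 0.
    apply/eqP => y0; move: g1; rewrite x0 y0 !scale0r addr0 normr0 => /eqP.
    by rewrite eq_sym oner_eq0.
  rewrite addrC swap; apply: orthonormal_completion => //; last by rewrite addrC.
  by move=> k l; rewrite addrC => /uv[-> ->].
have scaled (g : H) : g != 0 -> `| `|g|^-1 *: g| = 1.
  by move=> g0; rewrite normrZ normfV normr_id mulVf// normr_eq0.
have Lscaled (g : H) : span2 u v g -> span2 u v (`|g|^-1 *: g).
  by move=> [x [y ->]]; exists (`|x *: u + y *: v|^-1 * x), (`|x *: u + y *: v|^-1 * y);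
    rewrite scalerDr !scalerA.
move=> Lf; have [f0|f0] := eqVneq f 0; last first.
  have [e2 oe] := unit_case _ (scaled _ f0) (Lscaled _ Lf).
  by exists (`|f|^-1 *: f), e2; split => //; rewrite scalerA mulfV ?scale1r// normr_eq0.
have u0 : u != 0.
  apply/eqP => u0; have [|/eqP] := uv 1 0; last by rewrite oner_eq0.
  by rewrite u0 scaler0 scale0r addr0.
have Lu : span2 u v u by exists 1, 0; rewrite scale1r scale0r addr0.
have [e2 oe] := unit_case _ (scaled _ u0) (Lscaled _ Lu).
by exists (`|u|^-1 *: u), e2; split => //; rewrite f0 normr0 scale0r.
Qed.

End orthonormal_bases.

Section conformal_frame.
Context (R : realType) (H : completeNormedModType R) (ip : {dot H for @idfun R}).
Hypothesis hip : forall x : H, ip x x = `|x| ^+ 2.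
Implicit Types (F : R * R -> H) (u v : R * R).

Lemma harmonic_diff0 F : Defs.harmonic F -> differentiable F 0 /\
  'd F (0 : R * R) = lin2 ('D_(e_x R) F 0) ('D_(e_y R) F 0) :> (R * R -> H).
Proof. by move=> [[C1 _ _] _]; apply: (C1_diff hip C1); exact: unit_disk0. Qed.

Lemma dF0_normE F (lam : R) : 0 <= lam ->
  (forall v : R * R, `|'d F (0 : R * R) v| = lam * enorm v) -> dF0_norm F = lam.
Proof.
move=> l0 hl; apply/eqP; rewrite eq_le; apply/andP; split.
  apply: ge_sup; first by exists `|'d F (0 : R * R) 0|, 0 => //=; rewrite enorm0.
  by move=> _ [v /= v1 <-]; rewrite hl ler_piMr.
apply: ub_le_sup; last by exists (e_x R) => /=; rewrite ?hl enorm_ex ?mulr1.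
by exists lam => _ [v /= v1 <-]; rewrite hl ler_piMr.
Qed.

(** The frame consists of the preimages of [e1], [e2] under the differential, rescaled by its
    conformal factor; orthogonality follows by polarization from the length of the image of their
    sum. *)
Lemma conformal_frame G (p : H) L F e1 e2 : conformal_maps G p L F ->
  orthonormal_basis2 ip e1 e2 L -> 0 < dF0_norm F /\
  exists u1 u2 : R * R, [/\ enorm u1 = 1, enorm u2 = 1, edot u1 u2 = 0,
    'D_u1 F 0 = dF0_norm F *: e1 & 'D_u2 F 0 = dF0_norm F *: e2].
Proof.
move=> [hF _ _ [lam l0 hl] rL] [n1 n2 e12 LE].
rewrite (dF0_normE (ltW l0) hl); split => //.
have [dF dE] := harmonic_diff0 hF.
have : L e1 by rewrite LE; exists 1, 0; rewrite scale1r scale0r addr0.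
have : L e2 by rewrite LE; exists 0, 1; rewrite scale1r scale0r add0r.
rewrite -rL => -[v2 _ v2E] [v1 _ v1E].
have lv1 : lam * enorm v1 = 1 by rewrite -hl v1E.
have lv2 : lam * enorm v2 = 1 by rewrite -hl v2E.
have DE v : 'D_(lam *: v) F 0 = lam *: 'd F (0 : R * R) v.
  by rewrite deriveE// linearZ.
exists (lam *: v1), (lam *: v2).
rewrite !enormZ gtr0_norm// lv1 lv2 !DE v1E v2E; split => //.
have : `|'d F (0 : R * R) (v1 + v2)| ^+ 2 = 2.
  by rewrite linearD v1E v2E -hip !ipE (ipC _ e2 e1) e12 !hip n1 n2; ring.
rewrite hl exprMn sqr_enorm.
rewrite edotZl edotC edotZl.
have := congr1 (fun x => x ^+ 2) lv1; have := congr1 (fun x => x ^+ 2) lv2.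
rewrite !exprMn !sqr_enorm /edot /= expr1n => h2 h1 h3; lra.
Qed.

End conformal_frame.

(** * The gap function and its integral *)

Section gap.
Context (R : realType) (H : completeNormedModType R) (ip : {dot H for @idfun R}).
Hypothesis hip : forall x : H, ip x x = `|x| ^+ 2.
Local Notation cm := (circle_measure R).
Variables (e1 e2 pperp : H) (c s rho : R).
Hypotheses (n1 : `|e1| = 1) (n2 : `|e2| = 1).
Hypothesis pe1 : ip pperp e1 = 0.
Hypotheses (s01 : 0 <= s < 1) (rhoE : rho ^+ 2 = c ^+ 2 + `|pperp| ^+ 2).
Variables (F Phi : R * R -> H) (u1 u2 : R * R) (lam : R).
Hypotheses (dF : differentiable F 0) (wP : weak_poisson ip F Phi).
Hypotheses (F0 : F 0 = pperp + (c * s) *: e1).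
Hypotheses (u1n : enorm u1 = 1) (u2n : enorm u2 = 1) (u12 : edot u1 u2 = 0).
Hypotheses (Du1 : 'D_u1 F 0 = lam *: e1) (Du2 : 'D_u2 F 0 = lam *: e2).
Implicit Types eta : R * R.

(* A conformal map is normalized after an orthogonal change of variables, to
   which the weighted functional is transported. *)
Definition frame_coord eta : R * R := (edot u1 eta, edot u2 eta).

Lemma enorm_frame_coord eta : enorm (frame_coord eta) = enorm eta.
Proof.
rewrite /enorm; congr Num.sqrt.
move: u1n u2n u12 => /(congr1 (fun x => x ^+ 2)) + /(congr1 (fun x => x ^+ 2)).
rewrite !sqr_enorm /frame_coord /edot /= expr1n.
case: u1 u2 eta => [p q] [r t] [x y] /= pq rt prqt.
(* Orthonormality forces the second frame vector to be d (- q, p), where the determinant d satisfies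
   d^2 = 1; both orientations are covered. *)
have rE : r = - q * (p * t - q * r).
  rewrite -[LHS]mulr1 -pq; apply/eqP; rewrite -subr_eq0; apply/eqP.
  by rewrite -[RHS](mulr0 p) -prqt; ring.
have tE : t = p * (p * t - q * r).
  rewrite -[LHS]mulr1 -pq; apply/eqP; rewrite -subr_eq0; apply/eqP.
  by rewrite -[RHS](mulr0 q) -prqt; ring.
have d1 : (p * t - q * r) ^+ 2 = 1.
  rewrite -[RHS]mulr1 -{1}pq -rt; apply/eqP; rewrite -subr_eq0; apply/eqP.
  by rewrite -[RHS](mulr0 (- (p * r + q * t))) -prqt; ring.
move: rE tE d1; set d := _ - _ => -> -> d1.
rewrite (_ : _ + _ = (p * x + q * y) ^+ 2 + d ^+ 2 * (p * y - q * x) ^+ 2); last by ring.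
rewrite d1 mul1r (_ : _ + _ = (p ^+ 2 + q ^+ 2) * (x ^+ 2 + y ^+ 2)); last by ring.
by rewrite pq mul1r.
Qed.

Let x1 eta := edot u1 (retract eta).
Let x2 eta := edot u2 (retract eta).

(* The weight turns the Moebius map into a trigonometric polynomial of degree 1,
   so that the integral of the gap only involves [F 0] and ['d F 0]. *)
Definition gap eta : R :=
  (1 + s ^+ 2) * rho ^+ 2 + 2 * s * rho ^+ 2 * x1 eta
  - ((1 + s ^+ 2) * ip (Phi eta) pperp + 2 * s * (x1 eta * ip (Phi eta) pperp))
  - (2 * s * c * ip (Phi eta) e1 + c * (1 + s ^+ 2) * (x1 eta * ip (Phi eta) e1))
  - c * (1 - s ^+ 2) * (x2 eta * ip (Phi eta) e2).

(** Uses the trigonometric forms of the weight and of its products with the real and imaginary parts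
    of the Moebius map, at the rotated point. *)
Lemma gapE eta : enorm eta = 1 ->
  gap eta = weight s (frame_coord eta) *
    (rho ^+ 2 - ip (Phi eta) (Emap pperp e1 e2 c s (frame_coord eta))).
Proof.
move=> eta1; have xi1 : enorm (frame_coord eta) = 1 by rewrite enorm_frame_coord.
rewrite (EmapE s01) ?xi1// weightE /vec !ipE.
have W1 := weight_reM s01 xi1; have W2 := weight_imM s01 xi1.
have W := weight_circle s xi1.
rewrite (_ : _ * (_ - _) = emap_den s (frame_coord eta) * (rho ^+ 2 - ip (Phi eta) pperp)
  - c * (emap_den s (frame_coord eta) * reM s (frame_coord eta)) * ip (Phi eta) e1
  - c * (emap_den s (frame_coord eta) * imM s (frame_coord eta)) * ip (Phi eta) e2); last by ring.
rewrite W1 W2 W /gap /x1 /x2 retract_id ?eta1// /=; ring.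
Qed.

Let bx1 : bmeas x1 := bmeas_edot_retract u1n.
Let bx2 : bmeas x2 := bmeas_edot_retract u2n.
Let bP v : bmeas (fun eta => ip (Phi eta) v) := bsm_ipl hip v wP.1.

Lemma bmeas_gap : bmeas gap.
Proof.
by do !first [exact: bmeas_cst | exact: bP | exact: bx1 | exact: bx2
  | apply: bmeasB | apply: bmeasD | apply: bmeasZ | apply: bmeasM].
Qed.

(** The derivative formula applied to the constant map [e1], which is its own boundary function and
    has zero derivative. *)
Lemma int_edot_retract : \int[cm]_eta x1 eta = 0.
Proof.
have wc : weak_poisson ip (fun=> e1) (fun=> e1).
  split; first exact: bsm_cst.
  move=> z w z1; rewrite -[LHS]mulr1 -(int_pk z1) -(bintZ _ _ (bmeas_pk z1)).
  by apply: eq_Rintegral => eta _; rewrite mulrC.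
have := weak_poisson_derivative hip e1 (differentiable_cst e1 (0 : R * R)) wc u1n.
rewrite derive_cst ip0l hip n1 expr1n => /esym/eqP.
rewrite mulf_eq0 pnatr_eq0 /= => /eqP h.
by rewrite -[RHS]h; apply: eq_Rintegral => eta _; rewrite mulr1.
Qed.

Lemma int_gap : \int[cm]_eta gap eta = c * (c * (1 - s ^+ 2) - lam).
Proof.
have m0 v := weak_poisson_mean v wP.
have m1 v := weak_poisson_derivative hip v dF wP u1n.
have m2 v := weak_poisson_derivative hip v dF wP u2n.
have bxP v := bmeasM bx1 (bP v).
have byP v := bmeasM bx2 (bP v).
have bC (k : R) : bmeas (fun _ : R * R => k) by exact: bmeas_cst.
have b1 := bmeasD (bC ((1 + s ^+ 2) * rho ^+ 2)) (bmeasZ (2 * s * rho ^+ 2) bx1).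
have b2 := bmeasD (bmeasZ (1 + s ^+ 2) (bP pperp)) (bmeasZ (2 * s) (bxP pperp)).
have b3 := bmeasD (bmeasZ (2 * s * c) (bP e1)) (bmeasZ (c * (1 + s ^+ 2)) (bxP e1)).
have b4 := bmeasZ (c * (1 - s ^+ 2)) (byP e2).
rewrite /gap (bintB _ (bmeasB (bmeasB b1 b2) b3) b4) (bintB _ (bmeasB b1 b2) b3) (bintB _ b1 b2).
rewrite (bintD _ (bC _) (bmeasZ _ bx1)) bint_cst (bintZ _ _ bx1) int_edot_retract.
rewrite (bintD _ (bmeasZ _ (bP _)) (bmeasZ _ (bxP _))) (bintZ _ _ (bP _)) (bintZ _ _ (bxP _)).
rewrite (bintD _ (bmeasZ _ (bP _)) (bmeasZ _ (bxP _))) (bintZ _ _ (bP _)) (bintZ _ _ (bxP _)).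
rewrite (bintZ _ _ (byP _)).
have := m0 pperp; have := m0 e1; have := m1 pperp; have := m1 e1; have := m2 e2.
rewrite F0 Du1 Du2 !ipE (ipC _ e1 pperp) pe1 !hip n1 n2 !expr1n !mulr1 !mulr0 addr0 add0r.
rewrite -/x1 -/x2 => i5 i4 i3 i2 i1.
(* The first moments are half the directional derivatives, so the last two terms of the gap
   contribute c (1 + s^2) lam / 2 and c (1 - s^2) lam / 2, in total c lam. The rest is (1 + s^2) c^2
   - 2 s^2 c^2. *)
have half (a b : R) : a = 2 * b -> b = a / 2 by move=> ->; field.
rewrite -i1 -i2 (half _ _ i3) (half _ _ i4) (half _ _ i5) rhoE; by field.
Qed.

End gap.

(** * The extremal problem *)

Section extremal_problem.
Context (R : realType) (H : completeNormedModType R) (ip : {dot H for @idfun R}).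
Hypothesis hip : forall x : H, ip x x = `|x| ^+ 2.
Local Notation cm := (circle_measure R).
Variables (G : set H) (p : H) (L : set H) (pL pperp e1 e2 : H) (c s rho : R).
Hypotheses (bG : bounded_set G) (hp : G p) (hpdec : p = pL + pperp).
Hypothesis hpperp : forall v, L v -> ip pperp v = 0.
Hypothesis hc : 0 < c.
Hypothesis hslice : G `&` [set p + v | v in L] =
  [set pperp + v | v in [set v | L v /\ `|v| < c]].
Hypotheses (sE : s = `|pL| / c) (rhoE : rho ^+ 2 = c ^+ 2 + `|pperp| ^+ 2).
Hypothesis hsupp : forall v, L v -> `|v| = c ->
  forall X, closure G X -> ip X (pperp + v) <= rho ^+ 2.
Hypotheses (oe : orthonormal_basis2 ip e1 e2 L) (pLE : pL = `|pL| *: e1).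
Implicit Types (F Phi : R * R -> H) (z eta : R * R).

Let E := Emap pperp e1 e2 c s.
Let k := c * (1 - s ^+ 2).

Let n1 : `|e1| = 1. Proof. by case: oe. Qed.
Let n2 : `|e2| = 1. Proof. by case: oe. Qed.
Let e12 : ip e1 e2 = 0. Proof. by case: oe. Qed.
Let LE : L = span2 e1 e2. Proof. by case: oe. Qed.
Let L_comb (x y : R) : L (x *: e1 + y *: e2). Proof. by rewrite LE; exists x, y. Qed.
Let L1 : L e1. Proof. by rewrite -[e1]addr0 -[X in _ + X](scale0r e2) -[X in X + _]scale1r. Qed.
Let pe1 : ip pperp e1 = 0. Proof. exact: hpperp. Qed.

(** The point [p] itself belongs to the slice, so the length of [pL] is less than [c]. *)
Lemma slice_ratio : 0 <= s < 1.
Proof.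
have : (G `&` [set p + v | v in L]) p.
  split=> //; exists 0; last by rewrite addr0.
  by rewrite -(addr0 0) -[X in X + _](scale0r e1) -[X in _ + X](scale0r e2).
rewrite hslice => -[v [_ vc]] pv.
have vE : v = pL by apply: (@addrI _ pperp); rewrite pv hpdec addrC.
by rewrite sE divr_ge0 ?(ltW hc)//= ltr_pdivrMr// mul1r -vE.
Qed.
Let s01 := slice_ratio.

Lemma base_point : p = pperp + (c * s) *: e1.
Proof. by rewrite sE mulrC divfK ?gt_eqF// -pLE addrC. Qed.

Lemma Emap_slice z : enorm z <= 1 -> exists v,
  [/\ E z = pperp + v, L v & `|v| ^+ 2 = c ^+ 2 * (reM s z ^+ 2 + imM s z ^+ 2)].
Proof.
move=> z1; exists (vec e1 e2 (fun z => c * reM s z) (fun z => c * imM s z) z).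
split; first by rewrite /E (EmapE s01).
  exact: L_comb.
by rewrite (sqr_norm_combination hip _ _ n1 n2 e12); ring.
Qed.

Lemma Emap_disk z : unit_disk R z -> G (E z).
Proof.
move=> zd; have z1 : enorm z < 1 := zd.
have [v [-> Lv vE]] := Emap_slice (ltW z1).
suff : (G `&` [set p + v | v in L]) (pperp + v) by case.
rewrite hslice; exists v => //; split => //.
rewrite -ltr_sqr ?nnegrE ?(ltW hc)// vE -[ltRHS]mulr1 ltr_pM2l ?exprn_gt0//.
rewrite -subr_gt0 (modulus_reM_imM s01) ?(ltW z1)//.
have /andP[s0 s1] := s01.
rewrite divr_gt0 ?(emap_den_gt0 s01) ?(ltW z1)// mulr_gt0// subr_gt0 expr_lt1//.
Qed.

(** On the unit circle the Moebius factor has modulus 1, so [E z] lies on the boundary circle of the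
    slice, where the support hypothesis applies. *)
Lemma Emap_support z X : enorm z = 1 -> closure G X -> ip X (E z) <= rho ^+ 2.
Proof.
move=> z1; have z1' : enorm z <= 1 by rewrite z1.
have [v [-> Lv vE]] := Emap_slice z1'.
apply: hsupp => //; apply/eqP; rewrite -(@eqrXn2 _ 2)// ?(ltW hc)// vE.
have := modulus_reM_imM s01 z1'.
rewrite z1 expr1n subrr mulr0 mul0r => /eqP; rewrite subr_eq0 => /eqP <-.
by rewrite mulr1.
Qed.

Lemma k_gt0 : 0 < k.
Proof. by have /andP[s0 s1] := s01; rewrite mulr_gt0// subr_gt0 expr_lt1. Qed.

Lemma Emap_conformal : conformal_maps G p L E /\ dF0_norm E = k.
Proof.
have hE : Defs.harmonic E := harmonic_Emap s01 pperp e1 e2 c.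
have [dE dEE] := harmonic_diff0 hip hE.
have dEv v : 'd E (0 : R * R) v = (k * v.1) *: e1 + (k * v.2) *: e2.
  by rewrite -deriveE// (Emap_derive0 s01).
have nE v : `|'d E (0 : R * R) v| = k * enorm v.
  have k0 := ltW k_gt0.
  apply/eqP; rewrite -(@eqrXn2 _ 2)// ?(mulr_ge0 k0)//.
  by rewrite dEv (sqr_norm_combination hip _ _ n1 n2 e12) [X in _ == X]exprMn sqr_enorm;
    apply/eqP; ring.
split; last by rewrite (dF0_normE (ltW k_gt0) nE).
split => //; first exact: Emap_disk.
- by rewrite /E (Emap0 s01) -base_point.
- by exists k => //; exact: k_gt0.
apply/seteqP; split => [_ [v _ <-]|w]; first by rewrite dEv; exact: L_comb.
rewrite LE => -[x [y ->]]; exists (k^-1 * x, k^-1 * y) => //.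
by rewrite dEv /= !mulrA mulfV ?gt_eqF ?k_gt0// !mul1r.
Qed.

Lemma Emap_normalized : normalized_maps G p L e1 e2 E.
Proof.
have [cE nE] := Emap_conformal; split => //; first by rewrite nE k_gt0.
  by rewrite (Emap_derive0 s01) nE /= mulr1 mulr0 scale0r addr0.
by rewrite (Emap_derive0 s01) nE /= mulr1 mulr0 scale0r add0r.
Qed.

Lemma boundary_representative F : conformal_maps G p L F -> exists Phi,
  [/\ weak_poisson ip F Phi, {ae cm, forall eta, boundary_function F eta = Phi eta} &
      {ae cm, forall eta, closure G (Phi eta)}].
Proof.
move=> [hF FG _ _ _].
have [M [_ hM]] := bG.
have FC z : unit_disk R z -> `|F z| <= M + 1.
  by move=> zd; apply: hM (FG z zd); rewrite ltrDl.
have [LB PB GB] := boundary_functionP hip hF FC FG.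
have [Phi bP BP] := Linfty_bsm LB.
exists Phi; split => //; last by apply: filterS2 BP GB => eta ->.
by split => // z w z1; exact: (poisson_integral_weak hip w PB bP BP z1).
Qed.

Lemma gap_ge0 Phi u1 u2 : enorm u1 = 1 -> enorm u2 = 1 -> edot u1 u2 = 0 ->
  {ae cm, forall eta, closure G (Phi eta)} ->
  {ae cm, forall eta, 0 <= gap ip e1 e2 pperp c s rho Phi u1 u2 eta}.
Proof.
move=> u1n u2n u12 GP; apply: filterS2 GP (ae_circle R) => eta GPe eta1.
have xi1 : enorm (frame_coord u1 u2 eta) = 1 by rewrite enorm_frame_coord.
rewrite gapE//.
rewrite mulr_ge0//; first by rewrite weightE ltW// (emap_den_gt0 s01) ?xi1.
by rewrite subr_ge0; exact: Emap_support.
Qed.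

(** The map need not be normalized: the gap is taken in a frame adapted to its differential, and
    nonnegativity of its integral is the bound. *)
Lemma dF0_norm_le F : conformal_maps G p L F -> dF0_norm F <= k.
Proof.
move=> cF; have [Phi [wP _ GP]] := boundary_representative cF.
have [_ [u1 [u2 [u1n u2n u12 D1 D2]]]] := conformal_frame hip cF oe.
have [hF _ F0 _ _] := cF.
have [dF _] := harmonic_diff0 hip hF.
have I := int_gap hip n1 n2 pe1 rhoE dF wP (etrans F0 base_point) u1n u2n D1 D2.
have gap0 := gap_ge0 u1n u2n u12 GP.
have bg := bmeas_gap hip e1 e2 pperp c s rho wP u1n u2n.
have := ae_le_bint (bmeas_cst _ (0 : R)) bg gap0.
by rewrite bint_cst I pmulr_rge0// subr_ge0.
Qed.

Lemma M_G_value : M_G G p L = k%:E.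
Proof.
apply/eqP; rewrite eq_le; apply/andP; split.
  by apply: ge_ereal_sup => _ [F cF <-]; rewrite lee_fin dF0_norm_le.
have [cE nE] := Emap_conformal.
by apply: ereal_sup_ubound; exists E => //; rewrite nE.
Qed.

Section normalized.
Variables (F Phi : R * R -> H).
Hypotheses (nF : normalized_maps G p L e1 e2 F) (wP : weak_poisson ip F Phi).
Hypothesis BP : {ae cm, forall eta, boundary_function F eta = Phi eta}.
Hypothesis GP : {ae cm, forall eta, closure G (Phi eta)}.

Let g := gap ip e1 e2 pperp c s rho Phi (e_x R) (e_y R).

Lemma edot_exy : edot (e_x R) (e_y R) = 0.
Proof. by rewrite /edot /= mulr0 mul0r addr0. Qed.

Lemma frame_coord_exy eta : frame_coord (e_x R) (e_y R) eta = eta.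
Proof. by case: eta => x y; rewrite /frame_coord /edot /= !mul1r !mul0r addr0 add0r. Qed.

Lemma gap_normalizedE eta : enorm eta = 1 ->
  g eta = weight s eta * (rho ^+ 2 - ip (Phi eta) (E eta)).
Proof.
move=> eta1; rewrite /g gapE ?enorm_ex ?enorm_ey ?edot_exy//.
by rewrite frame_coord_exy.
Qed.

Lemma int_gap_normalized : \int[cm]_eta g eta = c * (k - dF0_norm F).
Proof.
have [[hF _ F0 _ _] _ D1 D2] := nF.
have [dF _] := harmonic_diff0 hip hF.
exact: (int_gap hip n1 n2 pe1 rhoE dF wP (etrans F0 base_point) (enorm_ex R) (enorm_ey R) D1 D2).
Qed.

Let bg : bmeas g := bmeas_gap hip e1 e2 pperp c s rho wP (enorm_ex R) (enorm_ey R).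

(** The integrand is [rho ^+ 2] times the weight minus the gap, and the weight has mean 1 + s^2
    because its degree 1 term integrates to 0. *)
Lemma I_s_value : I_s ip pperp e1 e2 c s (boundary_function F) =
  (1 + s ^+ 2) * rho ^+ 2 - c * (k - dF0_norm F).
Proof.
have bx := bmeas_edot_retract (enorm_ex R).
have bC (x : R) : bmeas (fun _ : R * R => x) by exact: bmeas_cst.
rewrite -int_gap_normalized /I_s.
have -> : (1 + s ^+ 2) * rho ^+ 2 = \int[cm]_eta ((1 + s ^+ 2) * rho ^+ 2
    + 2 * s * rho ^+ 2 * edot (e_x R) (retract eta)).
  rewrite (bintD _ (bC _) (bmeasZ _ bx)) bint_cst (bintZ _ _ bx).
  by rewrite (int_edot_retract hip n1 (enorm_ex R)) mulr0 addr0.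
rewrite -(bintB _ (bmeasD (bC _) (bmeasZ _ bx)) bg).
apply: ae_eq_Rintegral; apply: filterS2 BP (ae_circle R) => eta -> eta1.
rewrite gap_normalizedE// retract_id ?eta1// weightE weight_circle//.
rewrite /edot /=; ring.
Qed.

Lemma extremal_iff_contact : dF0_norm F = k <->
  {ae cm, forall eta, contact_set ip G rho (E eta) (boundary_function F eta)}.
Proof.
have w0 eta : enorm eta = 1 -> 0 < weight s eta.
  by move=> eta1; rewrite weightE (emap_den_gt0 s01) ?eta1.
split=> [lk|contact].
  (* The gap is nonnegative only almost everywhere, hence the passage to its absolute value before
     concluding that it vanishes; the positive weight is then divided out. *)
  have I0 : \int[cm]_eta `|g eta| = 0.
    rewrite -[RHS](mulr0 c) -(subrr k) -[X in k - X]lk -int_gap_normalized.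
    apply: ae_eq_Rintegral; apply: filterS (gap_ge0 (enorm_ex R) (enorm_ey R) edot_exy GP) => eta.
    by move=> g0; rewrite ger0_norm.
  have G0 := bint_eq0 (bmeas_norm bg) (fun eta => normr_ge0 _) I0.
  apply: filterS2 (filterI BP GP) (filterI G0 (ae_circle R)) => eta [-> GPe] [g0 eta1].
  split => //; move/eqP: g0; rewrite normr_eq0 gap_normalizedE// mulf_eq0 gt_eqF ?w0//=.
  by rewrite subr_eq0 => /eqP.
have : \int[cm]_eta g eta = 0.
  rewrite -(bint_cst cm 0); apply: ae_eq_Rintegral.
  apply: filterS2 (filterI BP contact) (ae_circle R) => eta [BPe []] _ + eta1.
  by rewrite BPe gap_normalizedE// => ->; rewrite subrr mulr0.
rewrite int_gap_normalized => /eqP; rewrite mulf_eq0 gt_eqF//= subr_eq0 => /eqP ->.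
by [].
Qed.

End normalized.

Lemma sigma_G_value : sigma_G ip G p L pperp e1 e2 c s = ((1 + s ^+ 2) * rho ^+ 2)%:E.
Proof.
apply/eqP; rewrite eq_le; apply/andP; split.
  apply: ge_ereal_sup => _ [F nF <-]; have [cF _ _ _] := nF.
  have [Phi [wP BP _]] := boundary_representative cF.
  rewrite lee_fin (I_s_value nF wP BP) gerBl mulr_ge0 ?(ltW hc)// subr_ge0.
  exact: dF0_norm_le.
have [cE nE] := Emap_conformal.
have [Phi [wP BP _]] := boundary_representative cE.
apply: ereal_sup_ubound; exists E; first exact: Emap_normalized.
by rewrite (I_s_value Emap_normalized wP BP) nE subrr mulr0 subr0.
Qed.

(** Since [E] is itself a normalized extremal, the contact criterion also determines its boundary
    function, without computing its radial limits. Both boundary functions agree, hence so do the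
    Poisson integrals. *)
Lemma extremal_unique F :
  {ae cm, forall eta, contact_set ip G rho (E eta) = [set E eta]} ->
  normalized_maps G p L e1 e2 F -> dF0_norm F = k ->
  forall z, unit_disk R z -> F z = E z.
Proof.
move=> single nF lF z zd.
have value F' : normalized_maps G p L e1 e2 F' -> dF0_norm F' = k -> exists Phi,
    weak_poisson ip F' Phi /\ {ae cm, forall eta, Phi eta = E eta}.
  move=> nF' lF'; have [cF _ _ _] := nF'.
  have [Phi [wP BP GP]] := boundary_representative cF.
  exists Phi; split => //.
  have contact := (extremal_iff_contact nF' wP BP GP).1 lF'.
  by apply: filterS2 (filterI BP single) contact => eta [<- ->].
have [P1 [w1 E1]] := value F nF lF.
have [P2 [w2 E2]] := value E Emap_normalized Emap_conformal.2.
apply/eqP; rewrite -subr_eq0; apply/eqP; apply: (ip_eq0 hip) => w.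
rewrite ipBl w1.2// w2.2//; apply/eqP; rewrite subr_eq0; apply/eqP.
by apply: ae_eq_Rintegral; apply: filterS2 E1 E2 => eta -> ->.
Qed.

End extremal_problem.

Theorem proposition4p5 (R : realType)
  (H : completeNormedModType R) (ip : {dot H for @idfun R})
  (hip : forall x : H, ip x x = `|x| ^+ 2)
  (G : set H) (hG : domain G) (bG : bounded_set G)
  (p : H) (hp : G p)
  (L : set H) (hL : two_dim_subspace L)
  (pL pperp : H) (hpdec : p = pL + pperp) (hpL : L pL)
  (hpperp : forall v, L v -> ip pperp v = 0)
  (a b : R) (ha : a = `|pL|) (hb : b = `|pperp|)
  (c : R) (hc : 0 < c)
  (hslice : G `&` [set p + v | v in L] =
            [set pperp + v | v in [set v | L v /\ `|v| < c]])
  (s rho : R) (hs : s = a / c) (hrho : rho = Num.sqrt (c ^+ 2 + b ^+ 2))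
  (hsupp : forall v, L v -> `|v| = c ->
     forall X, closure G X -> ip X (pperp + v) <= rho ^+ 2) :
  M_G G p L = ((rho ^+ 2 - `|p| ^+ 2) / c)%:E /\
  forall e1 e2 : H, orthonormal_basis2 ip e1 e2 L -> pL = a *: e1 ->
    let E := Emap pperp e1 e2 c s in
    let Fn := normalized_maps G p L e1 e2 in
    [/\ sigma_G ip G p L pperp e1 e2 c s = ((1 + s ^+ 2) * rho ^+ 2)%:E,
        forall F, Fn F ->
          ((dF0_norm F)%:E = M_G G p L <->
           {ae circle_measure R, forall zeta,
              contact_set ip G rho (E zeta) (boundary_function F zeta)}) &
        {ae circle_measure R, forall zeta,
           contact_set ip G rho (E zeta) = [set E zeta]} ->
          [/\ Fn E, (dF0_norm E)%:E = M_G G p L &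
              forall F, Fn F -> (dF0_norm F)%:E = M_G G p L ->
                forall z, unit_disk R z -> F z = E z]].
Proof.
subst a b.
have rhoE : rho ^+ 2 = c ^+ 2 + `|pperp| ^+ 2.
  by rewrite hrho sqr_sqrtr// addr_ge0 ?sqr_ge0.
have -> : (rho ^+ 2 - `|p| ^+ 2) / c = c * (1 - s ^+ 2).
  (* Pythagoras for the orthogonal decomposition of [p], with the length of [pL] equal to s c. *)
  have -> : `|p| ^+ 2 = (s * c) ^+ 2 + `|pperp| ^+ 2.
    rewrite -hip hpdec !ipE (ipC _ pL pperp) hpperp// !hip hs divfK ?gt_eqF//.
    by rewrite addr0 add0r.
  by rewrite rhoE; field; rewrite gt_eqF.
have M_GE e1 e2 : orthonormal_basis2 ip e1 e2 L -> pL = `|pL| *: e1 ->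
    M_G G p L = (c * (1 - s ^+ 2))%:E.
  by move=> oe pLE; exact: (M_G_value hip bG hp hpdec hpperp hc hslice hs rhoE hsupp oe pLE).
(* The value of [M_G] is stated without a basis, while its proof goes through the extremal map of
   one; an adapted basis is therefore constructed. *)
split; first by have [e1 [e2 [oe pLE]]] :=
  adapted_orthonormal_basis hip hL hpL; exact: M_GE oe pLE.
move=> e1 e2 oe pLE E Fn; rewrite (M_GE e1 e2)//.
have nE : Fn E := Emap_normalized hip hp hpdec hc hslice hs oe pLE.
have [_ lE] := Emap_conformal hip hp hpdec hc hslice hs oe pLE.
split.
- exact: (sigma_G_value hip bG hp hpdec hpperp hc hslice hs rhoE hsupp oe pLE).
- move=> F nF; have [cF _ _ _] := nF.
  have [Phi [wP BP GP]] := boundary_representative hip bG cF.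
  have iffF := extremal_iff_contact hip hp hpdec hpperp hc hslice hs rhoE hsupp oe pLE nF wP BP
    GP.
  split; first by move=> [lF]; apply/iffF.
  by move=> /iffF ->.
- move=> single; split => //; first by rewrite lE.
  move=> F nF [lF] z zd.
  exact: (extremal_unique hip bG hp hpdec hpperp hc hslice hs rhoE hsupp oe pLE single nF lF zd).
Qed.
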